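(* Let $d\ge1$, $\gamma>0$ and $f\in E^d_{\mathcal F}(\tanh2\gamma)$. Then there is $C>0$ (depending on $f,\gamma,d$) such that for all $\alpha\in\mathbb N_0^d$, $$|\langle f,\mathbf h_\alpha\rangle|\le C\, d^{|\alpha|}\,|\alpha|^{\frac{d-2}{4}}\,e^{-\gamma|\alpha|}.$$
   Context: Fourier transform $\hat f(\xi)=(2\pi)^{-d/2}\int e^{-i\xi\cdot x}f(x)dx$. For $a>0$ the Hardy class $E^d_{\mathcal F}(a)$ is the set of $f\in(L^1\cap L^2)(\mathbb R^d)$ such that for some $C>0$, $|f(x)|\le Ce^{-a|x|^2/2}$ and $|\hat f(\xi)|\le Ce^{-a|\xi|^2/2}$ for all $x,\xi$. Hermite functions $h_k(x)=(-1)^k(2^kk!\sqrt\pi)^{-1/2}e^{x^2/2}\frac{d^k}{dx^k}e^{-x^2}$, $\mathbf h_\alpha(x)=\prod_jh_{\alpha_j}(x_j)$; $|\alpha|=\alpha_1+\dots+\alpha_d$; $\langle f,g\rangle=\int f\bar g$.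
   Formalization: The bound is stated for α ≠ 0 only: at α = 0 the factor |α|^{(d-2)/4} is undefined for d = 1 and zero for d ≥ 3, where the bound fails (e.g. for f = e^{-|x|²/2}); f is taken Borel measurable. *)

(* Defs.v *)
From HB Require Import structures.
From mathcomp Require Import all_boot all_order all_algebra.
From mathcomp Require Import all_classical all_reals all_analysis.
From mathcomp Require Import complex.
Set Implicit Arguments. Unset Strict Implicit. Unset Printing Implicit Defensive.
Import Order.TTheory GRing.Theory Num.Theory.
Import numFieldNormedType.Exports.
Local Open Scope classical_set_scope.
Local Open Scope ring_scope.

Section Defs.
Variable R : realType.
Local Notation leb := (@lebesgue_measure R).

(* Iterated Lebesgue integral over R^n = n.-tuple R (extended-real valued,
   used for nonnegative integrands: by Tonelli it is the integral w.r.t.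
   the n-dimensional Lebesgue measure). *)
Fixpoint iintE (n : nat) : (n.-tuple R -> \bar R) -> \bar R :=
  match n return (n.-tuple R -> \bar R) -> \bar R with
  | 0 => fun F => F [tuple]
  | n'.+1 => fun F => (\int[leb]_t iintE (fun x => F (cons_tuple t x)))%E
  end.

(* Iterated real-valued Lebesgue integral over R^n (by Fubini it is the
   integral over R^n for integrable integrands). *)
Fixpoint iint (n : nat) : (n.-tuple R -> R) -> R :=
  match n return (n.-tuple R -> R) -> R with
  | 0 => fun F => F [tuple]
  | n'.+1 => fun F => Rintegral leb setT (fun t => iint (fun x => F (cons_tuple t x)))
  end.

Definition cint (n : nat) (F : n.-tuple R -> R[i]) : R[i] :=
  Complex (iint (fun x => complex.Re (F x))) (iint (fun x => complex.Im (F x))).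

Definition cmod (z : R[i]) : R := Num.sqrt (complex.Re z ^+ 2 + complex.Im z ^+ 2).

Definition sqnorm (n : nat) (x : n.-tuple R) : R := \sum_(i < n) tnth x i ^+ 2.
Definition dotp (n : nat) (x y : n.-tuple R) : R := \sum_(i < n) tnth x i * tnth y i.

Definition expi (t : R) : R[i] := Complex (cos t) (sin t).

Definition fourier (n : nat) (f : n.-tuple R -> R[i]) (xi : n.-tuple R) : R[i] :=
  Complex ((2 * pi) `^ (- (n%:R) / 2)) 0 * cint (fun x => f x * expi (- dotp xi x)).

Definition L1L2 (n : nat) (f : n.-tuple R -> R[i]) : Prop :=
  [/\ measurable_fun setT (fun x => complex.Re (f x)),
      measurable_fun setT (fun x => complex.Im (f x)),
      (iintE (fun x => (cmod (f x))%:E) < +oo)%E &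
      (iintE (fun x => (cmod (f x) ^+ 2)%:E) < +oo)%E].

Definition hardy_class (n : nat) (a : R) (f : n.-tuple R -> R[i]) : Prop :=
  L1L2 f /\
  exists C : R, 0 < C /\
    (forall x, cmod (f x) <= C * expR (- (a * sqnorm x) / 2)) /\
    (forall xi, cmod (fourier f xi) <= C * expR (- (a * sqnorm xi) / 2)).

Definition tanh (x : R) : R := (expR x - expR (- x)) / (expR x + expR (- x)).

Definition hermite (k : nat) (x : R) : R :=
  (-1) ^+ k * (Num.sqrt (2 ^+ k * (k`!)%:R * Num.sqrt pi))^-1 * expR (x ^+ 2 / 2)
  * derive1n k (fun t : R => expR (- t ^+ 2)) x.

Definition hermite_multi (n : nat) (al : n.-tuple nat) (x : n.-tuple R) : R :=
  \prod_(i < n) hermite (tnth al i) (tnth x i).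

Definition msize (n : nat) (al : n.-tuple nat) : nat := (\sum_(i < n) tnth al i)%N.

(* <f, g> = \int f conj(g); h_alpha is real-valued *)
Definition hermite_coef (n : nat) (f : n.-tuple R -> R[i]) (al : n.-tuple nat) : R[i] :=
  cint (fun x => f x * Complex (hermite_multi al x) 0).

End Defs.

(* Main.v *)
(* The Bargmann transform of f restricted to a real line, G(z) = B f(z x) with
   |x| = 1, has Taylor coefficients P_k(x), a homogeneous polynomial of degree k
   in x whose monomial coefficients are the Hermite coefficients of f up to
   normalization.  With beta = exp(-2 gamma), the decay of f gives
   |G(u + iv)| <= C exp((beta^2 u^2 + v^2)/2), and the decay of its Fourier
   transform the same bound with u and v exchanged.  On the rays
   theta = atan beta and theta = pi/2 - atan beta respectively, these exponents
   equal beta r^2 sin(2 theta)/2, so Phragmen-Lindelof gives this growth in the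
   sector between them.  The mean of |G| over the circle
   beta r^2 = k is then O(exp(k/2)/sqrt k), which bounds P_k on the unit ball.
   The coefficient of x^alpha is read off P_k by a Chebyshev quadrature at the
   points rho_i cos t, rho_i^2 = alpha_i/k, at the cost of a factor 2^k
   (nothing for d = 1), and Stirling's formula concludes. *)
Require Import Defs.
From HB Require Import structures.
From mathcomp Require Import all_boot all_order all_algebra.
From mathcomp Require Import all_classical all_reals all_analysis.
From mathcomp Require Import complex measurable_realfun.
From mathcomp Require Import ring lra zify.
Import Order.TTheory GRing.Theory Num.Theory.
Local Open Scope ring_scope.
Set Implicit Arguments. Unset Strict Implicit. Unset Printing Implicit Defensive.
Import numFieldNormedType.Exports.

(** * Maximum modulus principle on rectangles *)

(** The exponent (d - 2)/4 balances a gain and a loss. On the circle beta r^2 = k the bound on |G|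
    is a Gaussian in the angle, of width about 1/sqrt k around each diagonal, so the mean gains
    k^(-1/2) over the maximum; Stirling costs at most k^(1/4) in each of the d coordinates. That
    radius is the one minimizing exp(beta r^2/2)/r^k. The growth bounds come with beta^2 = (1 -
    a)/(1 + a) for a = tanh(2 gamma), and the sector between the two critical rays is narrower than
    a right angle, which is what makes growth of order 2 admissible for Phragmen-Lindelof. Only the
    values of P_k on the real unit ball are controlled, so a coefficient cannot be read off by
    Cauchy's formula on a complex torus. The quadrature functional that isolates degree m in one
    real variable has total weight up to 2^m, whence 2^k, which is at most d^k as soon as d >= 2.
    Complex analysis enters only in finite form: entire functions are locally uniform limits of
    partial sums, Cauchy's formula is an average over roots of unity, and contour shifts are
    replaced by an identity theorem from the real axis. *)

Section ComplexModulus.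
Variable R : realType.
Local Notation C := R[i].
Implicit Types (x y z w : C).

Lemma complexP z w :
  complex.Re z = complex.Re w -> complex.Im z = complex.Im w -> z = w.
Proof. by case: z w => [a b] [c d] /= -> ->. Qed.

Lemma ReD z w : complex.Re (z + w) = complex.Re z + complex.Re w.
Proof. by case: z w => [a b] [c d]. Qed.

Lemma ImD z w : complex.Im (z + w) = complex.Im z + complex.Im w.
Proof. by case: z w => [a b] [c d]. Qed.

Lemma ReN z : complex.Re (- z) = - complex.Re z.
Proof. by case: z. Qed.

Lemma ImN z : complex.Im (- z) = - complex.Im z.
Proof. by case: z. Qed.

Lemma ReM z w : complex.Re (z * w) =
  complex.Re z * complex.Re w - complex.Im z * complex.Im w.
Proof. by case: z w => [a b] [c d]. Qed.

Lemma ImM z w : complex.Im (z * w) =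
  complex.Re z * complex.Im w + complex.Im z * complex.Re w.
Proof. by case: z w => [a b] [c d]. Qed.

Definition ReImE := (ReD, ImD, ReN, ImN, ReM, ImM).

Lemma cmodE z : cmod z = ComplexField.Normc.normc z.
Proof. by case: z. Qed.

Lemma cmod_ge0 z : 0 <= cmod z.
Proof. exact: sqrtr_ge0. Qed.

Lemma sqr_cmod z : cmod z ^+ 2 = complex.Re z ^+ 2 + complex.Im z ^+ 2.
Proof. by rewrite sqr_sqrtr// addr_ge0// sqr_ge0. Qed.

Lemma cmodM z w : cmod (z * w) = cmod z * cmod w.
Proof. by rewrite !cmodE ComplexField.Normc.normcM. Qed.

Lemma ler_cmodD z w : cmod (z + w) <= cmod z + cmod w.
Proof. by rewrite !cmodE le_normcD. Qed.

Lemma cmod0 : cmod (0 : C) = 0.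
Proof. by rewrite cmodE ComplexField.Normc.normc0. Qed.

Lemma cmod1 : cmod (1 : C) = 1.
Proof. by rewrite cmodE ComplexField.Normc.normc1. Qed.

Lemma cmodN z : cmod (- z) = cmod z.
Proof. by rewrite /cmod !ReImE !sqrrN. Qed.

Lemma cmodX z n : cmod (z ^+ n) = cmod z ^+ n.
Proof. by elim: n => [|n IH]; rewrite ?expr0 ?cmod1// !exprS cmodM IH. Qed.

Lemma ler_cmod_sum (I : Type) (r : seq I) (P : pred I) (F : I -> C) :
  cmod (\sum_(i <- r | P i) F i) <= \sum_(i <- r | P i) cmod (F i).
Proof.
elim/big_ind2 : _ => [|z a w b za wb|//]; first by rewrite cmod0.
by apply: le_trans (ler_cmodD _ _) _; exact: lerD.
Qed.

Lemma cmod_real (t : R) : cmod (Complex t 0) = `|t|.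
Proof. by rewrite /cmod /= expr0n addr0 sqrtr_sqr. Qed.

Lemma ler_Re_cmod z : `|complex.Re z| <= cmod z.
Proof. by rewrite -sqrtr_sqr ler_wsqrtr// lerDl sqr_ge0. Qed.

Lemma ler_Im_cmod z : `|complex.Im z| <= cmod z.
Proof. by rewrite -sqrtr_sqr ler_wsqrtr// lerDr sqr_ge0. Qed.

Lemma cmod_eq0 z : cmod z = 0 -> z = 0.
Proof. by rewrite cmodE => /ComplexField.Normc.eq0_normc. Qed.

(* A unimodular rotation reduces a bound on |z| to a bound on Re. *)
Lemma cmod_rot z : exists2 c : C, cmod c <= 1 & c * z = Complex (cmod z) 0.
Proof.
have [/cmod_eq0 ->|z0] := eqVneq (cmod z) 0.
  by exists 0; rewrite ?cmod0// mul0r.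
exists (Complex (complex.Re z / cmod z) (- complex.Im z / cmod z)).
  rewrite -(@ler_pXn2r _ 2)// ?nnegrE ?cmod_ge0// sqr_cmod /= expr1n.
  by rewrite !exprMn sqrrN -mulrDl -sqr_cmod exprVn divff// expf_neq0.
apply: complexP; rewrite !ReImE /=; last by rewrite mulrC; ring.
rewrite -[RHS](mulfK z0) -expr2 sqr_cmod; ring.
Qed.

Definition cexp z : C :=
  Complex (expR (complex.Re z) * cos (complex.Im z))
          (expR (complex.Re z) * sin (complex.Im z)).

Lemma cexpD z w : cexp (z + w) = cexp z * cexp w.
Proof.
apply: complexP; rewrite !ReImE /= !ReImE expRD ?cosD ?sinD; ring.
Qed.

Lemma cexp0 : cexp 0 = 1.
Proof. by apply: complexP; rewrite /= expR0 ?cos0 ?sin0 mul1r. Qed.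

Lemma cmod_cexp z : cmod (cexp z) = expR (complex.Re z).
Proof.
rewrite /cmod /= !exprMn -mulrDr cos2Dsin2 mulr1 sqrtr_sqr.
by rewrite ger0_norm// expR_ge0.
Qed.

Lemma cexpMn z n : cexp (z *+ n) = cexp z ^+ n.
Proof. by elim: n => [|n IH]; rewrite ?mulr0n ?cexp0 ?expr0// mulrS cexpD IH exprS. Qed.

Lemma cexp_sum (I : Type) (r : seq I) (F : I -> C) :
  cexp (\sum_(i <- r) F i) = \prod_(i <- r) cexp (F i).
Proof. by apply: (big_morph cexp cexpD cexp0). Qed.

Lemma cexp_real (t : R) : cexp (Complex t 0) = Complex (expR t) 0.
Proof. by rewrite /cexp /= cos0 sin0 mulr1 mulr0. Qed.

Lemma cexp_expi (t : R) : cexp (Complex 0 t) = expi t.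
Proof. by rewrite /cexp /= expR0 !mul1r. Qed.

End ComplexModulus.

Section MaximumPrinciple.
Variable R : realType.
Local Notation C := R[i].

(* Syntactic entire functions: the maximum principle only needs a class closed
   under differentiation that contains polynomials in exp. *)
Inductive entexpr :=
  | EConst of C
  | EVar
  | EAdd of entexpr & entexpr
  | EMul of entexpr & entexpr
  | EExp of entexpr.

Fixpoint eval (e : entexpr) (w : C) : C :=
  match e with
  | EConst c => c
  | EVar => w
  | EAdd e1 e2 => eval e1 w + eval e2 w
  | EMul e1 e2 => eval e1 w * eval e2 w
  | EExp e => cexp (eval e w)
  end.

Fixpoint ediff (e : entexpr) : entexpr :=
  match e with
  | EConst c => EConst 0
  | EVar => EConst 1
  | EAdd e1 e2 => EAdd (ediff e1) (ediff e2)
  | EMul e1 e2 => EAdd (EMul (ediff e1) e2) (EMul e1 (ediff e2))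
  | EExp e => EMul (ediff e) (EExp e)
  end.

(** Lets instance resolution produce a derivative in its own form; what remains is an algebraic
    identity with the wanted one. *)
Lemma is_derive_eq1 (f : R -> R) (x l l' : R) :
  is_derive x 1 f l -> l = l' -> is_derive x 1 f l'.
Proof. by move=> ? <-. Qed.

Lemma is_derive_eval_Re e (s t : R) :
  (is_derive s 1 (fun s => complex.Re (eval e (Complex s t)))
     (complex.Re (eval (ediff e) (Complex s t))) *
   is_derive s 1 (fun s => complex.Im (eval e (Complex s t)))
     (complex.Im (eval (ediff e) (Complex s t))))%type.
Proof.
elim: e => [c||e1 [R1 I1] e2 [R2 I2]|e1 [R1 I1] e2 [R2 I2]|e [R1 I1]] /=.
- by split; exact: is_derive_cst.
- by split; [exact: is_derive_id|exact: is_derive_cst].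
- split.
  + under eq_fun do rewrite ReD. rewrite ReD; exact: is_deriveD.
  + under eq_fun do rewrite ImD. rewrite ImD; exact: is_deriveD.
- split.
  + under eq_fun do rewrite ReM.
    apply: is_derive_eq1; rewrite !ReImE /=/GRing.scale/=; ring.
  + under eq_fun do rewrite ImM.
    apply: is_derive_eq1; rewrite !ReImE /=/GRing.scale/=; ring.
- split.
  + apply: is_derive_eq1. rewrite !ReImE /=/GRing.scale/=; ring.
  + apply: is_derive_eq1. rewrite !ReImE /=/GRing.scale/=; ring.
Qed.

(** The vertical derivative is i times [ediff e]; together with the horizontal one these are the
    Cauchy-Riemann equations, obtained by structural induction. *)
Lemma is_derive_eval_Im e (s t : R) :
  (is_derive t 1 (fun t => complex.Re (eval e (Complex s t)))
     (- complex.Im (eval (ediff e) (Complex s t))) *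
   is_derive t 1 (fun t => complex.Im (eval e (Complex s t)))
     (complex.Re (eval (ediff e) (Complex s t))))%type.
Proof.
elim: e => [c||e1 [R1 I1] e2 [R2 I2]|e1 [R1 I1] e2 [R2 I2]|e [R1 I1]] /=.
- by rewrite oppr0; split; exact: is_derive_cst.
- by rewrite oppr0; split; [exact: is_derive_cst|exact: is_derive_id].
- split.
  + under eq_fun do rewrite ReD. rewrite ImD opprD; exact: is_deriveD.
  + under eq_fun do rewrite ImD. rewrite ReD; exact: is_deriveD.
- split.
  + under eq_fun do rewrite ReM.
    apply: is_derive_eq1; rewrite !ReImE /=/GRing.scale/=; ring.
  + under eq_fun do rewrite ImM.
    apply: is_derive_eq1; rewrite !ReImE /=/GRing.scale/=; ring.
- split.
  + apply: is_derive_eq1. rewrite !ReImE /=/GRing.scale/=; ring.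
  + apply: is_derive_eq1. rewrite !ReImE /=/GRing.scale/=; ring.
Qed.
End MaximumPrinciple.

Section SecondDerivative.
Variable R : realType.
Local Open Scope classical_set_scope.

Lemma is_derive_continuous (g dg : R -> R) :
  (forall x : R, is_derive x 1 g (dg x)) -> continuous g.
Proof. by move=> dgP x; apply/differentiable_continuous/derivable1_diffP. Qed.

Lemma is_derive_gt0_right (g : R -> R) (c l : R) :
  is_derive c 1 g l -> 0 < l -> g c = 0 ->
  exists2 e, 0 < e & forall h, 0 < h -> h < e -> 0 < g (c + h).
Proof.
move=> dg l0 gc0.
have [ex lE] := dg.
have cv : h^-1 *: (g (h *: 1 + c) - g c) @[h --> 0^'] --> l.
  by rewrite -lE; exact: ex.
have H : \forall h \near (0 : R)^', 0 < h^-1 *: (g (h *: 1 + c) - g c).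
  by apply: (@cvgr_gt R _ _ _ _ l) => //; exact: cv.
have [e /= e0 He] := (nbhs_ballP (0 : R^o) _).1 H.
exists e => // h h0 he.
have := He h; rewrite /ball /= sub0r normrN gtr0_norm// => /(_ he).
have hn : h != 0 by rewrite gt_eqF.
move=> /(_ hn); rewrite gc0 subr0 /GRing.scale /= mulr1 addrC.
by rewrite pmulr_rgt0// invr_gt0.
Qed.

(** If l were positive, [dg], which vanishes at the maximum c, would be positive just to the right
    of c, and the mean value theorem would give a value above g c. *)
Lemma second_derivative_at_max (g dg : R -> R) (a b c l : R) :
  c \in `]a, b[%R -> (forall x : R, is_derive x 1 g (dg x)) ->
  is_derive c 1 dg l -> (forall t, t \in `]a, b[%R -> g t <= g c) -> l <= 0.
Proof.
move=> cab dgP ddg mx; rewrite leNgt; apply/negP => l0.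
have ab : a <= b by move: cab; rewrite in_itv /= => /andP[] /lt_trans /[apply] /ltW.
have D0 : is_derive c 1 g 0.
  apply: (derive1_at_max ab) => // t _; exact: ex_derive.
have dgc : dg c = 0 by rewrite -(@derive_val _ _ _ _ _ _ _ (dgP c)) derive_val.
have [e e0 He] := is_derive_gt0_right ddg l0 dgc.
pose h := Num.min (e / 2) ((b - c) / 2).
have bc : 0 < b - c by move: cab; rewrite in_itv /= subr_gt0 => /andP[].
have h0 : 0 < h by rewrite /h lt_min !divr_gt0.
have he : h < e.
  by rewrite /h gt_min; apply/orP; left; rewrite ltr_pdivrMr// mulr_natr mulr2n ltrDl.
have hb : c + h < b.
  rewrite -ltrBrDl /h gt_min; apply/orP; right.
  by rewrite ltr_pdivrMr// mulr_natr mulr2n ltrDl.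
have cch : c < c + h by rewrite ltrDl.
have [x] := MVT cch (fun x _ => dgP x)
  (continuous_subspaceT (is_derive_continuous dgP)).
rewrite in_itv /= => /andP[cx xh] E.
have : 0 < dg x.
  rewrite -(subrK c x) addrC; apply: He; first by rewrite subr_gt0.
  by apply: lt_trans he; rewrite ltrBlDl.
have : g (c + h) <= g c.
  apply: mx; rewrite in_itv /= hb andbT.
  by move: cab; rewrite in_itv /= => /andP[+ _] => /lt_trans; apply.
rewrite -subr_le0 E addrAC subrr add0r pmulr_lle0// => H1 H2.
by have := lt_le_trans H2 H1; rewrite ltxx.
Qed.

End SecondDerivative.

Section MaximumModulus.
Variable R : realType.
Local Notation C := R[i].
Local Open Scope classical_set_scope.

Lemma continuous_eval (e : entexpr R) :
  continuous (fun p : R * R => complex.Re (eval e (Complex p.1 p.2))) /\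
  continuous (fun p : R * R => complex.Im (eval e (Complex p.1 p.2))).
Proof.
elim: e => [c||e1 [R1 I1] e2 [R2 I2]|e1 [R1 I1] e2 [R2 I2]|e [R1 I1]] /=.
- by split => p; exact: cvg_cst.
- by split => p; [exact: cvg_fst|exact: cvg_snd].
- split => p; rewrite /continuous_at.
  + under eq_fun do rewrite ReD. rewrite ReD; apply: cvgD; [exact: R1|exact: R2].
  + under eq_fun do rewrite ImD. rewrite ImD; apply: cvgD; [exact: I1|exact: I2].
- split => p; rewrite /continuous_at.
  + under eq_fun do rewrite ReM. rewrite ReM.
    apply: cvgB; apply: cvgM; by [exact: R1|exact: R2|exact: I1|exact: I2].
  + under eq_fun do rewrite ImM. rewrite ImM.
    apply: cvgD; apply: cvgM; by [exact: R1|exact: R2|exact: I1|exact: I2].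
- split => p; apply: cvgM.
  + by apply: continuous_comp; [exact: R1|exact: continuous_expR].
  + by apply: continuous_comp; [exact: I1|exact: continuous_cos].
  + by apply: continuous_comp; [exact: R1|exact: continuous_expR].
  + by apply: continuous_comp; [exact: I1|exact: continuous_sin].
Qed.

(* |e|^2 + eta s^2 is strictly subharmonic, so it has no interior maximum: its
   two second partial derivatives sum to 4|e'|^2 + 2 eta > 0. *)
Lemma max_modulus_perturbed (e : entexpr R) (s0 s1 t0 t1 eta : R)
    (phi := fun s t => cmod (eval e (Complex s t)) ^+ 2 + eta * s ^+ 2) (K : R) :
  0 < eta ->
  (forall s t, s0 <= s <= s1 -> t0 <= t <= t1 ->
     [|| s == s0, s == s1, t == t0 | t == t1] -> phi s t <= K) ->
  forall s t, s0 <= s <= s1 -> t0 <= t <= t1 -> phi s t <= K.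
Proof.
move=> eta0 bd s t hs ht.
pose A := [set` `[s0, s1]%R] `*` [set` `[t0, t1]%R] : set (R * R).
have cA : compact A by apply: compact_setX; exact: segment_compact.
have A0 : A !=set0 by exists (s, t); split; rewrite /= in_itv.
have cphi : {within A, continuous (fun p : R * R => phi p.1 p.2)}.
  apply: continuous_subspaceT => p; rewrite /phi /continuous_at.
  under eq_fun do rewrite sqr_cmod.
  rewrite sqr_cmod; have [cR cI] := continuous_eval e.
  apply: cvgD; [apply: cvgD|].
  - by apply: cvgM; exact: cR.
  - by apply: cvgM; exact: cI.
  - by apply: cvgM; [exact: cvg_cst|apply: cvgM; exact: cvg_fst].
have [[c d]] := compact_EVT_max A0 cA cphi.
rewrite inE /A /= => -[]; rewrite /= !in_itv /= => hc hd mx.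
apply: (@le_trans _ _ (phi c d)).
  by have := mx (s, t); rewrite inE /A /= !in_itv /=; apply; split.
have [bdy|] := boolP [|| c == s0, c == s1, d == t0 | d == t1]; first exact: bd.
rewrite !negb_or => /and4P[c0 c1 d0 d1].
have ci : c \in `]s0, s1[%R.
  by rewrite in_itv /= !lt_neqAle eq_sym c0 c1 /=.
have di : d \in `]t0, t1[%R.
  by rewrite in_itv /= !lt_neqAle eq_sym d0 d1 /=.
exfalso.
pose e1 := ediff e; pose e2 := ediff e1.
pose re f s t := complex.Re (eval f (Complex s t)) : R.
pose im f s t := complex.Im (eval f (Complex s t)) : R.
have sR f (u v : R) : is_derive u 1 (re f ^~ v) (re (ediff f) u v)
  by case: (is_derive_eval_Re f u v).
have sI f (u v : R) : is_derive u 1 (im f ^~ v) (im (ediff f) u v)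
  by case: (is_derive_eval_Re f u v).
have tR f (u v : R) : is_derive v 1 (re f u) (- im (ediff f) u v)
  by case: (is_derive_eval_Im f u v).
have tI f (u v : R) : is_derive v 1 (im f u) (re (ediff f) u v)
  by case: (is_derive_eval_Im f u v).
have phiE u v : phi u v =
    re e u v * re e u v + im e u v * im e u v + eta * (u * u).
  by rewrite /phi sqr_cmod !expr2.
(* [l1] and [l2] are the second partial derivatives of phi at (c, d). The terms in the second
   derivative of e have opposite signs and cancel in the sum. *)
pose l1 := 2 * (re e1 c d ^+ 2 + im e1 c d ^+ 2
  + re e c d * re e2 c d + im e c d * im e2 c d) + 2 * eta.
pose l2 := 2 * (re e1 c d ^+ 2 + im e1 c d ^+ 2
  - re e c d * re e2 c d - im e c d * im e2 c d).
have L1 : l1 <= 0.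
  apply: (@second_derivative_at_max _ (phi ^~ d)
    (fun u => 2 * (re e u d * re e1 u d + im e u d * im e1 u d) + 2 * eta * u)
    s0 s1 c) => //.
  - move=> u; rewrite (_ : phi ^~ d = fun u =>
      re e u d * re e u d + im e u d * im e u d + eta * (u * u)); last first.
      by apply/funext => ?; rewrite phiE.
    apply: is_derive_eq1; rewrite /GRing.scale /= /e1; ring.
  - apply: is_derive_eq1; rewrite /GRing.scale /= /l1 /e2 /e1; ring.
  - move=> u ui; have := mx (u, d); rewrite inE /A /= !in_itv /=; apply.
    split=> //; move: ui; rewrite in_itv /= => /andP[? ?].
    by rewrite !ltW.
have L2 : l2 <= 0.
  apply: (@second_derivative_at_max _ (phi c)
    (fun v => 2 * (re e c v * - im e1 c v + im e c v * re e1 c v))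
    t0 t1 d) => //.
  - move=> v; rewrite (_ : phi c = fun v =>
      re e c v * re e c v + im e c v * im e c v + eta * (c * c)); last first.
      by apply/funext => ?; rewrite phiE.
    apply: is_derive_eq1; rewrite /GRing.scale /= /e1; ring.
  - apply: is_derive_eq1; rewrite /GRing.scale /= /l2 /e2 /e1; ring.
  - move=> u ui; have := mx (c, u); rewrite inE /A /= !in_itv /=; apply.
    split=> //; move: ui; rewrite in_itv /= => /andP[? ?].
    by rewrite !ltW.
have : l1 + l2 > 0; last by lra.
have -> : l1 + l2 = 4 * (re e1 c d ^+ 2 + im e1 c d ^+ 2) + 2 * eta.
  by rewrite /l1 /l2; ring.
by rewrite ltr_wpDl ?mulr_gt0// mulr_ge0// addr_ge0// sqr_ge0.
Qed.

Lemma max_modulus_rectangle (e : entexpr R) (s0 s1 t0 t1 M : R) :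
  (forall s t, s0 <= s <= s1 -> t0 <= t <= t1 ->
     [|| s == s0, s == s1, t == t0 | t == t1] ->
     cmod (eval e (Complex s t)) <= M) ->
  forall s t, s0 <= s <= s1 -> t0 <= t <= t1 ->
    cmod (eval e (Complex s t)) <= M.
Proof.
move=> bd s t hs ht.
have M0 : 0 <= M.
  apply: le_trans (cmod_ge0 _) (bd s0 t _ ht _); last by rewrite eqxx.
  by case/andP: hs => ? ?; rewrite lexx (@le_trans _ _ s).
rewrite -(@ler_pXn2r _ 2)// ?nnegrE ?cmod_ge0//.
pose L := s0 ^+ 2 + s1 ^+ 2.
have L0 : 0 <= L by rewrite addr_ge0// sqr_ge0.
have sL u : s0 <= u <= s1 -> u ^+ 2 <= L.
  rewrite /L; case/andP => h1 h2; have [u0|u0] := leP 0 u.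
  - have le2 : u ^+ 2 <= s1 ^+ 2 by rewrite ler_pXn2r// nnegrE// (le_trans u0).
    by rewrite (le_trans le2)// lerDr sqr_ge0.
  - have le2 : u ^+ 2 <= s0 ^+ 2.
      rewrite -sqrrN -[leRHS]sqrrN ler_pXn2r// ?nnegrE ?oppr_ge0 ?lerN2//.
        exact: ltW.
      by rewrite (le_trans h1)// ltW.
    by rewrite (le_trans le2)// lerDl sqr_ge0.
apply/ler_addgt0Pr => eps eps0.
(* L bounds s^2 on the rectangle, so this choice keeps the perturbation below eps. *)
pose eta := eps / (L + 1).
have L1 : 0 < L + 1 by rewrite ltr_wpDl.
have eta0 : 0 < eta by rewrite divr_gt0.
have := @max_modulus_perturbed e s0 s1 t0 t1 eta (M ^+ 2 + eps) eta0.
move=> /(_ _ s t hs ht) H.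
apply: le_trans (H _); first by rewrite lerDl mulr_ge0 ?sqr_ge0// ltW.
move=> u v hu hv b; apply: lerD.
  by rewrite ler_pXn2r// ?nnegrE ?cmod_ge0// bd.
rewrite /eta mulrAC ler_pdivrMr// ler_pM2l//.
by rewrite (le_trans (sL _ hu))// lerDl.
Qed.

End MaximumModulus.

(** * Phragmen-Lindelof in a sector *)

Section PhragmenLindelof.
Variable R : realType.
Local Notation C := R[i].
Implicit Types (P : nat -> C) (G : C -> C).

Definition psum P N (z : C) : C := \sum_(k < N) P k * z ^+ k.

(** This is how G is known to be entire: its power series converges uniformly on every disc. *)
Definition psum_cvg P G := forall r eps : R, 0 < eps ->
  exists N0, forall N, (N0 <= N)%N -> forall z, cmod z <= r ->
    cmod (G z - psum P N z) <= eps.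

(** The substitution z = exp w turns the sector into a horizontal strip, where the maximum principle
    on rectangles applies. *)
Fixpoint epsum P N : entexpr R :=
  if N is M.+1 then
    EAdd (epsum P M) (EMul (EConst (P M)) (EExp (EMul (EConst M%:R) (EVar R))))
  else EConst 0.

Lemma eval_epsum P N w : eval (epsum P N) w = psum P N (cexp w).
Proof.
rewrite /psum; elim: N => [|N IH] /=; first by rewrite big_ord0.
by rewrite big_ord_recr /= IH mulr_natl cexpMn.
Qed.

Variables (beta K : R) (P : nat -> C) (G : C -> C).
Hypotheses (beta_gt0 : 0 < beta) (beta_lt1 : beta < 1) (K_ge0 : 0 <= K).
Hypothesis cvgG : psum_cvg P G.
Hypothesis G_real : forall z, cmod (G z) <=
  K * expR ((beta ^+ 2 * complex.Re z ^+ 2 + complex.Im z ^+ 2) / 2).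
Hypothesis G_imag : forall z, cmod (G z) <=
  K * expR ((complex.Re z ^+ 2 + beta ^+ 2 * complex.Im z ^+ 2) / 2).

Let th := atan beta.
Let delta := pi / 4 - th.
(** [delta] is the half-opening of the sector. The exponent p must exceed 2, to beat the growth of
    G, while p * delta stays below pi/2, so that z^p rotated to the axis of the sector keeps a
    positive real part. Here p * delta = pi/2 - th. *)
Let p := 1 + pi / (4 * delta).
Let kap := cos (p * delta).

Let th_gt0 : 0 < th. Proof. by rewrite -atan0 lt_atan. Qed.

Let delta_gt0 : 0 < delta.
Proof. by rewrite subr_gt0 -atan1 lt_atan. Qed.

Let pdelta : p * delta = delta + pi / 4.
Proof. by rewrite /p; field; rewrite gt_eqF. Qed.

Let p_gt2 : 2 < p.
Proof.
have h : 2 * delta < p * delta.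
  by rewrite pdelta -subr_gt0 /delta; have := th_gt0; lra.
by rewrite ltr_pM2r in h.
Qed.

Let pdelta_lt : 0 < p * delta < pi / 2.
Proof.
by rewrite pdelta /delta; have := th_gt0; have := delta_gt0; rewrite /delta; lra.
Qed.

Let kap_gt0 : 0 < kap.
Proof. by apply: cos_gt0_pihalf; have := pdelta_lt; lra. Qed.

Let tan_th : sin th = beta * cos th.
Proof.
have c0 : cos th != 0.
  by rewrite gt_eqF// cos_gt0_pihalf// atan_gtNpi2 atan_ltpi2.
by rewrite -[in RHS](atanK beta) -/th /tan mulfVK.
Qed.

(** With z = exp w this is i beta z^2/2 - eps (z exp(-i pi/4))^p. The first term removes the target
    growth beta r^2 cos t sin t; the second forces decay at infinity and disappears as eps tends to
    0. *)
Let damp eps : entexpr R := EAdd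
  (EMul (EConst (Complex 0 (beta / 2))) (EMul (EExp (EVar R)) (EExp (EVar R))))
  (EMul (EConst (Complex (- eps) 0))
     (EExp (EAdd (EMul (EConst (Complex p 0)) (EVar R))
                 (EConst (Complex 0 (- (p * (pi / 4)))))))).

Let Re_damp eps s t : complex.Re (eval (damp eps) (Complex s t)) =
  - (beta * expR s ^+ 2 * (cos t * sin t))
  - eps * (expR (p * s) * cos (p * (t - pi / 4))).
Proof.
by rewrite /= !mul0r !subr0 !addr0 mulrBr; field.
Qed.

Let cos_damp t : th <= t <= pi / 2 - th -> kap <= cos (p * (t - pi / 4)).
Proof.
move=> /andP[h1 h2]; rewrite -(cos_norm (p * _)).
have p0 : 0 < p by have := p_gt2; lra.
have ub : `|p * (t - pi / 4)| <= p * delta.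
  rewrite normrM gtr0_norm// ler_pM2l// ler_norml /delta; lra.
rewrite leNgt; apply/negP; rewrite /kap ltr_cos.
- by rewrite ltNge ub.
- by rewrite in_itv /=; have := pdelta_lt; have := pi_gt0 R; lra.
- by rewrite in_itv /= normr_ge0 (le_trans ub)//; have := pdelta_lt; have := pi_gt0 R; lra.
Qed.

Let sector_trig t : th <= t <= pi / 2 - th -> 0 <= cos t * sin t.
Proof.
have := th_gt0; have := pi_gt0 R => ? ? ?.
by rewrite mulr_ge0// ?cos_ge0_pihalf ?sin_ge0_pi//; lra.
Qed.

Let cexpST (s t : R) :
  cexp (Complex s t) = Complex (expR s * cos t) (expR s * sin t).
Proof. by []. Qed.

(** On the left edge r <= 1, which is the origin of the constant exp(1/2). On the right edge the
    hypothesis on s1 makes eps r^p kap exceed r^2/2. On the two rays sin th = beta cos th turns the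
    exponent of the growth bound into exactly beta r^2 cos t sin t, which the first term of [damp]
    cancels. *)
Let edge eps s0 s1 s t : 0 < eps -> s0 <= 0 ->
  1 <= 2 * eps * kap * expR ((p - 2) * s1) ->
  s0 <= s <= s1 -> th <= t <= pi / 2 - th ->
  [|| s == s0, s == s1, t == th | t == pi / 2 - th] ->
  cmod (G (cexp (Complex s t))) *
    expR (complex.Re (eval (damp eps) (Complex s t))) <= K * expR (1 / 2).
Proof.
move=> eps0 s00 hs1 hs ht.
have kc := cos_damp ht.
have sc := sector_trig ht.
have e2 : 0 < expR s ^+ 2 by rewrite exprn_gt0// expR_gt0.
have ep : 0 < expR (p * s) by exact: expR_gt0.
have ek : 0 <= eps * (expR (p * s) * cos (p * (t - pi / 4))).
  by rewrite !mulr_ge0// ltW// (lt_le_trans kap_gt0).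
have bsc : 0 <= beta * expR s ^+ 2 * (cos t * sin t).
  by rewrite mulr_ge0// mulr_ge0// ltW.
suff H A : cmod (G (cexp (Complex s t))) <= K * expR A ->
    A + complex.Re (eval (damp eps) (Complex s t)) <= 1 / 2 ->
    cmod (G (cexp (Complex s t))) *
    expR (complex.Re (eval (damp eps) (Complex s t))) <= K * expR (1 / 2).
  have Gr := G_real (cexp (Complex s t)); rewrite cexpST /= in Gr.
  have Gi := G_imag (cexp (Complex s t)); rewrite cexpST /= in Gi.
  have crude : (beta ^+ 2 * (expR s * cos t) ^+ 2 + (expR s * sin t) ^+ 2) / 2
      <= expR s ^+ 2 / 2.
    rewrite ler_pM2r ?invr_gt0// !exprMn mulrCA -mulrDr.
    rewrite -[leRHS]mulr1 ler_pM2l// -(cos2Dsin2 t) lerD2r.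
    rewrite ler_piMl ?sqr_ge0// expr_le1//; exact: ltW.
  case/or4P => /eqP e.
  - apply: H Gr _; rewrite Re_damp.
    have : expR s ^+ 2 <= 1 by rewrite expr_le1// ?expR_ge0// expR_le1 e.
    by move: crude bsc ek; lra.
  - apply: H Gr _; rewrite Re_damp.
    suff : expR s ^+ 2 / 2 <= eps * (expR (p * s) * cos (p * (t - pi / 4))).
      by move: crude bsc ek; lra.
    apply: (@le_trans _ _ (eps * (expR (p * s) * kap))).
      2: by rewrite ler_pM2l// ler_pM2l.
    have -> : expR (p * s) = expR s ^+ 2 * expR ((p - 2) * s).
      by rewrite -expRM_natl -expRD; congr expR; ring.
    rewrite e ler_pdivrMr//.
    have -> : eps * (expR s1 ^+ 2 * expR ((p - 2) * s1) * kap) * 2 =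
      expR s1 ^+ 2 * (2 * eps * kap * expR ((p - 2) * s1)) by ring.
    by rewrite ler_peMr// sqr_ge0.
  - apply: H Gr _; rewrite Re_damp.
    suff : (beta ^+ 2 * (expR s * cos t) ^+ 2 + (expR s * sin t) ^+ 2) / 2
       - beta * expR s ^+ 2 * (cos t * sin t) <= 0.
      by move: ek; lra.
    by rewrite e tan_th le_eqVlt; apply/orP; left; apply/eqP; field.
  - apply: H Gi _; rewrite Re_damp.
    suff : ((expR s * cos t) ^+ 2 + beta ^+ 2 * (expR s * sin t) ^+ 2) / 2
       - beta * expR s ^+ 2 * (cos t * sin t) <= 0.
      by move: ek; lra.
    have ct : cos t = sin th by rewrite e cosB cos_pihalf sin_pihalf mul0r mul1r add0r.
    have st : sin t = cos th by rewrite e sinB cos_pihalf sin_pihalf mul0r mul1r subr0.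
    by rewrite ct st tan_th le_eqVlt; apply/orP; left; apply/eqP; field.
move=> GA AE; apply: le_trans (ler_wpM2r (expR_ge0 _) GA) _.
by rewrite -mulrA -expRD ler_wpM2l// ler_expR.
Qed.

Let damp_le1 eps s t : 0 < eps -> th <= t <= pi / 2 - th ->
  expR (complex.Re (eval (damp eps) (Complex s t))) <= 1.
Proof.
move=> eps0 ht; rewrite expR_le1 Re_damp -opprD oppr_le0.
have ? : 0 <= eps * (expR (p * s) * cos (p * (t - pi / 4))).
  apply: mulr_ge0; first exact: ltW.
  by rewrite mulr_ge0 ?expR_ge0// ltW// (lt_le_trans kap_gt0)// cos_damp.
by rewrite addr_ge0// mulr_ge0 ?sector_trig// mulr_ge0 ?sqr_ge0// ltW.
Qed.

(** The maximum principle is available for polynomials in exp w, so G is replaced by a partial sum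
    that is eta/2-close on the disc of radius exp s1; damping by a factor at most 1 preserves this
    closeness. *)
Let damped eps s t : 0 < eps -> th <= t <= pi / 2 - th ->
  cmod (G (cexp (Complex s t))) *
    expR (complex.Re (eval (damp eps) (Complex s t))) <= K * expR (1 / 2).
Proof.
move=> eps0 ht.
pose s0 := Num.min s 0.
(* From exp x >= 1 + x, this makes exp((p - 2) s1) at least 1/(2 eps kap), as [edge] requires. *)
pose s1 := Num.max s ((2 * eps * kap)^-1 / (p - 2)).
have p2 : 0 < p - 2 by rewrite subr_gt0.
have ek : 0 < 2 * eps * kap by rewrite !mulr_gt0.
have hs1 : 1 <= 2 * eps * kap * expR ((p - 2) * s1).
  rewrite -ler_pdivrMl// mulr1; apply: le_trans (expR_ge1Dx _).
  rewrite -[leLHS]add0r lerD// [leRHS]mulrC -ler_pdivrMr//.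
  by rewrite /s1 le_max lexx orbT.
have s00 : s0 <= 0 by rewrite /s0 ge_min lexx orbT.
have hs : s0 <= s <= s1 by rewrite /s0 /s1 ge_min le_max !lexx.
apply/ler_addgt0Pr => eta eta0.
have eta2 : 0 < eta / 2 by rewrite divr_gt0.
have [N0 HN] := cvgG (expR s1) eta2.
pose e := EMul (epsum P N0) (EExp (damp eps)).
have close u v : s0 <= u <= s1 -> th <= v <= pi / 2 - th ->
    cmod (G (cexp (Complex u v)) - psum P N0 (cexp (Complex u v))) *
    expR (complex.Re (eval (damp eps) (Complex u v))) <= eta / 2.
  move=> /andP[_ us] hv.
  rewrite -[leRHS]mulr1; apply: ler_pM; rewrite ?cmod_ge0 ?expR_ge0//.
    by apply: HN => //; rewrite cmod_cexp ler_expR.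
  exact: damp_le1.
have cmod_e u v : cmod (eval e (Complex u v)) =
    cmod (psum P N0 (cexp (Complex u v))) *
    expR (complex.Re (eval (damp eps) (Complex u v))).
  rewrite /e; cbn [eval]; by rewrite cmodM cmod_cexp eval_epsum.
have main : cmod (eval e (Complex s t)) <= K * expR (1 / 2) + eta / 2.
  apply: (@max_modulus_rectangle _ _ s0 s1 th (pi / 2 - th)) => // u v hu hv b.
  rewrite cmod_e.
  have := close u v hu hv; have := edge eps0 s00 hs1 hu hv b.
  set g := G _; set q := psum _ _ _; set D := expR _ => h1 h2.
  have : cmod q <= cmod g + cmod (g - q).
    by rewrite -(cmodN (g - q)) -{1}(subrK g q) opprB addrC; exact: ler_cmodD.
  move=> /(ler_wpM2r (expR_ge0 (complex.Re (eval (damp eps) (Complex u v))))).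
  by rewrite -/D mulrDl => /le_trans; apply; exact: lerD.
have := close s t hs ht; move: main; rewrite cmod_e.
set g := G _; set q := psum _ _ _; set D := expR _ => h1 h2.
have : cmod g <= cmod q + cmod (g - q).
  by rewrite -{1}(subrK q g) addrC; exact: ler_cmodD.
move=> /(ler_wpM2r (expR_ge0 (complex.Re (eval (damp eps) (Complex s t))))).
rewrite -/D mulrDl => /le_trans; apply; apply: le_trans (lerD h1 h2) _.
by rewrite -addrA -splitr.
Qed.

Lemma phragmen_lindelof r t : 0 < r -> atan beta <= t <= pi / 2 - atan beta ->
  cmod (G (Complex (r * cos t) (r * sin t))) <=
    K * expR (1 / 2) * expR (beta * r ^+ 2 * (cos t * sin t)).
Proof.
move=> r0 ht; have [s sr] := expR_total r0.
rewrite -{}sr -cexpST -ler_pdivrMr ?expR_gt0// -expRN.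
set B := beta * _ * _.
set g := cmod _ * _.
have g0 : 0 <= g by rewrite mulr_ge0 ?cmod_ge0 ?expR_ge0.
pose A := expR (p * s) * cos (p * (t - pi / 4)).
(* Linearizing exp(-eps A) makes the passage to eps = 0 an explicit choice of eps, whatever the size
   of A. *)
have H eps : 0 < eps -> g * (1 - eps * A) <= K * expR (1 / 2).
  move=> eps0; apply: le_trans (damped s eps0 ht); rewrite Re_damp -/A expRD.
  rewrite mulrA ler_wpM2l//; exact: expR_ge1Dx.
apply/ler_addgt0Pr => eta eta0.
have gA : 0 <= g * `|A| + 1 by rewrite addr_ge0// mulr_ge0.
have gA1 : 0 < g * `|A| + 1 by rewrite ltr_wpDl// mulr_ge0.
have := H (eta / (g * `|A| + 1)) (divr_gt0 eta0 gA1).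
rewrite mulrBr mulr1 lerBlDr => /le_trans; apply; rewrite lerD2l.
rewrite mulrCA mulrAC ler_pdivrMr// ler_pM2l//.
by apply: le_trans (_ : g * `|A| <= _); [rewrite ler_wpM2l// ler_norm|rewrite lerDl].
Qed.

End PhragmenLindelof.

(** * Coefficients from circle means *)

Section RootsOfUnity.
Variable R : realType.
Local Notation C := R[i].

Definition uroot (M : nat) : C := cexp (Complex 0 (2 * pi / M%:R)).

Lemma ComplexMn (x y : R) n : Complex x y *+ n = Complex (x *+ n) (y *+ n) :> C.
Proof. by elim: n => [//|n IH]; rewrite !mulrS IH. Qed.

Lemma urootX M a : uroot M ^+ a = cexp (Complex 0 (2 * pi * a%:R / M%:R)).
Proof.
rewrite -cexpMn ComplexMn mul0rn -mulr_natr.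
by congr (cexp (Complex _ _)); ring.
Qed.

Lemma cexp_2pi : cexp (Complex 0 (2 * pi)) = 1 :> C.
Proof.
by rewrite cexp_expi /expi mulr_natl cos2pi sin2pi.
Qed.

Lemma uroot_expM M : (0 < M)%N -> uroot M ^+ M = 1.
Proof. by move=> M0; rewrite urootX mulfK ?pnatr_eq0 -?lt0n// cexp_2pi. Qed.

Lemma cexp_neq1 (x : R) : 0 < x < 2 * pi -> cexp (Complex 0 x) != 1.
Proof.
move=> hx; apply/eqP => /(congr1 (@complex.Re R)).
rewrite cexp_expi /= [x]splitr cosD -!expr2 cos2sin2 => h.
have : 0 < sin (x / 2) by apply: sin_gt0_pi; lra.
by move=> /(exprn_gt0 2); rewrite -[X in X < _](subrr 1) -{1}h; lra.
Qed.

Lemma sum_uroot M a : (0 < a < M)%N -> \sum_(j < M) (uroot M ^+ a) ^+ j = 0.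
Proof.
move=> /andP[a0 aM]; have M0 : (0 < M)%N by exact: leq_trans aM.
have MR : 0 < M%:R :> R by rewrite ltr0n.
have : uroot M ^+ a - 1 != 0.
  rewrite subr_eq0 urootX cexp_neq1//; apply/andP; split.
    by rewrite divr_gt0// mulr_gt0 ?ltr0n// mulr_gt0// pi_gt0.
  by rewrite ltr_pdivrMr// ltr_pM2l ?ltr_nat// mulr_gt0// pi_gt0.
move=> /mulfI; apply; rewrite -subrX1 mulr0.
by rewrite -exprM mulnC exprM uroot_expM// expr1n subrr.
Qed.

(** A discrete Cauchy formula: the average over M-th roots of unity is exact for polynomials of
    degree below M. The exponent j (M - k) stands for -j k, since the root has order dividing M. *)
Lemma psum_coef (P : nat -> C) (M k : nat) (r : C) : (k < M)%N ->
  \sum_(j < M) psum P M (r * uroot M ^+ j) * uroot M ^+ (j * (M - k)) =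
  M%:R * (P k * r ^+ k).
Proof.
move=> kM; have M0 : (0 < M)%N by exact: leq_trans kM.
under eq_bigr do rewrite /psum mulr_suml.
rewrite exchange_big /= (bigD1 (Ordinal kM)) //= [X in _ + X]big1 ?addr0.
  rewrite (eq_bigr (fun=> P k * r ^+ k)) => [|j _].
    by rewrite sumr_const card_ord mulr_natl.
  rewrite exprMn -!exprM mulrA -mulrA -exprD -mulnDr subnKC ?(ltnW kM)//.
  by rewrite mulnC exprM uroot_expM// expr1n mulr1.
move=> l /eqP lk.
rewrite (eq_bigr (fun j : 'I_M => P l * r ^+ l * (uroot M ^+ (l + (M - k))) ^+ j)).
  rewrite -mulr_sumr; set S := \sum_(i < M) _; suff -> : S = 0 by rewrite mulr0.
  rewrite /S; have [lk1|lk1] := ltnP l k.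
    apply: sum_uroot; rewrite addn_gt0 subn_gt0 kM orbT /=.
    by lia.
  have lk2 : (k < l)%N.
    rewrite ltn_neqAle lk1 andbT; apply/eqP => kl; apply: lk.
    by apply: val_inj.
  have -> : (l + (M - k) = M + (l - k))%N.
    by lia.
  under eq_bigr do rewrite exprD uroot_expM// mul1r.
  by apply: sum_uroot; rewrite subn_gt0 lk2 /=; apply: leq_ltn_trans (leq_subr _ _) _.
move=> j _; rewrite exprMn -!exprM !mulrA -mulrA -exprD; congr (_ * _ ^+ _).
by rewrite mulnDl mulnC (mulnC j).
Qed.

End RootsOfUnity.

(** * Riemann sums of a Gaussian over a quarter circle *)

Section CircleMean.
Variable R : realType.
Local Notation C := R[i].

(** As 1/(1 + x^2) decreases for x >= 0, each term with m >= 1 is at most the increment of atan over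
    [D (m - 1), D m], divided by D. *)
Lemma sum_inv1Dsqr (D : R) (n : nat) : 0 < D ->
  \sum_(m < n) (1 + (D * m%:R) ^+ 2)^-1 <= 1 + pi / 2 / D.
Proof.
move=> D0.
case: n => [|n].
  by rewrite big_ord0 addr_ge0// divr_ge0 ?(ltW D0)// divr_ge0// pi_ge0.
rewrite big_ord_recl /= mulr0 expr0n addr0 invr1 lerD2l.
apply: (@le_trans _ _ (atan (D * n%:R) / D)); last first.
  by rewrite ler_pM2r ?invr_gt0// ltW// atan_ltpi2.
elim: n => [|n IH]; first by rewrite big_ord0 mulr0 atan0 mul0r.
rewrite big_ord_recr /=; apply: le_trans (lerD IH (lexx _)) _.
rewrite -lerBrDl -mulrBl.
have lt : D * n%:R < D * n.+1%:R by rewrite ltr_pM2l// ltr_nat.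
have [c] := MVT lt (fun x _ => is_derive1_atan x)
   (continuous_subspaceT (@continuous_atan R)).
rewrite in_itv /= => /andP[c1 c2] ->.
have -> : D * n.+1%:R - D * n%:R = D by rewrite -mulrBr -natrB// subSnn mulr1.
rewrite mulfK ?gt_eqF// /bump /= add1n lef_pV2 ?posrE ?ltr_wpDr ?sqr_ge0//.
have c0 : 0 <= c by rewrite (le_trans _ (ltW c1))// mulr_ge0// ltW.
have Dn0 : 0 <= D * n.+1%:R by rewrite mulr_ge0// ltW.
by rewrite lerD2l ler_pXn2r ?nnegrE// ltW.
Qed.

Lemma sum_sym_half (q : nat) (g : R -> R) :
  (forall x, 0 <= g x) -> (forall x, g (- x) = g x) ->
  \sum_(l < q + q) g (l%:R - q%:R) <= (\sum_(m < q.+1) g m%:R) *+ 2.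
Proof.
move=> g0 gN; rewrite big_split_ord /= mulr2n; apply: lerD.
- rewrite (reindex_inj rev_ord_inj) /= big_ord_recl.
  rewrite -[leLHS]add0r; apply: lerD => //.
  apply: ler_sum => i _; rewrite -gN opprB lift0.
  by rewrite natrB ?ltn_ord// subKr.
- rewrite big_ord_recr /= -[leLHS]addr0; apply: lerD => //.
  by apply: ler_sum => i _; rewrite natrD addrAC subrr add0r.
Qed.

(* Through exp(-u) <= 1/(1+u) and the telescoping bound by atan. *)
Lemma gauss_riemann_sum (kap : R) (q : nat) : 0 < kap -> (0 < q)%N ->
  \sum_(l < q + q) expR (- (kap * (pi * l%:R / (q + q).*2%:R - pi / 4) ^+ 2)) <=
  (q + q)%:R * (q%:R^-1 + 2 / Num.sqrt kap).
Proof.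
move=> kap0 q0; have qR : 0 < q%:R :> R by rewrite ltr0n.
have sk : 0 < Num.sqrt kap by rewrite sqrtr_gt0.
(* The l-th angle minus pi/4 is pi (l - q)/(4 q), so D (l - q) is that deviation in units of the
   Gaussian width. *)
pose D := Num.sqrt kap * (pi / (4 * q%:R)).
have D0 : 0 < D by rewrite mulr_gt0// divr_gt0 ?pi_gt0// mulr_gt0.
pose g x := (1 + (D * x) ^+ 2)^-1.
have g0 x : 0 <= g x by rewrite invr_ge0 addr_ge0// sqr_ge0.
have gN x : g (- x) = g x by rewrite /g mulrN sqrrN.
apply: (@le_trans _ _ (\sum_(l < q + q) g (l%:R - q%:R))).
  apply: ler_sum => l _; rewrite expRN /g.
  rewrite lef_pV2 ?posrE ?expR_gt0 ?ltr_wpDr ?sqr_ge0//.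
  apply: le_trans (expR_ge1Dx _); rewrite lerD2l le_eqVlt; apply/orP; left.
  apply/eqP; rewrite /D 2!exprMn (sqr_sqrtr (ltW kap0)) -mulrA -exprMn.
  rewrite -muln2 natrM natrD; congr (_ * _ ^+ 2); field.
  by rewrite !gt_eqF// addr_gt0.
apply: le_trans (sum_sym_half _ g0 gN) _.
apply: le_trans (_ : (1 + pi / 2 / D) *+ 2 <= _).
  by rewrite lerMn2r /=; exact: sum_inv1Dsqr.
rewrite [leLHS]mulr2n natrD [leRHS]mulrDl; set A := q%:R * _; suff : 1 + pi / 2 / D <= A.
  by move=> h; exact: lerD.
rewrite /A.
rewrite mulrDr divff ?gt_eqF// lerD2l /D le_eqVlt; apply/orP; left; apply/eqP.
by move: (pi : R) (pi_gt0 R) => c c0; field; rewrite !gt_eqF.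
Qed.

Lemma sin_sqr_lb (y : R) : -1 <= y <= 1 -> cos 1 ^+ 2 * y ^+ 2 <= sin y ^+ 2.
Proof.
suff pos (x : R) : 0 <= x <= 1 -> cos 1 ^+ 2 * x ^+ 2 <= sin x ^+ 2.
  move=> hy; have [y0|y0] := leP 0 y; first by apply: pos; lra.
  by have := pos (- y); rewrite sinN !sqrrN; apply; lra.
move=> /andP[]; rewrite le_eqVlt => /predU1P[<-|x0 x1].
  by rewrite sin0 expr0n mulr0.
have [c] := MVT x0 (fun x _ => is_derive_sin x)
   (continuous_subspaceT (@continuous_sin R)).
rewrite in_itv /= sin0 !subr0 => /andP[c1 c2] ->.
rewrite exprMn ler_wpM2r ?sqr_ge0//.
have cc : cos 1 <= cos c.
  have pi2 := @pi_ge2 R.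
  rewrite leNgt ltr_cos ?in_itv /=; lra.
by rewrite ler_pXn2r// nnegrE ?(le_trans _ cc)// ltW// cos1_gt0.
Qed.

End CircleMean.

(** * Growth in a closed quadrant, with a peak on the diagonal *)

Section SectorBound.
Variable R : realType.
Local Notation C := R[i].
Variable beta : R.
Hypotheses (beta_gt0 : 0 < beta) (beta_lt1 : beta < 1).

Let th := atan beta.
(** The curvature of the exponent at its peak t = pi/4. Inside the sector 2 cos(1)^2 would do; the
    last factor makes the same quadratic bound valid outside it, where the growth bound equals only
    its value on the boundary ray. *)
Definition sector_cst : R := 2 * cos 1 ^+ 2 * (pi / 4 - atan beta) ^+ 2.

Let th_gt0 : 0 < th. Proof. by rewrite -atan0 lt_atan. Qed.
Let th_lt : th < pi / 4. Proof. by rewrite -atan1 lt_atan. Qed.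
Let pi4 : pi / 4 < 1 :> R. Proof. by have := @pihalf_lt2 R; lra. Qed.

Lemma sector_cst_gt0 : 0 < sector_cst.
Proof. by rewrite !mulr_gt0// ?exprn_gt0// ?cos1_gt0// subr_gt0. Qed.

Let cos_sin_shift (t : R) : 2 * (cos t * sin t) = 1 - 2 * sin (t - pi / 4) ^+ 2.
Proof.
have -> : t = (t - pi / 4) + pi / 4 by rewrite subrK.
set y := t - pi / 4; rewrite addrK cosD sinD.
have h4 : sin (pi / 4) = cos (pi / 4) :> R.
  have e : (pi / 4 : R) = pi / 2 - pi / 4 by move: (pi : R) => c; field.
  by rewrite [in LHS]e sinB cos_pihalf sin_pihalf mul1r mul0r subr0.
have := cos2Dsin2 (pi / 4 : R); have := cos2Dsin2 y; rewrite h4.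
move: (cos y) (sin y) (cos (pi / 4)) => a b c h1 h2.
have -> : 2 * ((a * c - b * c) * (b * c + a * c)) =
  (a ^+ 2 + b ^+ 2 - 2 * b ^+ 2) * (c ^+ 2 + c ^+ 2) by ring.
by rewrite h1 h2 mulr1.
Qed.

Let middle (t : R) : th <= t <= pi / 2 - th ->
  2 * (cos t * sin t) <= 1 - sector_cst * (t - pi / 4) ^+ 2.
Proof.
move=> ht; rewrite cos_sin_shift lerD2l lerN2 /sector_cst -/th.
have := @sin_sqr_lb R (t - pi / 4).
have h1 : -1 <= t - pi / 4 <= 1.
  by move: ht; have := th_gt0; have := pi4; lra.
move=> /(_ h1) h; move: (cos 1 ^+ 2) (sqr_ge0 (cos 1 : R)) h => C1 C1_ge0 h.
rewrite -mulrA -mulrA ler_pM2l//; apply: le_trans h; rewrite ler_wpM2l ?sqr_ge0//.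
rewrite ler_piMl ?sqr_ge0// expr_le1//; have := th_gt0; have := th_lt; have := pi4; lra.
Qed.

Let tan_th : sin th = beta * cos th.
Proof.
have c0 : cos th != 0.
  by rewrite gt_eqF// cos_gt0_pihalf// atan_gtNpi2 atan_ltpi2.
by rewrite -[in RHS](atanK beta) -/th /tan mulfVK.
Qed.

(** Because beta < 1, the left side increases with t up to its value beta sin(2 th) on the ray,
    which is at most beta (1 - [sector_cst]); and (t - pi/4)^2 <= 1. *)
Let low (t : R) : 0 <= t <= th ->
  beta ^+ 2 * cos t ^+ 2 + sin t ^+ 2 <=
  beta * (1 - sector_cst * (t - pi / 4) ^+ 2).
Proof.
move=> ht; have pi0 := pi_gt0 R.
have st0 : 0 <= sin t by apply: sin_ge0_pi; have := th_lt; lra.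
have st : sin t <= sin th.
  by rewrite leNgt ltr_sin ?in_itv /=; have := th_lt; lra.
have st2 : sin t ^+ 2 <= sin th ^+ 2.
  by rewrite ler_pXn2r// nnegrE (le_trans st0).
apply: (@le_trans _ _ (beta ^+ 2 * cos th ^+ 2 + sin th ^+ 2)).
  have : 0 <= (1 - beta ^+ 2) * (sin th ^+ 2 - sin t ^+ 2).
    by rewrite mulr_ge0 ?subr_ge0// expr_le1// ltW.
  rewrite !cos2sin2; move: (sin t ^+ 2) (sin th ^+ 2) (beta ^+ 2) => a b c.
  by lra.
have -> : beta ^+ 2 * cos th ^+ 2 + sin th ^+ 2 = beta * (2 * (cos th * sin th)).
  by rewrite tan_th; ring.
rewrite ler_pM2l// cos_sin_shift lerD2l lerN2.
have h1 : -1 <= th - pi / 4 <= 1 by have := th_gt0; have := th_lt; have := pi4; lra.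
apply: (@le_trans _ _ sector_cst); last first.
  rewrite /sector_cst -mulrA ler_pM2l// -/th.
  have -> : (pi / 4 - th) ^+ 2 = (th - pi / 4) ^+ 2 by rewrite -sqrrN opprB.
  exact: sin_sqr_lb.
rewrite ler_piMr ?(ltW sector_cst_gt0)// -sqrrN opprB expr_le1//.
  by have := pi4; lra.
by have := th_lt; lra.
Qed.

Variables (K : R) (P : nat -> C) (G : C -> C).
Hypothesis K_ge0 : 0 <= K.
Hypothesis cvgG : psum_cvg P G.
Hypothesis G_real : forall z, cmod (G z) <=
  K * expR ((beta ^+ 2 * complex.Re z ^+ 2 + complex.Im z ^+ 2) / 2).
Hypothesis G_imag : forall z, cmod (G z) <=
  K * expR ((complex.Re z ^+ 2 + beta ^+ 2 * complex.Im z ^+ 2) / 2).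

(** Phragmen-Lindelof is used between the rays only. Near the axes the two growth hypotheses
    suffice, the upper range being the reflection of [low] in the diagonal. *)
Lemma quadrant_bound r t : 0 < r -> 0 <= t <= pi / 2 ->
  cmod (G (Complex (r * cos t) (r * sin t))) <=
  K * expR (1 / 2) *
    expR (beta * r ^+ 2 / 2 * (1 - sector_cst * (t - pi / 4) ^+ 2)).
Proof.
move=> r0 ht.
have weak z A : cmod (G z) <= K * expR A ->
    A <= beta * r ^+ 2 / 2 * (1 - sector_cst * (t - pi / 4) ^+ 2) ->
    cmod (G z) <= K * expR (1 / 2) *
      expR (beta * r ^+ 2 / 2 * (1 - sector_cst * (t - pi / 4) ^+ 2)).
  move=> /le_trans h hA; apply: h; rewrite -mulrA ler_wpM2l// -expRD ler_expR.
  by lra.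
have r2 : 0 < r ^+ 2 / 2 by rewrite divr_gt0// exprn_gt0.
have [t1|t1] := leP t th.
  apply: weak (G_real _) _ => /=.
  have := @low t; rewrite t1 andbT => /(_ (proj1 (andP ht))).
  by rewrite -(ler_pM2l r2) => h; lra.
have [t2|t2] := leP (pi / 2 - th) t.
  apply: weak (G_imag _) _ => /=.
  have := @low (pi / 2 - t).
  have -> : 0 <= pi / 2 - t <= th by lra.
  have -> : (pi / 2 - t - pi / 4) ^+ 2 = (t - pi / 4) ^+ 2.
    by move: (pi : R) => c; field.
  rewrite sinB cosB cos_pihalf sin_pihalf !mul0r !mul1r add0r subr0.
  by move=> /(_ isT); rewrite -(ler_pM2l r2) => h; lra.
have ht' : th <= t <= pi / 2 - th by rewrite !ltW.
apply: le_trans (phragmen_lindelof beta_gt0 beta_lt1 K_ge0 cvgG G_real G_imag r0 ht') _.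
rewrite ler_wpM2l ?mulr_ge0 ?expR_ge0// ler_expR.
have := middle ht'.
have br : 0 < beta * r ^+ 2 / 2 by rewrite -mulrA mulr_gt0.
by rewrite -(ler_pM2l br) => h; lra.
Qed.

End SectorBound.

(** * Taylor coefficients from the mean over a circle *)

Section CoefficientBound.
Variable R : realType.
Local Notation C := R[i].

Lemma psum_cvg_scale (P : nat -> C) (G : C -> C) (c : C) : cmod c <= 1 ->
  psum_cvg P G -> psum_cvg (fun k => P k * c ^+ k) (fun z => G (c * z)).
Proof.
move=> c1 cv r eps eps0; have [N0 HN] := cv r eps eps0.
exists N0 => N NN z zr.
have -> : psum (fun k => P k * c ^+ k) N z = psum P N (c * z).
  by apply: eq_bigr => k _; rewrite exprMn mulrA.
apply: HN => //; rewrite cmodM; apply: le_trans zr.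
by rewrite ler_piMl// cmod_ge0.
Qed.

Lemma big_ord_mul (a n : nat) (F : nat -> R) :
  \sum_(j < a * n) F j = \sum_(m < a) \sum_(l < n) F (m * n + l)%N.
Proof.
elim: a => [|a IH]; first by rewrite mul0n !big_ord0.
by rewrite mulSn addnC big_split_ord /= IH big_ord_recr.
Qed.

Variables (beta K : R) (P : nat -> C) (G : C -> C).
Hypotheses (beta_gt0 : 0 < beta) (beta_lt1 : beta < 1) (K_ge0 : 0 <= K).
Hypothesis cvgG : psum_cvg P G.
Hypothesis G_real : forall z, cmod (G z) <=
  K * expR ((beta ^+ 2 * complex.Re z ^+ 2 + complex.Im z ^+ 2) / 2).
Hypothesis G_imag : forall z, cmod (G z) <=
  K * expR ((complex.Re z ^+ 2 + beta ^+ 2 * complex.Im z ^+ 2) / 2).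

(* The two growth hypotheses are exchanged by multiplication by i. *)
Let circle_bound (m : nat) r t : 0 < r -> 0 <= t <= pi / 2 ->
  cmod (G (Complex 0 1 ^+ m * Complex (r * cos t) (r * sin t))) <=
  K * expR (1 / 2) *
    expR (beta * r ^+ 2 / 2 * (1 - sector_cst beta * (t - pi / 4) ^+ 2)).
Proof.
have ci : cmod (Complex 0 1 : C) = 1.
  by rewrite /cmod /= expr0n expr1n add0r sqrtr1.
suff H : forall z : C, (complex.Re (Complex 0 1 ^+ m * z) ^+ 2 = complex.Re z ^+ 2 /\
    complex.Im (Complex 0 1 ^+ m * z) ^+ 2 = complex.Im z ^+ 2) \/
    (complex.Re (Complex 0 1 ^+ m * z) ^+ 2 = complex.Im z ^+ 2 /\
    complex.Im (Complex 0 1 ^+ m * z) ^+ 2 = complex.Re z ^+ 2).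
  move=> r0 ht.
  apply: (@quadrant_bound _ _ beta_gt0 beta_lt1 K
    (fun k => P k * (Complex 0 1 ^+ m) ^+ k) (fun z => G (Complex 0 1 ^+ m * z))) => //.
  - by apply: psum_cvg_scale => //; rewrite cmodX ci expr1n.
  - move=> z; case: (H z) => -[e1 e2].
      by apply: le_trans (G_real _) _; rewrite e1 e2.
    by apply: le_trans (G_imag _) _; rewrite e1 e2 addrC.
  - move=> z; case: (H z) => -[e1 e2].
      by apply: le_trans (G_imag _) _; rewrite e1 e2.
    by apply: le_trans (G_real _) _; rewrite e1 e2 addrC.
elim: m => [|m IH] z; first by left; rewrite expr0 mul1r.
have -> : Complex 0 1 ^+ m.+1 * z = Complex 0 1 ^+ m * (Complex 0 1 * z).
  by rewrite exprSr mulrA.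
have e1 : complex.Re (Complex 0 1 * z) ^+ 2 = complex.Im z ^+ 2.
  by rewrite ReM /= mul0r mul1r sub0r sqrrN.
have e2 : complex.Im (Complex 0 1 * z) ^+ 2 = complex.Re z ^+ 2.
  by rewrite ImM /= mul0r mul1r add0r.
by case: (IH (Complex 0 1 * z)); rewrite e1 e2 => -[-> ->]; [right|left].
Qed.

(** The first factor is the Phragmen-Lindelof constant; the second bounds sqrt k times the mean of
    the Gaussian exp(-(k c/2) (t - pi/4)^2), where c is [sector_cst]. *)
Definition coef_cst : R :=
  expR (1 / 2) * (1 + 2 / Num.sqrt (sector_cst beta / 2)).

Lemma coef_cst_gt0 : 0 < coef_cst.
Proof.
rewrite mulr_gt0 ?expR_gt0// ltr_wpDr// divr_ge0// sqrtr_ge0//.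
Qed.

Lemma coefficient_bound (k : nat) (r : R) : (0 < k)%N -> 0 < r ->
  beta * r ^+ 2 = k%:R ->
  cmod (P k) * r ^+ k <= K * coef_cst * expR (k%:R / 2) / Num.sqrt k%:R.
Proof.
move=> k0 r0 brk; apply/ler_addgt0Pr => eps eps0.
have [N0 HN] := cvgG r eps0.
(* M is a multiple of 4 so that the nodes split into four quadrants exchanged by powers of i, and n
   is even so that pi/4 is a node of each. Besides M >= N0 and M > k, the choice gives q >= k, hence
   1/q <= 1/sqrt k. *)
pose q := (N0 + k)%N; pose n := (q + q)%N; pose M := (4 * n)%N.
have q0 : (0 < q)%N by rewrite addn_gt0 k0 orbT.
have kM : (k < M)%N by rewrite /M /n /q; lia.
have NM : (N0 <= M)%N by rewrite /M /n /q; lia.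
have n0 : (0 < n)%N by rewrite addn_gt0 q0.
have nR : 0 < n%:R :> R by rewrite ltr0n.
have MR : 0 < M%:R :> R by rewrite ltr0n /M muln_gt0.
have kR : 0 < k%:R :> R by rewrite ltr0n.
set c := sector_cst beta.
have c0 : 0 < c by exact: sector_cst_gt0.
have cu j : cmod (uroot R M ^+ j) = 1 by rewrite urootX cmod_cexp /= expR0.
have cr : cmod (Complex r 0 : C) = r by rewrite cmod_real gtr0_norm.
pose Psi (l : nat) : R := K * expR (1 / 2) * expR (k%:R / 2) *
  expR (- (k%:R * c / 2 * (pi * l%:R / n.*2%:R - pi / 4) ^+ 2)).
have pt m l : (l < n)%N ->
    cmod (G (Complex r 0 * uroot R M ^+ (m * n + l))) <= Psi l.
  move=> ln; pose t : R := pi * l%:R / n.*2%:R.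
  have -> : Complex r 0 * uroot R M ^+ (m * n + l) =
      Complex 0 1 ^+ m * Complex (r * cos t) (r * sin t).
    have -> : Complex 0 1 = uroot R M ^+ n.
      rewrite urootX cexp_expi /expi.
      have -> : 2 * pi * n%:R / M%:R = pi / 2 :> R.
        rewrite /M natrM; move: (pi : R) => p'; field; by rewrite gt_eqF.
      by rewrite cos_pihalf sin_pihalf.
    rewrite exprD mulnC exprM mulrCA; congr (_ * _).
    rewrite urootX cexp_expi /expi.
    have -> : 2 * pi * l%:R / M%:R = t.
      rewrite /t /M -muln2 !natrM; move: (pi : R) => p'; field.
      by rewrite gt_eqF.
    by apply: complexP; rewrite !ReImE /=; ring.
  apply: le_trans (circle_bound _ r0 _) _.
    rewrite /t -muln2 natrM; apply/andP; split.
      by rewrite divr_ge0// mulr_ge0// pi_ge0.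
    rewrite ler_pdivrMr ?mulr_gt0//.
    have -> : pi / 2 * (n%:R * 2) = pi * n%:R :> R.
      by move: (pi : R) => p'; field.
    by rewrite ler_pM2l ?pi_gt0// ler_nat ltnW.
  rewrite /Psi brk -/c -/t -!mulrA ler_wpM2l// ler_pM2l ?expR_gt0//.
  by rewrite -expRD ler_expR; lra.
have tot : M%:R * (cmod (P k) * r ^+ k) <= 4 * (\sum_(l < n) Psi l) + M%:R * eps.
  have -> : M%:R * (cmod (P k) * r ^+ k) =
      cmod (\sum_(j < M) psum P M (Complex r 0 * uroot R M ^+ j) *
        uroot R M ^+ (j * (M - k))).
    rewrite psum_coef// !cmodM cmodX cr; congr (_ * _).
    have -> : (M%:R : C) = Complex M%:R 0 by rewrite ComplexMn mul0rn.
    by rewrite cmod_real gtr0_norm.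
  apply: le_trans (ler_cmod_sum _ _ _) _.
  apply: (@le_trans _ _ (\sum_(j < M)
    (cmod (G (Complex r 0 * uroot R M ^+ j)) + eps))).
    apply: ler_sum => j _; rewrite cmodM cu mulr1.
    set z := Complex r 0 * _; have := HN M NM z.
    rewrite cmodM cr cu mulr1 lexx => /(_ isT) h.
    apply: le_trans (lerD (lexx (cmod (G z))) h).
    by rewrite -(cmodN (G z - _)) -{1}(subrK (G z) (psum P M z)) opprB addrC; exact: ler_cmodD.
  rewrite big_split /= sumr_const card_ord -[eps *+ _]mulr_natl lerD2r.
  rewrite (@big_ord_mul 4 n (fun j => cmod (G (Complex r 0 * uroot R M ^+ j)))).
  apply: (@le_trans _ _ (\sum_(m < 4) \sum_(l < n) Psi l)).
    by apply: ler_sum => m _; apply: ler_sum => l _; exact: pt.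
  by rewrite sumr_const card_ord -[leLHS]mulr_natl.
have kap0 : 0 < k%:R * c / 2 by rewrite divr_gt0// mulr_gt0.
have gs := gauss_riemann_sum kap0 q0; rewrite -/n in gs.
have sumPsi : \sum_(l < n) Psi l <= n%:R * (K * coef_cst * expR (k%:R / 2) / Num.sqrt k%:R).
  rewrite /Psi -mulr_sumr.
  apply: le_trans (ler_wpM2l _ gs) _; first by rewrite !mulr_ge0// expR_ge0.
  rewrite mulrCA ler_pM2l// /coef_cst -/c.
  have -> : K * (expR (1 / 2) * (1 + 2 / Num.sqrt (c / 2))) * expR (k%:R / 2) / Num.sqrt k%:R
    = K * expR (1 / 2) * expR (k%:R / 2) * ((1 + 2 / Num.sqrt (c / 2)) / Num.sqrt k%:R) by ring.
  rewrite ler_wpM2l ?mulr_ge0 ?expR_ge0// [leRHS]mulrDl mul1r; apply: lerD.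
    rewrite lef_pV2 ?posrE ?ltr0n// ?sqrtr_gt0//.
    apply: le_trans (_ : k%:R <= _); last by rewrite ler_nat leq_addl.
    rewrite -[leRHS]ger0_norm// -sqrtr_sqr ler_wsqrtr// expr2 ler_peMr//.
    by rewrite ler1n.
  have -> : k%:R * c / 2 = k%:R * (c / 2) by rewrite mulrA.
  rewrite sqrtrM ?ler0n// invfM.
  by move: (Num.sqrt k%:R)^-1 (Num.sqrt (c / 2))^-1 => a b; lra.
rewrite -(ler_pM2l MR); apply: le_trans tot _.
rewrite mulrDr lerD2r; apply: le_trans (ler_wpM2l _ sumPsi) _ => //.
by rewrite [leLHS]mulrA /M natrM.
Qed.

End CoefficientBound.

(** * Hermite functions and the series of exp (a z + b z^2) *)

Section ScaledHermite.
Variable R : realType.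
Implicit Types (a b x r : R) (k : nat).

(* hq a b k is the coefficient of z^k in exp (a z + b z^2). *)
Fixpoint hqp a b k : R * R :=
  if k is k'.+1 then
    let: (u, v) := hqp a b k' in (v, (a * v + 2 * b * u) / k'.+2%:R)
  else (1, a).

Definition hq a b k := (hqp a b k).1.

Lemma hq0 a b : hq a b 0 = 1. Proof. by []. Qed.
Lemma hq1 a b : hq a b 1 = a. Proof. by []. Qed.

Lemma hqSS a b k :
  k.+2%:R * hq a b k.+2 = a * hq a b k.+1 + 2 * b * hq a b k.
Proof.
rewrite /hq /=; case: (hqp a b k) => u v /=.
by rewrite mulrC mulfVK// pnatr_eq0.
Qed.

Lemma hqS a b k : k.+1%:R * hq a b k.+1 =
  a * hq a b k + 2 * b * (if k is j.+1 then hq a b j else 0).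
Proof. by case: k => [|k]; [rewrite hq1 hq0; ring|exact: hqSS]. Qed.

Lemma nat2_ind (Q : nat -> Prop) :
  Q 0%N -> Q 1%N -> (forall k, Q k -> Q k.+1 -> Q k.+2) -> forall k, Q k.
Proof.
move=> q0 q1 qS k; suff: Q k /\ Q k.+1 by case.
by elim: k => [//|k [h1 h2]]; split=> //; exact: qS.
Qed.

(** The recurrence is S' = (a + 2 b z) S for S = exp(a z + b z^2). Identities such as [hq_scale] and
    [hqD] then follow by checking that both sides satisfy it. *)
Lemma hq_unique a b (u : nat -> R) : u 0%N = 1 ->
  (forall k, k.+1%:R * u k.+1 =
     a * u k + 2 * b * (if k is j.+1 then u j else 0)) ->
  forall k, u k = hq a b k.
Proof.
move=> u0 uS; apply: nat2_ind => [//||k h1 h2].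
  by have := uS 0%N; rewrite u0 mulr1 mulr0 addr0 mul1r.
have k2 : k.+2%:R != 0 :> R by rewrite pnatr_eq0.
by apply: (mulfI k2); rewrite uS h1 h2 hqSS.
Qed.

Lemma hq_scale r a b k : hq (r * a) (r ^+ 2 * b) k = r ^+ k * hq a b k.
Proof.
symmetry; apply: (hq_unique (u := fun k => r ^+ k * hq a b k)) => {k}[|k].
  by rewrite expr0 mul1r.
by rewrite mulrCA hqS; case: k => [|k]; rewrite ?exprS; ring.
Qed.

Lemma hq00 k : hq 0 0 k = (k == 0%N)%:R.
Proof.
symmetry; apply: (hq_unique (u := fun k => (k == 0%N)%:R)) => // {}k.
by rewrite !mulr0 !mul0r addr0.
Qed.

Lemma hqD a b a' b' k : hq (a + a') (b + b') k =
  \sum_(j < k.+1) hq a b j * hq a' b' (k - j).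
Proof.
pose cv a b a' b' k := \sum_(j < k.+1) hq a b j * hq a' b' (k - j).
symmetry; apply: (hq_unique (u := cv a b a' b')) => {k}[|k].
  by rewrite /cv big_ord_recl big_ord0 addr0 mulr1.
(* The product rule: writing k + 1 = j + (k + 1 - j) splits the derivative of the convolution into
   two sums, each computed by one recurrence. *)
have half (x y x' y' : R) : \sum_(j < k.+2) j%:R * (hq x y j * hq x' y' (k.+1 - j)) =
    x * cv x y x' y' k + 2 * y * (if k is j.+1 then cv x y x' y' j else 0).
  rewrite big_ord_recl mul0r add0r.
  rewrite (eq_bigr (fun i : 'I_k.+1 => x * (hq x y i * hq x' y' (k - i)) +
     2 * y * ((if nat_of_ord i is j.+1 then hq x y j else 0) * hq x' y' (k - i)))).
    rewrite big_split /= -!mulr_sumr; congr (_ + _ * _).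
    case: (k) => [|k']; first by rewrite big_ord_recl big_ord0 mul0r addr0.
    by rewrite big_ord_recl mul0r add0r.
  by move=> i _; rewrite lift0 subSS mulrA hqS; ring.
have sym k' : cv a' b' a b k' = cv a b a' b' k'.
  rewrite /cv (reindex_inj rev_ord_inj) /=; apply: eq_bigr => i _.
  by rewrite subSS subKn 1?mulrC// -ltnS.
have -> : k.+1%:R * cv a b a' b' k.+1 =
    \sum_(j < k.+2) j%:R * (hq a b j * hq a' b' (k.+1 - j)) +
    \sum_(j < k.+2) j%:R * (hq a' b' j * hq a b (k.+1 - j)).
  rewrite [X in _ + X](reindex_inj rev_ord_inj) /= -big_split /= /cv mulr_sumr.
  apply: eq_bigr => i _; have ik : (i <= k.+1)%N by rewrite -ltnS.
  rewrite subSS subKn// [hq a' b' _ * _]mulrC -mulrDl -natrD subnKC//.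
rewrite !half !sym {half}; case: k => [|k]; last rewrite !sym; ring.
Qed.

Lemma hq_sum (I : Type) (s : seq I) (a b : I -> R) N k : (k < N)%N ->
  hq (\sum_(i <- s) a i) (\sum_(i <- s) b i) k =
  (\prod_(i <- s) \poly_(m < N) hq (a i) (b i) m)`_k.
Proof.
elim: s k => [|i s IH] k kN; first by rewrite !big_nil hq00 coef1.
rewrite !big_cons hqD coefM; apply: eq_bigr => j _.
have jk : (j <= k)%N by rewrite -ltnS.
by rewrite coef_poly (leq_ltn_trans jk kN) -IH// (leq_ltn_trans (leq_subr _ _)).
Qed.

Lemma hq_a0 a k : hq a 0 k = a ^+ k / k`!%:R.
Proof.
symmetry; apply: (hq_unique (u := fun k => a ^+ k / k`!%:R)) => {k}[|k].
  by rewrite fact0 expr0 divr1.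
rewrite mulr0 mul0r addr0 factS natrM exprS.
by field; rewrite nat1r !pnatr_eq0 -lt0n fact_gt0.
Qed.

Lemma hq_0b b m : hq 0 b m.*2 = b ^+ m / m`!%:R /\ hq 0 b m.*2.+1 = 0.
Proof.
elim: m => [|m [IH1 IH2]]; first by rewrite fact0 expr0 divr1.
rewrite doubleS.
have h1 : hq 0 b m.*2.+2 = b ^+ m.+1 / m.+1`!%:R.
  have k2 : m.*2.+2%:R != 0 :> R by rewrite pnatr_eq0.
  apply: (mulfI k2); rewrite hqSS mul0r add0r IH1 factS natrM exprS.
  rewrite -doubleS -muln2 natrM.
  by field; rewrite nat1r !pnatr_eq0 -lt0n fact_gt0.
split=> //.
have k2 : m.*2.+3%:R != 0 :> R by rewrite pnatr_eq0.
by apply: (mulfI k2); rewrite hqSS IH2 mul0r !mulr0 addr0.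
Qed.

Lemma exprn_fact_le x k : 0 <= x -> x ^+ k / k`!%:R <= expR x.
Proof.
case: k => [|k] x0; first by rewrite fact0 expr0 divr1 -expR0 ler_expR.
by apply: le_trans (expR_ge1Dxn k x0); rewrite lerDr.
Qed.

(** Each term of the convolution of the series of exp(a r) and exp(b r^2) is bounded by the product
    of the two sums; k + 1 counts the terms. *)
Lemma hq_le_expR a b r k : 0 <= a -> 0 <= b -> 0 <= r ->
  hq a b k * r ^+ k <= k.+1%:R * expR (a * r + b * r ^+ 2).
Proof.
move=> a0 b0 r0; rewrite mulrC -hq_scale.
rewrite -[r * a]addr0 -[r ^+ 2 * b]add0r hqD.
apply: (@le_trans _ _ (\sum_(j < k.+1) expR (a * r) * expR (b * r ^+ 2))).
  apply: ler_sum => j _.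
  have p0 : 0 <= r ^+ 2 * b by rewrite mulr_ge0// sqr_ge0.
  have h : 0 <= hq 0 (r ^+ 2 * b) (k - j) <= expR (b * r ^+ 2).
    rewrite -(odd_double_half (k - j)); case: (odd _).
      by rewrite add1n (hq_0b _ _).2 expR_ge0 lexx.
    rewrite add0n (hq_0b _ _).1 divr_ge0 ?exprn_ge0//=.
    by rewrite (mulrC b); exact: exprn_fact_le.
  case/andP: h => h1 h2; apply: ler_pM => //.
    by rewrite hq_a0 divr_ge0// exprn_ge0// mulr_ge0.
  by rewrite hq_a0 (mulrC a); apply: exprn_fact_le; rewrite mulr_ge0.
by rewrite sumr_const card_ord -expRD mulr_natl.
Qed.

Lemma norm_hq_le a b k : `|hq a b k| <= hq `|a| `|b| k.
Proof.
elim/nat2_ind: k => [||k h1 h2]; first by rewrite !hq0 normr1.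
  by rewrite !hq1.
have k2 : 0 < k.+2%:R :> R by rewrite ltr0n.
rewrite -(ler_pM2l k2) -[X in X * _](@ger0_norm R k.+2%:R)// -normrM !hqSS.
apply: le_trans (ler_normD _ _) _; rewrite !normrM normr_nat.
apply: lerD; first by rewrite ler_wpM2l.
by rewrite ler_wpM2l// mulr_ge0.
Qed.

Lemma is_derive_hq b k x :
  is_derive x 1 (fun t : R => hq t b k) (if k is j.+1 then hq x b j else 0).
Proof.
elim/nat2_ind: k => [||k h1 h2].
- by under eq_fun do rewrite hq0; exact: is_derive_cst.
- by under eq_fun do rewrite hq1; exact: is_derive_id.
have k2 : k.+2%:R != 0 :> R by rewrite pnatr_eq0.
have E t : hq t b k.+2 = k.+2%:R^-1 * (t * hq t b k.+1 + 2 * b * hq t b k).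
  by apply: (mulfI k2); rewrite hqSS mulVKf.
under eq_fun do rewrite E.
apply: is_derive_eq1; rewrite /GRing.scale /=.
have := hqS x b k; move: (if k is j.+1 then hq x b j else 0) => A E2.
apply: (mulfI k2); rewrite mulVKf//.
rewrite -[k.+2%:R]natr1 [RHS]mulrDl E2.
by move: (hq x b k) (hq x b k.+1) => u v; ring.
Qed.

(** Here [hq (2 * x) (-1) k] is H_k(x)/k!, by the generating function exp(2 x z - z^2) of the
    Hermite polynomials. *)
Lemma hermite_derive k x :
  derive1n k (fun t : R => expR (- t ^+ 2)) x =
  (-1) ^+ k * k`!%:R * hq (2 * x) (-1) k * expR (- x ^+ 2).
Proof.
elim: k x => [|k IH] x; first by rewrite fact0 hq0 !mul1r.
rewrite derive1nS.
rewrite (_ : derive1n k _ = fun t : R =>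
  (-1) ^+ k * k`!%:R * hq (2 * t) (-1) k * expR (- t ^+ 2)); last exact/funext.
have dh : is_derive x 1 (fun t : R => hq (2 * t) (-1) k)
    (2 * (if k is j.+1 then hq (2 * x) (-1) j else 0)).
  have d1 := is_derive_hq (-1) k (2 * x).
  have d2 : is_derive x 1 (fun t : R => 2 * t) 2.
    by apply: is_derive_eq1; rewrite /GRing.scale /= ?mulr1 ?mulr0 ?addr0 ?add0r.
  by have := is_derive1_comp d1 d2; rewrite /GRing.scale /= mulrC.
rewrite derive1E.
have dd : is_derive x 1 (fun t : R =>
    (-1) ^+ k * k`!%:R * hq (2 * t) (-1) k * expR (- t ^+ 2))
    ((-1) ^+ k.+1 * k.+1`!%:R * hq (2 * x) (-1) k.+1 * expR (- x ^+ 2)).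
  apply: is_derive_eq1; rewrite /GRing.scale /=.
  rewrite factS natrM [(-1) ^+ k.+1]exprS.
  have := hqS (2 * x) (-1) k.
  set A := (if k is j.+1 then _ else _); set B := hq _ _ k.+1 => E.
  rewrite [RHS](_ : _ =
    - (-1) ^+ k * k`!%:R * (k.+1%:R * B) * expR (- x ^+ 2)); last by ring.
  by rewrite E; move: ((-1) ^+ k) (k`!%:R) => s f; ring.
by rewrite derive_val.
Qed.

(** Rescaling z by sqrt 2 absorbs the normalizing power of 2 and turns the generating function into
    the Bargmann kernel exp(sqrt 2 x z - z^2/2). *)
Lemma hermite_hq k x : hermite k x =
  Num.sqrt k`!%:R / Num.sqrt (Num.sqrt pi) *
  hq (Num.sqrt 2 * x) (- (2^-1)) k * expR (- x ^+ 2 / 2).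
Proof.
rewrite /hermite hermite_derive.
have s2 : (Num.sqrt 2 : R) ^+ 2 = 2 by rewrite sqr_sqrtr.
have -> : hq (2 * x) (-1) k = Num.sqrt 2 ^+ k * hq (Num.sqrt 2 * x) (- 2^-1) k.
  rewrite -hq_scale mulrA -expr2 s2; congr hq.
  by rewrite mulrN divff.
have kf : 0 < k`!%:R :> R by rewrite ltr0n fact_gt0.
have sp : 0 < Num.sqrt (pi : R) by rewrite sqrtr_gt0 pi_gt0.
have ssp : 0 < Num.sqrt (Num.sqrt (pi : R)) by rewrite sqrtr_gt0.
have sk : 0 < Num.sqrt (k`!%:R : R) by rewrite sqrtr_gt0.
have sn : 0 < Num.sqrt (2 : R) ^+ k by rewrite exprn_gt0// sqrtr_gt0.
rewrite sqrtrM ?mulr_ge0 ?exprn_ge0 ?ler0n// sqrtrM ?exprn_ge0//.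
have -> : Num.sqrt (2 ^+ k : R) = Num.sqrt 2 ^+ k.
  rewrite -[in LHS]s2 -exprM mulnC exprM sqrtr_sqr ger0_norm//; exact: ltW.
have -> : expR (- x ^+ 2) = expR (- x ^+ 2 / 2) * expR (- x ^+ 2 / 2).
  by rewrite -expRD; congr expR; field.
have fE : k`!%:R = Num.sqrt k`!%:R ^+ 2 :> R by rewrite sqr_sqrtr ?ltW.
have ee : expR (x ^+ 2 / 2) * expR (- x ^+ 2 / 2) = 1.
  by rewrite -expRD -mulrDl subrr mul0r expR0.
have sgn : (-1) ^+ k * (-1) ^+ k = 1 :> R by rewrite -expr2 sqrr_sign.
move: ee sgn; set e1 := expR (x ^+ 2 / 2); set e2 := expR (- x ^+ 2 / 2).
move: ((-1) ^+ k) (Num.sqrt 2 ^+ k) sn (Num.sqrt (Num.sqrt pi)) ssp (hq _ _ k).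
move: (Num.sqrt k`!%:R) sk fE => f f0; move: (k`!%:R) => F ->.
move=> s t t0 p p0 h ee sgn.
have -> : s * (t * f * p)^-1 * e1 * (s * f ^+ 2 * (t * h) * (e2 * e2)) =
  (s * s) * (e1 * e2) * ((t * f * p)^-1 * (f ^+ 2 * (t * h))) * e2 by ring.
rewrite ee sgn !mul1r; field; by rewrite !gt_eqF.
Qed.

End ScaledHermite.

(** * Uniform convergence of the series of exp (a z + b z^2) *)

Section ExponentialSeries.
Variable R : realType.
Local Notation C := R[i].

Fixpoint epow (m : nat) : entexpr R :=
  if m is m'.+1 then EMul (EVar R) (epow m') else EConst 1.

Lemma eval_epow m w : eval (epow m) w = w ^+ m.
Proof. by elim: m => [//|m IH] /=; rewrite IH exprS. Qed.

Lemma eval_ediff_epow m w : eval (ediff (epow m)) w = m%:R * w ^+ m.-1.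
Proof.
elim: m => [|m IH] /=; first by rewrite mul0r.
rewrite eval_epow IH mul1r; case: m {IH} => [|m] /=; first by rewrite mul0r mulr0 addr0 mul1r.
by rewrite -[m.+2%:R]nat1r [RHS]mulrDl mul1r exprS mulrCA.
Qed.

Fixpoint epoly (c : nat -> C) (N : nat) : entexpr R :=
  if N is M.+1 then EAdd (epoly c M) (EMul (EConst (c M)) (epow M))
  else EConst 0.

Lemma eval_epoly c N w : eval (epoly c N) w = psum c N w.
Proof.
rewrite /psum; elim: N => [|N IH] /=; first by rewrite big_ord0.
by rewrite big_ord_recr /= IH eval_epow.
Qed.

(* Truncating the series perturbs the equation S' = (al + 2 be w) S only in the
   last two degrees. *)
Lemma eval_ediff_epoly (c : nat -> C) (al be : C) N w :
  c 0%N = 1 -> c 1%N = al ->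
  (forall k, k.+2%:R * c k.+2 = al * c k.+1 + 2 * be * c k) ->
  eval (ediff (epoly c N.+1)) w - (al + 2 * be * w) * psum c N.+1 w =
  - (N.+1%:R * c N.+1 * w ^+ N + 2 * be * c N * w ^+ N.+1).
Proof.
move=> c0 c1 cS; elim: N => [|N IH].
  by rewrite /psum big_ord_recl big_ord0 /= c0 c1; ring.
rewrite {1}/epoly -/(epoly c N.+1); cbn [ediff eval].
rewrite eval_ediff_epow mul0r add0r /psum big_ord_recr /= -/(psum c N.+1 w).
rewrite mulrDr opprD addrACA IH cS !exprS; ring.
Qed.

(** The mean value theorem is real, so the increment is first rotated onto the real axis by
    [cmod_rot]. *)
Lemma ler_cmod_eval_diff (e : entexpr R) (M : R) :
  (forall s, 0 <= s <= 1 -> cmod (eval (ediff e) (Complex s 0)) <= M) ->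
  cmod (eval e (Complex 1 0) - eval e (Complex 0 0)) <= M.
Proof.
move=> H; have [c c1 cE] := cmod_rot (eval e (Complex 1 0) - eval e (Complex 0 0)).
pose e' := EMul (EConst c) e.
have d s := (is_derive_eval_Re e' s 0).1.
have [x] := MVT (@ltr01 R) (fun s _ => d s)
  (continuous_subspaceT (is_derive_continuous d)).
rewrite in_itv /= subr0 mulr1 mul0r add0r => /andP[x0 x1].
rewrite -ReN -ReD -mulrBr cE /= => ->.
apply: le_trans (ler_norm _) _; apply: le_trans (ler_Re_cmod _) _.
rewrite cmodM -[leRHS]mul1r; apply: ler_pM; rewrite ?cmod_ge0//.
by apply: H; rewrite !ltW.
Qed.

Lemma sqr_le_pow2 (N : nat) : (N.+2 ^ 2 <= 5 * 2 ^ N)%N.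
Proof.
case: N => [//|N]; elim: N => [//|N]; rewrite [(2 ^ N.+2)%N]expnS -!mulnn.
by move: (2 ^ N.+1)%N => X; nia.
Qed.

(** With S_N the truncated series along w -> w z, the function S_N(w) exp(-(al w + be w^2)) is 1 at
    w = 0, and its derivative involves only the last two coefficients by [eval_ediff_epoly]. Its
    increment over [0, 1] is the error up to an exponential factor. A rate 1/N is enough; what
    matters is that the dependence on a is exponential in |a| only. *)
Lemma cexp_psum_hq (a b r : R) (z : C) (N : nat) : cmod z <= r ->
  cmod (cexp (Complex a 0 * z + Complex b 0 * z ^+ 2) -
        psum (fun k => Complex (hq a b k) 0) N.+1 z) <=
  5 / N.+1%:R * (1 + 2 * `|b| * r ^+ 2) *
    expR (6 * (`|a| * r) + 18 * (`|b| * r ^+ 2)).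
Proof.
move=> zr; have r0 : 0 <= r by exact: le_trans (cmod_ge0 _) zr.
set al := Complex a 0 * z; set be := Complex b 0 * z ^+ 2.
pose c k := Complex (hq a b k) 0 * z ^+ k.
have cS k : k.+2%:R * c k.+2 = al * c k.+1 + 2 * be * c k.
  have E : (k.+2%:R : C) * Complex (hq a b k.+2) 0 =
      Complex a 0 * Complex (hq a b k.+1) 0 + 2 * Complex b 0 * Complex (hq a b k) 0.
    have natC n : (n%:R : C) = Complex n%:R 0 by rewrite ComplexMn mul0rn.
    rewrite !natC; apply: complexP; rewrite !ReImE /=; last by ring.
    by move: (hqSS a b k); lra.
  by rewrite /c mulrA E /al /be !exprS; ring.
have c0 : c 0%N = 1 by rewrite /c hq0 expr0 mulr1.
have c1 : c 1%N = al by rewrite /c hq1 expr1.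
have -> : psum (fun k => Complex (hq a b k) 0) N.+1 z = psum c N.+1 1.
  by apply: eq_bigr => k _; rewrite /c expr1n mulr1.
set A := `|a| * r + `|b| * r ^+ 2.
have zr2 : cmod z ^+ 2 <= r ^+ 2 by rewrite ler_pXn2r ?nnegrE ?cmod_ge0.
have calA : cmod al <= `|a| * r by rewrite cmodM cmod_real ler_wpM2l.
have cbeA : cmod be <= `|b| * r ^+ 2 by rewrite cmodM cmod_real cmodX ler_wpM2l.
(* [hq_le_expR] is applied at radius 4 r, which gains 4^-k. The final constants are 6 = 4 + 2 and 18
   = 16 + 2, the 2 coming from two factors exp A. *)
pose x4 := expR (4 * (`|a| * r) + 16 * (`|b| * r ^+ 2)).
have cb k : cmod (c k) <= k.+1%:R * x4 / 4 ^+ k.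
  rewrite /c cmodM cmod_real cmodX.
  apply: (@le_trans _ _ (hq `|a| `|b| k * r ^+ k)).
    apply: ler_pM; rewrite ?exprn_ge0 ?cmod_ge0 ?norm_hq_le//.
    by rewrite lerXn2r ?nnegrE ?cmod_ge0.
  rewrite ler_pdivlMr ?exprn_gt0// -mulrA -exprMn /x4.
  apply: le_trans (hq_le_expR _ _ _ _) _; rewrite ?mulr_ge0//.
  by rewrite ler_wpM2l// ler_expR; lra.
clearbody c al be.
pose e := EMul (epoly c N.+1) (EExp (EMul (EConst (-1))
  (EAdd (EMul (EConst al) (EVar R)) (EMul (EConst be) (EMul (EVar R) (EVar R)))))).
have eE w : eval e w = psum c N.+1 w * cexp (- (al * w + be * (w * w))).
  by rewrite /e; cbn [eval]; rewrite eval_epoly mulN1r.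
have deE w : eval (ediff e) w = cexp (- (al * w + be * (w * w))) *
   - (N.+1%:R * c N.+1 * w ^+ N + 2 * be * c N * w ^+ N.+1).
  rewrite -(eval_ediff_epoly N w c0 c1 cS) /e; cbn [eval ediff].
  by rewrite eval_epoly !mulN1r; ring.
pose M := expR A * (N.+1%:R * (N.+2%:R * x4 / 4 ^+ N.+1) +
   2 * (`|b| * r ^+ 2) * (N.+1%:R * x4 / 4 ^+ N)).
have F : cmod (eval e (Complex 1 0) - eval e (Complex 0 0)) <= M.
  apply: ler_cmod_eval_diff => s /andP[s0 s1].
  have cs : cmod (Complex s 0 : C) <= 1 by rewrite cmod_real ger0_norm.
  have csn n : cmod (Complex s 0 : C) ^+ n <= 1 by rewrite exprn_ile1 ?cmod_ge0.
  rewrite deE cmodM /M; apply: ler_pM; rewrite ?cmod_ge0//.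
    rewrite cmod_cexp ler_expR; apply: le_trans (ler_norm _) _.
    apply: le_trans (ler_Re_cmod _) _; rewrite cmodN.
    apply: le_trans (ler_cmodD _ _) _; rewrite /A; apply: lerD.
      by rewrite cmodM -[leRHS]mulr1; apply: ler_pM; rewrite ?cmod_ge0.
    rewrite cmodM -[leRHS]mulr1; apply: ler_pM; rewrite ?cmod_ge0//.
    by rewrite -expr2 cmodX.
  have cn n : cmod (n%:R : C) = n%:R.
    have -> : (n%:R : C) = Complex n%:R 0 by rewrite ComplexMn mul0rn.
    by rewrite cmod_real normr_nat.
  rewrite cmodN; apply: le_trans (ler_cmodD _ _) _; apply: lerD.
    rewrite !cmodM cmodX cn -mulrA ler_wpM2l// -[leRHS]mulr1.
    by apply: ler_pM; rewrite ?exprn_ge0 ?cmod_ge0 ?cb.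
  rewrite !cmodM cmodX cn -[leRHS]mulr1.
  apply: ler_pM; rewrite ?exprn_ge0 ?mulr_ge0 ?cmod_ge0//.
  by apply: ler_pM; rewrite ?mulr_ge0 ?cmod_ge0 ?cb// ler_wpM2l.
have -> : cmod (cexp (al + be) - psum c N.+1 1) = cmod (cexp (al + be)) *
    cmod (eval e (Complex 1 0) - eval e (Complex 0 0)).
  rewrite -cmodM -cmodN; congr cmod.
  have -> : Complex 1 0 = 1 :> C by [].
  have -> : Complex 0 0 = 0 :> C by [].
  rewrite !eE !mulr0 addr0 oppr0 cexp0 !mulr1.
  have -> : psum c N.+1 0 = 1.
    rewrite /psum big_ord_recl /= c0 expr0 mulr1 big1 ?addr0// => i _.
    by rewrite expr0n /= mulr0.
  rewrite mulrBr mulr1 mulrCA -cexpD subrr cexp0 mulr1; ring.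
apply: (@le_trans _ _ (expR A * M)).
  apply: ler_pM; rewrite ?cmod_ge0// cmod_cexp ler_expR.
  apply: le_trans (ler_norm _) _; apply: le_trans (ler_Re_cmod _) _.
  by apply: le_trans (ler_cmodD _ _) _; exact: lerD.
have x40 : 0 < x4 by exact: expR_gt0.
set B := `|b| * r ^+ 2; have B0 : 0 <= B by rewrite mulr_ge0// sqr_ge0.
have -> : expR (6 * (`|a| * r) + 18 * B) = expR A * expR A * x4.
  by rewrite /x4 -!expRD /A -/B; congr expR; ring.
rewrite /M -/B mulrA.
have -> : 5 / N.+1%:R * (1 + 2 * `|b| * r ^+ 2) * (expR A * expR A * x4) =
  expR A * expR A * (5 / N.+1%:R * (1 + 2 * B) * x4) by rewrite /B; ring.
rewrite ler_pM2l ?mulr_gt0 ?expR_gt0//.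
have key : N.+2%:R ^+ 2 / 4 ^+ N <= 5 / N.+1%:R :> R.
  rewrite ler_pdivrMr ?exprn_gt0// mulrAC ler_pdivlMr ?ltr0n//.
  have h1 : N.+2%:R ^+ 2 <= 5 * 2 ^+ N :> R.
    by rewrite -!natrX -natrM ler_nat sqr_le_pow2.
  have h2 : N.+1%:R <= 2 ^+ N :> R by rewrite -natrX ler_nat ltn_expl.
  have -> : 4 ^+ N = 2 ^+ N * 2 ^+ N :> R by rewrite -exprMn -natrM.
  by rewrite mulrA; apply: ler_pM; rewrite ?exprn_ge0.
have -> : N.+1%:R * (N.+2%:R * x4 / 4 ^+ N.+1) + 2 * B * (N.+1%:R * x4 / 4 ^+ N) =
  (N.+1%:R * N.+2%:R / 4 * x4 + 2 * B * N.+1%:R * x4) / 4 ^+ N.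
  by rewrite exprS invfM; ring.
apply: (@le_trans _ _ (N.+2%:R ^+ 2 / 4 ^+ N * (1 + 2 * B) * x4)); last first.
  by rewrite ler_wpM2r ?(ltW x40)// ler_wpM2r// addr_ge0// mulr_ge0.
have -> : N.+2%:R ^+ 2 / 4 ^+ N * (1 + 2 * B) * x4 =
  (N.+2%:R ^+ 2 * x4 + 2 * B * N.+2%:R ^+ 2 * x4) / 4 ^+ N by ring.
rewrite ler_pM2r ?invr_gt0 ?exprn_gt0//; apply: lerD; rewrite ler_wpM2r ?(ltW x40)//.
  rewrite -mulrA expr2 [X in X <= _](_ : _ = N.+2%:R * (N.+1%:R / 4)); last by ring.
  rewrite ler_wpM2l// ler_pdivrMr// -natrM ler_nat; lia.
rewrite ler_wpM2l ?mulr_ge0// expr2 -natrM ler_nat; lia.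
Qed.

End ExponentialSeries.

(** * Stirling's upper bound *)

Section Stirling.
Variable R : realType.

(** For v < 1 this says log((1 + v)/(1 - v)) >= 2 v. The difference of the two sides has derivative
    v (exp v - exp(-v)) >= 0. *)
Lemma expR_pade (v : R) : 0 <= v -> (1 - v) * expR v <= (1 + v) * expR (- v).
Proof.
rewrite le_eqVlt => /predU1P[<-|v0]; first by rewrite oppr0 addr0.
pose h (x : R) := (1 + x) * expR (- x) - (1 - x) * expR x.
have dh (x : R) : is_derive x 1 h (x * expR x - x * expR (- x)).
  apply: is_derive_eq1; rewrite /GRing.scale /=; ring.
have [x] := MVT v0 (fun x _ => dh x) (continuous_subspaceT (is_derive_continuous dh)).
have h0 : h 0 = 0 by rewrite /h oppr0 expR0; ring.
rewrite in_itv /= h0 !subr0 => /andP[x0 xv] hE.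
rewrite -subr_ge0 -/(h v) hE mulr_ge0// ?(ltW v0)// subr_ge0 ler_pM2l// ler_expR.
by lra.
Qed.

(** The induction step from x to y = x + 1 needs e <= (y/x)^(x + 1/2). This is [expR_pade] at v =
    1/(2 x + 1), for which (1 + v)/(1 - v) = y/x, raised to the power 2 x + 1. *)
Lemma stirling_upper (m : nat) : (0 < m)%N ->
  m`!%:R * expR m%:R <= expR 1 * Num.sqrt m%:R * m%:R ^+ m :> R.
Proof.
elim: m => // -[|m] IH _; first by rewrite factS fact0 mul1r sqrtr1 !mulr1.
have {}IH := IH isT.
have step : expR 1 * Num.sqrt m.+1%:R * m.+1%:R ^+ m.+1 <=
    Num.sqrt m.+2%:R * m.+2%:R ^+ m.+1 :> R.
  set x : R := m.+1%:R; set y : R := m.+2%:R.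
  have x0 : 0 < x by rewrite ltr0n.
  have y0 : 0 < y by rewrite ltr0n.
  have yx : y = x + 1 by rewrite /y -natr1.
  have sx : 0 < Num.sqrt x by rewrite sqrtr_gt0.
  have sy : 0 < Num.sqrt y by rewrite sqrtr_gt0.
  rewrite -(@ler_pXn2r _ 2)// ?nnegrE ?mulr_ge0 ?exprn_ge0 ?expR_ge0 ?sqrtr_ge0 ?(ltW x0) ?(ltW y0)//.
  rewrite !exprMn !sqr_sqrtr ?(ltW x0) ?(ltW y0)// -!exprM.
  pose v := (2 * x + 1)^-1.
  have d0 : 0 < 2 * x + 1 by rewrite ltr_wpDr// mulr_gt0.
  have vx : 1 - v = 2 * x * v by rewrite /v; field; rewrite gt_eqF.
  have vy : 1 + v = 2 * y * v by rewrite /v yx; field; rewrite gt_eqF.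
  have v0 : 0 < v by rewrite invr_gt0.
  have pd : x * expR v <= y * expR (- v).
    have := expR_pade (ltW v0); rewrite vx vy.
    rewrite -[X in X <= _](_ : 2 * v * (x * expR v) = _); last by ring.
    rewrite -[X in _ <= X](_ : 2 * v * (y * expR (- v)) = _); last by ring.
    by rewrite ler_pM2l// mulr_gt0.
  have pd2 : x * expR (2 * v) <= y.
    move: pd; rewrite -(ler_pM2r (expR_gt0 v)) -!mulrA -!expRD addNr expR0 mulr1.
    by rewrite mulr2n mulrDl mul1r.
  have xn : (2 * x + 1) * (2 * v) = 2 by rewrite /v; field; rewrite gt_eqF.
  have Hn : (x * expR (2 * v)) ^+ (m.+1 * 2).+1 <= y ^+ (m.+1 * 2).+1.
    by rewrite lerXn2r ?nnegrE ?mulr_ge0 ?expR_ge0 ?(ltW x0) ?(ltW y0).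
  rewrite exprMn -expRM_natl in Hn.
  have e2 : (m.+1 * 2).+1%:R * (2 * v) = 2 by rewrite -natr1 natrM -/x mulrC (mulrC x) mulrC xn.
  rewrite e2 !exprS in Hn.
  have -> : expR 1 ^+ 2 = expR 2 :> R by rewrite -expRM_natl mulr1.
  move: Hn; rewrite !exprS => Hn; lra.
rewrite factS natrM -natr1 expRD natr1.
apply: (@le_trans _ _ (m.+2%:R * expR 1 * (expR 1 * Num.sqrt m.+1%:R * m.+1%:R ^+ m.+1))).
  rewrite [X in X <= _](_ : _ = m.+2%:R * expR 1 * (m.+1`!%:R * expR m.+1%:R)); last by ring.
  by rewrite ler_wpM2l// mulr_ge0// expR_ge0.
rewrite [in leRHS]exprS.
rewrite [X in _ <= X](_ : _ = m.+2%:R * expR 1 * (Num.sqrt m.+2%:R * m.+2%:R ^+ m.+1)); last by ring.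
by rewrite ler_wpM2l// mulr_ge0// expR_ge0.
Qed.

End Stirling.

(** * Extracting monomial coefficients *)

Section CoefficientExtraction.
Variable R : realType.
Local Notation C := R[i].

Definition qnode (J j : nat) : R := 2 * pi * j%:R / J%:R.

Lemma sum_cos_qnode J n : (0 < n < J)%N ->
  \sum_(j < J) cos (n%:R * qnode J j) = 0 :> R.
Proof.
move=> nJ; have := congr1 (@complex.Re R) (sum_uroot R nJ).
rewrite (big_morph (@complex.Re R) (@ReD R) (erefl : complex.Re (0 : C) = 0)).
move=> E; rewrite -[RHS]E; apply: eq_bigr => j _.
rewrite -exprM urootX cexp_expi /=; congr cos.
by rewrite /qnode natrM; ring.
Qed.

Lemma cos_product_rec (n : nat) (t : R) : (0 < n)%N ->
  cos (n%:R * t) * cos t = (cos (n.+1%:R * t) + cos (n.-1%:R * t)) / 2.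
Proof.
case: n => // n _; have -> : n.+2%:R * t = n.+1%:R * t + t.
  by rewrite -(natr1 n.+1) mulrDl mul1r.
have -> : n.+1.-1%:R * t = n.+1%:R * t - t.
  by rewrite -(natr1 n) mulrDl mul1r addrK.
by rewrite cosD cosB; field.
Qed.

(** Discrete orthogonality of the Chebyshev polynomial of degree n to lower powers. The product
    formula trades one power of the cosine for a shift of n by one, which preserves both conditions;
    n + l < J excludes aliasing. *)
Lemma sum_cosM_cosX_eq0 J l n : (l < n)%N -> (n + l < J)%N ->
  \sum_(j < J) cos (n%:R * qnode J j) * cos (qnode J j) ^+ l = 0 :> R.
Proof.
elim: l n => [|l IH] n ln nJ.
  under eq_bigr do rewrite expr0 mulr1.
  by apply: sum_cos_qnode; rewrite ln -(addn0 n).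
have n0 : (0 < n)%N by exact: leq_trans ln.
under eq_bigr do rewrite exprS mulrA cos_product_rec// mulrAC mulrDl mulrDl.
rewrite big_split /= -!mulr_suml !IH ?mul0r ?addr0//.
all: lia.
Qed.

Lemma sum_cosM_cosX J l : (l.*2 < J)%N ->
  \sum_(j < J) cos (l%:R * qnode J j) * cos (qnode J j) ^+ l = J%:R / 2 ^+ l :> R.
Proof.
elim: l => [|l IH] lJ.
  under eq_bigr do rewrite expr0 mulr1 mul0r cos0.
  by rewrite sumr_const card_ord divr1.
under eq_bigr do rewrite exprS mulrA cos_product_rec// mulrAC mulrDl mulrDl.
rewrite big_split /= -!mulr_suml sum_cosM_cosX_eq0 ?mul0r ?add0r; last 2 first.
- lia.
- lia.
by rewrite IH ?exprS ?invfM; [rewrite mulrA mulrAC|lia].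
Qed.

Definition qweight (J m j : nat) : R := 2 ^+ m / J%:R * cos (m%:R * qnode J j).

Lemma norm_qweight J m j : `|qweight J m j| <= 2 ^+ m / J%:R.
Proof.
have h : 0 <= 2 ^+ m / J%:R :> R by rewrite divr_ge0// exprn_ge0.
by rewrite normrM ger0_norm// ler_piMr// cos_max.
Qed.

Lemma qweight_lt J m l : (l < m)%N -> (m.*2 < J)%N ->
  \sum_(j < J) qweight J m j * cos (qnode J j) ^+ l = 0.
Proof.
move=> lm mJ; under eq_bigr do rewrite -mulrA.
by rewrite -mulr_sumr sum_cosM_cosX_eq0 ?mulr0//; lia.
Qed.

Lemma qweight_eq J m : (m.*2 < J)%N ->
  \sum_(j < J) qweight J m j * cos (qnode J j) ^+ m = 1.
Proof.
move=> mJ; under eq_bigr do rewrite -mulrA.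
rewrite -mulr_sumr sum_cosM_cosX// mulrA mulfVK ?divff ?expf_neq0 ?pnatr_eq0//.
by rewrite -lt0n; lia.
Qed.

(** The quadrature kills only degrees below [al i], not those above. Fixing the total degree is
    enough: each factor has valuation at least [al i], so only the lowest terms can reach the
    sum. *)
Lemma coef_prod_low (d : nat) (B : 'I_d -> {poly R}) (al : 'I_d -> nat) :
  (forall i m, (m < al i)%N -> (B i)`_m = 0) ->
  (\prod_(i < d) B i)`_(\sum_(i < d) al i) = \prod_(i < d) (B i)`_(al i).
Proof.
move=> low.
have E i : B i = 'X^(al i) * drop_poly (al i) (B i).
  have T : take_poly (al i) (B i) = 0.
    by apply/polyP => m; rewrite coef_take_poly coef0; case: ifP => // /low.
  by rewrite -{1}(poly_take_drop (al i) (B i)) T add0r mulrC.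
rewrite (eq_bigr _ (fun i _ => E i)) big_split /= prodrXr coefXnM ltnn subnn.
rewrite -horner_coef0 horner_prod; apply: eq_bigr => i _.
by rewrite horner_coef0 coef_drop_poly add0n.
Qed.

Lemma hq_extract (d : nat) (a b rho : 'I_d -> R) (al : 'I_d -> nat)
    (k := (\sum_(i < d) al i)%N) (J := k.*2.+1) :
  \prod_(i < d) (hq (a i) (b i) (al i) * rho i ^+ al i) =
  \sum_(phi : {ffun 'I_d -> 'I_J}) (\prod_(i < d) qweight J (al i) (phi i)) *
    hq (\sum_(i < d) rho i * cos (qnode J (phi i)) * a i)
       (\sum_(i < d) (rho i * cos (qnode J (phi i))) ^+ 2 * b i) k.
Proof.
pose p (i : 'I_d) (j : 'I_J) : {poly R} :=
  \poly_(m < k.+1) hq (rho i * cos (qnode J j) * a i)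
    ((rho i * cos (qnode J j)) ^+ 2 * b i) m.
pose B (i : 'I_d) : {poly R} := \sum_(j < J) qweight J (al i) j *: p i j.
have alk i : (al i <= k)%N by rewrite /k (bigD1 i)//= leq_addr.
have BE i m : (m <= al i)%N -> (B i)`_m = hq (a i) (b i) m * rho i ^+ m *
    \sum_(j < J) qweight J (al i) j * cos (qnode J j) ^+ m.
  move=> mi; rewrite coef_sum mulr_sumr; apply: eq_bigr => j _.
  rewrite coefZ coef_poly ltnS (leq_trans mi (alk i)) hq_scale exprMn.
  by ring.
(* The same coefficient is computed twice: by valuations, and by expanding the product over all
   choices of one node per coordinate. *)
transitivity ((\prod_(i < d) B i)`_k).
  rewrite coef_prod_low => [|i m mi].
    apply: eq_bigr => i _; rewrite BE// qweight_eq ?mulr1//.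
    by rewrite /J ltnS leq_double.
  by rewrite BE ?(ltnW mi)// qweight_lt ?mulr0// /J ltnS leq_double.
rewrite /B (bigA_distr_bigA (fun (i : 'I_d) (j : 'I_J) => qweight J (al i) j *: p i j)) coef_sum.
apply: eq_bigr => phi _.
rewrite scaler_prod coefZ; congr (_ * _).
by rewrite (hq_sum _ _ _ (ltnSn k)).
Qed.

End CoefficientExtraction.

(** * Iterated integrals of functions with Gaussian decay *)

Section GaussianClass1.
Variable R : realType.
Local Notation leb := (@lebesgue_measure R).
Local Open Scope classical_set_scope.

Definition gauss_mass (c : R) : R := Num.sqrt (pi / c).

Lemma gauss_normal (c m : R) : 0 < c ->
  (fun t => expR (- (c * (t - m) ^+ 2))) =
  (fun t => gauss_mass c * normal_pdf m (Num.sqrt (2 * c))^-1 t).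
Proof.
move=> c0; have c2 : 0 < 2 * c by rewrite mulr_gt0.
have s0 : (Num.sqrt (2 * c))^-1 != 0 by rewrite invr_eq0 gt_eqF// sqrtr_gt0.
apply/funext => t; rewrite normal_pdfE// /normal_peak /normal_fun exprVn sqr_sqrtr ?ltW//.
have -> : (2 * c)^-1 * pi *+ 2 = pi / c.
  by rewrite -[LHS]mulr_natr; move: (pi : R) => p; field; rewrite gt_eqF.
rewrite /gauss_mass mulVKf; last by rewrite gt_eqF// sqrtr_gt0 divr_gt0// pi_gt0.
congr expR; rewrite -mulr_natr; field; by rewrite gt_eqF.
Qed.

Lemma integrable_gauss (c m : R) : 0 < c ->
  leb.-integrable setT (EFin \o (fun t => expR (- (c * (t - m) ^+ 2)))).
Proof.
move=> c0; rewrite gauss_normal//.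
rewrite (_ : _ \o _ = (fun t => (gauss_mass c)%:E *
   (normal_pdf m (Num.sqrt (2 * c))^-1 t)%:E)%E); last exact/funext.
apply: integrableZl => //; apply: integrable_normal_pdf.
Qed.

Lemma Rintegral_gauss (c m : R) : 0 < c ->
  Rintegral leb setT (fun t => expR (- (c * (t - m) ^+ 2))) = gauss_mass c.
Proof.
move=> c0; rewrite gauss_normal// RintegralZl//; last exact: integrable_normal_pdf.
by rewrite /Rintegral integral_normal_pdf /= mulr1.
Qed.

Lemma gauss_mass_ge0 c : 0 <= gauss_mass c.
Proof. exact: sqrtr_ge0. Qed.

Lemma gdom_integrable (h : R -> R) (C c : R) : 0 < c -> measurable_fun setT h ->
  (forall s, `|h s| <= C * expR (- (c * s ^+ 2))) ->
  leb.-integrable setT (EFin \o h).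
Proof.
move=> c0 mh hb.
have ig : leb.-integrable setT (EFin \o (fun t => C * expR (- (c * t ^+ 2)))).
  have := integrable_gauss 0 c0 => /(integrableZl measurableT C).
  by apply: eq_integrable => // t _ /=; rewrite subr0.
apply: le_integrable ig => //; first exact/measurable_EFinP.
move=> s _ /=; rewrite lee_fin; apply: le_trans (hb s) _; exact: ler_norm.
Qed.

Lemma gdom_Rintegral_le (h : R -> R) (C c : R) : 0 < c -> measurable_fun setT h ->
  (forall s, `|h s| <= C * expR (- (c * s ^+ 2))) ->
  `|Rintegral leb setT h| <= C * gauss_mass c.
Proof.
move=> c0 mh hb; have ih := gdom_integrable c0 mh hb.
apply: le_trans (le_normr_Rintegral _ ih) _ => //.
have := Rintegral_gauss 0 c0; under [X in Rintegral _ _ X]eq_fun do rewrite subr0.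
move=> <-.
have ig : leb.-integrable setT (EFin \o (fun t => expR (- (c * t ^+ 2)))).
  by have := integrable_gauss 0 c0; apply: eq_integrable => // t _ /=; rewrite subr0.
rewrite -RintegralZl//; apply: le_Rintegral => //.
- by have := integrable_norm ih; apply: eq_integrable.
- by have := integrableZl measurableT C ig; apply: eq_integrable.
Qed.

Lemma measurable_Rintegral d (T : measurableType d) (H : T * R -> R) :
  measurable_fun setT H ->
  (forall t, leb.-integrable setT (EFin \o (fun s => H (t, s)))) ->
  measurable_fun setT (fun t => Rintegral leb setT (fun s => H (t, s))).
Proof.
move=> mH iH; apply/measurable_EFinP.
have mE : measurable_fun setT (EFin \o H) by exact/measurable_EFinP.
rewrite (_ : _ \o _ = (fun t => (\int[leb]_s (EFin \o H)^\+ (t, s) -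
   \int[leb]_s (EFin \o H)^\- (t, s))%E)).
  apply: emeasurable_funB.
  - by apply: measurable_fun_fubini_tonelli_F => //; exact: measurable_funepos.
  - by apply: measurable_fun_fubini_tonelli_F => //; exact: measurable_funeneg.
apply/funext => t /=; rewrite /Rintegral fineK; last exact: (integrable_fin_num measurableT (iH t)).
rewrite [LHS]integralE; congr (_ - _)%E; apply: eq_integral => s _.
  by rewrite !funeposE.
by rewrite !funenegE.
Qed.

Lemma fubini_Rintegral (H : R * R -> R) (C c : R) : 0 < c ->
  measurable_fun setT H ->
  (forall p, `|H p| <= C * expR (- (c * p.1 ^+ 2)) * expR (- (c * p.2 ^+ 2))) ->
  Rintegral leb setT (fun t => Rintegral leb setT (fun s => H (t, s))) =
  Rintegral leb setT (fun s => Rintegral leb setT (fun t => H (t, s))).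
Proof.
move=> c0 mH Hb.
have i1 t : leb.-integrable setT (EFin \o (fun s => H (t, s))).
  apply: (gdom_integrable (C := C * expR (- (c * t ^+ 2))) c0
    (measurableT_comp mH (pair1_measurable t))) => s.
  exact: (Hb (t, s)).
have i2 s : leb.-integrable setT (EFin \o (fun t => H (t, s))).
  apply: (gdom_integrable (C := C * expR (- (c * s ^+ 2))) c0
    (measurableT_comp mH (pair2_measurable s))) => t.
  by have := Hb (t, s); rewrite mulrAC.
have mE : measurable_fun setT (EFin \o H) by exact/measurable_EFinP.
have iH : (leb \x leb)%E.-integrable setT (EFin \o H).
  apply/integrable12ltyP => //.
  apply: (@le_lt_trans _ _ (\int[leb]_t (C * gauss_mass c * expR (- (c * t ^+ 2)))%:E)%E).
    apply: ge0_le_integral => //.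
    - by move=> t _; exact: integral_ge0.
    - have mA : measurable_fun setT (abse \o (EFin \o H)) by exact: measurableT_comp.
      exact: (@measurable_fun_fubini_tonelli_F _ _ _ _ _ leb _ mA (fun x => abse_ge0 _)).
    - apply/measurable_EFinP; apply: measurable_funM => //.
      apply: measurableT_comp => //; apply: measurableT_comp => //.
      by apply: measurable_funM => //.
    - move=> t _.
      have -> : (\int[leb]_s `|(EFin \o H) (t, s)| = (Rintegral leb setT (fun s => `|H (t, s)|))%:E)%E.
        rewrite /Rintegral fineK//.
        have := integrable_norm (i1 t) => /integrable_fin_num; exact.
      rewrite lee_fin; apply: le_trans (ler_norm _) _.
      rewrite mulrAC; apply: gdom_Rintegral_le => //.
        by apply: measurableT_comp => //; exact: measurableT_comp.
      by move=> s; rewrite normr_id; exact: (Hb (t, s)).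
  have ig : leb.-integrable setT (EFin \o (fun t => C * gauss_mass c * expR (- (c * t ^+ 2)))).
    have := integrable_gauss 0 c0 => /(integrableZl measurableT (C * gauss_mass c)).
    by apply: eq_integrable => // t _ /=; rewrite subr0.
  by have := integrable_fin_num measurableT ig; rewrite fin_numE ltey => /andP[].
rewrite /Rintegral; congr fine.
transitivity (\int[leb]_t \int[leb]_s (EFin \o H) (t, s))%E.
  by apply: eq_integral => t _; rewrite fineK//; exact: (integrable_fin_num measurableT (i1 t)).
rewrite (Fubini iH); apply: eq_integral => s _.
by rewrite fineK//; exact: (integrable_fin_num measurableT (i2 s)).
Qed.

End GaussianClass1.

(** * Linearity, monotonicity and exchange for iterated integrals *)

Section TupleIntegrals.
Variable R : realType.
Local Notation C := R[i].
Local Notation leb := (@lebesgue_measure R).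
Local Open Scope classical_set_scope.

Lemma tnth_cons0 n (t : R) (x : n.-tuple R) : tnth (cons_tuple t x) ord0 = t.
Proof. by []. Qed.

Lemma tnth_consS n (t : R) (x : n.-tuple R) i :
  tnth (cons_tuple t x) (lift ord0 i) = tnth x i.
Proof. exact: tnthS. Qed.

Lemma sqnorm_cons n (t : R) (x : n.-tuple R) :
  sqnorm (cons_tuple t x) = t ^+ 2 + sqnorm x.
Proof.
rewrite /sqnorm big_ord_recl; congr (_ + _).
by apply: eq_bigr => i _; rewrite tnth_consS.
Qed.

Lemma sqnorm0 (x : 0.-tuple R) : sqnorm x = 0.
Proof. by rewrite /sqnorm big_ord0. Qed.

Lemma sqnorm_ge0 n (x : n.-tuple R) : 0 <= sqnorm x.
Proof. by apply: sumr_ge0 => i _; exact: sqr_ge0. Qed.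

Lemma measurable_cons_tuple d (T : measurableType d) n (f : T -> R) (g : T -> n.-tuple R) :
  measurable_fun setT f -> measurable_fun setT g ->
  measurable_fun setT (fun x => cons_tuple (f x) (g x)).
Proof. exact: measurable_cons. Qed.

(** The parameter space is arbitrary so that the induction can move the first coordinate of the
    tuple into it. *)
Lemma iint_param n : forall d (T : measurableType d) (F : T * n.-tuple R -> R)
    (g : T -> R) (c : R), 0 < c -> measurable_fun setT F ->
  (forall p, `|F p| <= g p.1 * expR (- (c * sqnorm p.2))) ->
  measurable_fun setT (fun t => iint (fun x => F (t, x))) /\
  (forall t, `|iint (fun x => F (t, x))| <= g t * gauss_mass c ^+ n).
Proof.
elim: n => [|n IH] d T F g c c0 mF Fb.
  split; first by apply: measurableT_comp => //; exact: pair2_measurable.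
  by move=> t; have := Fb (t, [tuple]); rewrite /= sqnorm0 mulr0 oppr0 expR0 expr0.
pose H (p : T * R) := iint (fun x => F (p.1, cons_tuple p.2 x)).
have mF' : measurable_fun setT
    (fun q : (T * R) * n.-tuple R => F (q.1.1, cons_tuple q.1.2 q.2)).
  apply: measurableT_comp => //; apply: measurable_fun_pair.
    exact: measurableT_comp.
  by apply: measurable_cons_tuple => //; exact: measurableT_comp.
have Fb' (q : (T * R) * n.-tuple R) : `|F (q.1.1, cons_tuple q.1.2 q.2)| <=
    g q.1.1 * expR (- (c * q.1.2 ^+ 2)) * expR (- (c * sqnorm q.2)).
  by have := Fb (q.1.1, cons_tuple q.1.2 q.2);
     rewrite sqnorm_cons mulrDr opprD expRD mulrA.
have [mH Hb] := IH _ (T * R)%type _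
  (fun p => g p.1 * expR (- (c * p.2 ^+ 2))) c c0 mF' Fb'.
have Hb' t s : `|H (t, s)| <= (g t * gauss_mass c ^+ n) * expR (- (c * s ^+ 2)).
  by have := Hb (t, s); rewrite /= mulrAC.
have mHt t : measurable_fun setT (fun s => H (t, s)).
  by apply: measurableT_comp; [exact: mH|exact: pair1_measurable].
split.
  apply: (measurable_Rintegral (H := H)) => // t.
  exact: (gdom_integrable c0 (mHt t) (Hb' t)).
move=> t; rewrite exprSr mulrA.
exact: (gdom_Rintegral_le c0 (mHt t) (Hb' t)).
Qed.

(** Gaussian domination replaces integrability because it passes to every slice, whereas Fubini
    gives integrable slices only almost everywhere. *)
Definition rgd n (F : n.-tuple R -> R) := measurable_fun setT F /\
  exists K c, 0 < c /\ forall x, `|F x| <= K * expR (- (c * sqnorm x)).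

Lemma rgd_slice n (F : n.+1.-tuple R -> R) (t : R) :
  rgd F -> rgd (fun x => F (cons_tuple t x)).
Proof.
move=> [mF [K [c [c0 Fb]]]]; split.
  by apply: measurableT_comp => //; exact: measurable_cons_tuple.
exists (K * expR (- (c * t ^+ 2))), c; split => // x.
by have := Fb (cons_tuple t x); rewrite sqnorm_cons mulrDr opprD expRD mulrA.
Qed.

Lemma rgd_iint_slice n (F : n.+1.-tuple R -> R) : rgd F ->
  leb.-integrable setT (EFin \o (fun t => iint (fun x => F (cons_tuple t x)))).
Proof.
move=> [mF [K [c [c0 Fb]]]].
have mF' : measurable_fun setT (fun p : R * n.-tuple R => F (cons_tuple p.1 p.2)).
  by apply: measurableT_comp => //; exact: measurable_cons_tuple.
have Fb' (p : R * n.-tuple R) : `|F (cons_tuple p.1 p.2)| <=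
    K * expR (- (c * p.1 ^+ 2)) * expR (- (c * sqnorm p.2)).
  by have := Fb (cons_tuple p.1 p.2); rewrite sqnorm_cons mulrDr opprD expRD mulrA.
have [mH Hb] := iint_param (g := fun t : R => K * expR (- (c * t ^+ 2))) c0 mF' Fb'.
apply: (gdom_integrable (C := K * gauss_mass c ^+ n) c0 mH) => t.
by have := Hb t; rewrite /= mulrAC.
Qed.

Lemma gauss_weaken n (K c e : R) (x : n.-tuple R) : e <= c ->
  K * expR (- (c * sqnorm x)) <= `|K| * expR (- (e * sqnorm x)).
Proof.
move=> ec; apply: le_trans (ler_wpM2r (expR_ge0 _) (ler_norm K)) _.
by rewrite ler_wpM2l// ler_expR lerN2 ler_wpM2r// sqnorm_ge0.
Qed.

Lemma rgdZ n (k : R) (F : n.-tuple R -> R) : rgd F -> rgd (fun x => k * F x).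
Proof.
move=> [mF [K [c [c0 Fb]]]]; split; first exact: measurable_funM.
exists (`|k| * K), c; split=> // x.
by rewrite normrM -mulrA ler_wpM2l.
Qed.

Lemma iintD n (F G : n.-tuple R -> R) : rgd F -> rgd G ->
  iint (fun x => F x + G x) = iint F + iint G.
Proof.
elim: n F G => [//|n IH] F G rF rG /=.
rewrite -RintegralD//; last 2 first.
- exact: rgd_iint_slice.
- exact: rgd_iint_slice.
by apply: eq_Rintegral => t _; rewrite IH//; exact: rgd_slice.
Qed.

Lemma iintZ n (k : R) (F : n.-tuple R -> R) : rgd F ->
  iint (fun x => k * F x) = k * iint F.
Proof.
elim: n F => [//|n IH] F rF /=.
rewrite -RintegralZl//; last exact: rgd_iint_slice.
by apply: eq_Rintegral => t _; rewrite IH//; exact: rgd_slice.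
Qed.

Lemma ler_iint n (F G : n.-tuple R -> R) : rgd F -> rgd G ->
  (forall x, F x <= G x) -> iint F <= iint G.
Proof.
elim: n F G => [|n IH] F G rF rG FG /=; first exact: FG.
apply: le_Rintegral => //; [exact: rgd_iint_slice|exact: rgd_iint_slice|].
by move=> t _; apply: IH => //; exact: rgd_slice.
Qed.

Lemma eq_iint n (F G : n.-tuple R -> R) : (forall x, F x = G x) -> iint F = iint G.
Proof. by move=> /funext ->. Qed.

Lemma iint_swap1 m (F : R * m.-tuple R -> R) (K c : R) : 0 < c ->
  measurable_fun setT F ->
  (forall p, `|F p| <= K * expR (- (c * p.1 ^+ 2)) * expR (- (c * sqnorm p.2))) ->
  Rintegral leb setT (fun t => iint (fun y => F (t, y))) =
  iint (fun y => Rintegral leb setT (fun t => F (t, y))).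
Proof.
elim: m F K => [//|m IH] F K c0 mF Fb /=.
have mF' : measurable_fun setT
    (fun q : (R * R) * m.-tuple R => F (q.1.1, cons_tuple q.1.2 q.2)).
  apply: measurableT_comp => //; apply: measurable_fun_pair.
    exact: measurableT_comp.
  by apply: measurable_cons_tuple => //; exact: measurableT_comp.
have Fb' (q : (R * R) * m.-tuple R) : `|F (q.1.1, cons_tuple q.1.2 q.2)| <=
    K * expR (- (c * q.1.1 ^+ 2)) * expR (- (c * q.1.2 ^+ 2)) *
    expR (- (c * sqnorm q.2)).
  by have := Fb (q.1.1, cons_tuple q.1.2 q.2);
     rewrite /= sqnorm_cons mulrDr opprD expRD mulrA.
have [mH Hb] := iint_param (g := fun p : R * R => K * expR (- (c * p.1 ^+ 2)) *
   expR (- (c * p.2 ^+ 2))) c0 mF' Fb'.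
rewrite (fubini_Rintegral (C := K * gauss_mass c ^+ m)
  (H := fun p : R * R => iint (fun x => F (p.1, cons_tuple p.2 x))) c0 mH) /=.
  apply: eq_Rintegral => s _.
  apply: (IH (fun p => F (p.1, cons_tuple s p.2)) (K * expR (- (c * s ^+ 2)))) => //.
    apply: measurableT_comp => //; apply: measurable_fun_pair => //.
    exact: measurable_cons_tuple.
  by move=> p; have := Fb' ((p.1, s), p.2); rewrite /= [X in _ <= X * _]mulrAC.
by move=> p; apply: le_trans (Hb p) _; rewrite le_eqVlt; apply/orP; left; apply/eqP; ring.
Qed.

Lemma iint_swap n m (F : n.-tuple R * m.-tuple R -> R) (K c : R) : 0 < c ->
  measurable_fun setT F ->
  (forall p, `|F p| <= K * expR (- (c * sqnorm p.1)) * expR (- (c * sqnorm p.2))) ->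
  iint (fun x => iint (fun y => F (x, y))) =
  iint (fun y => iint (fun x => F (x, y))).
Proof.
elim: n F K => [//|n IH] F K c0 mF Fb /=.
have Fb' t x y : `|F (cons_tuple t x, y)| <= K * expR (- (c * t ^+ 2)) *
   expR (- (c * sqnorm x)) * expR (- (c * sqnorm y)).
  by have := Fb (cons_tuple t x, y); rewrite /= sqnorm_cons mulrDr opprD expRD mulrA.
transitivity (Rintegral leb setT (fun t =>
    iint (fun y => iint (fun x => F (cons_tuple t x, y))))).
  apply: eq_Rintegral => t _.
  apply: (IH (fun p => F (cons_tuple t p.1, p.2)) (K * expR (- (c * t ^+ 2)))) => //.
    apply: measurableT_comp => //; apply: measurable_fun_pair => //.
    exact: measurable_cons_tuple.
have mF' : measurable_fun setT
    (fun q : (R * m.-tuple R) * n.-tuple R => F (cons_tuple q.1.1 q.2, q.1.2)).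
  apply: measurableT_comp => //; apply: measurable_fun_pair.
    by apply: measurable_cons_tuple => //; exact: measurableT_comp.
  exact: measurableT_comp.
have Fb2 (q : (R * m.-tuple R) * n.-tuple R) : `|F (cons_tuple q.1.1 q.2, q.1.2)| <=
    K * expR (- (c * q.1.1 ^+ 2)) * expR (- (c * sqnorm q.1.2)) *
    expR (- (c * sqnorm q.2)).
  by have := Fb' q.1.1 q.2 q.1.2; rewrite mulrAC.
have [mH Hb] := iint_param (g := fun p : R * m.-tuple R => K * expR (- (c * p.1 ^+ 2)) *
   expR (- (c * sqnorm p.2))) c0 mF' Fb2.
rewrite (iint_swap1 (K := K * gauss_mass c ^+ n) c0 mH)//.
by move=> p; apply: le_trans (Hb p) _; rewrite le_eqVlt; apply/orP; left; apply/eqP; ring.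
Qed.

End TupleIntegrals.

Section ComplexTupleIntegrals.
Variable R : realType.
Local Notation C := R[i].
Local Notation leb := (@lebesgue_measure R).
Local Open Scope classical_set_scope.

Definition cmeas d (T : measurableType d) (F : T -> C) :=
  measurable_fun setT (fun x => complex.Re (F x)) /\
  measurable_fun setT (fun x => complex.Im (F x)).

Section Measurability.
Context d (T : measurableType d).
Implicit Types F G : T -> C.

Lemma cmeas_cst (z : C) : cmeas (fun _ : T => z).
Proof. by split; exact: measurable_cst. Qed.

Lemma cmeas_real (f : T -> R) : measurable_fun setT f -> cmeas (fun x => Complex (f x) 0 : C).
Proof. by move=> mf; split=> //; exact: measurable_cst. Qed.

Lemma cmeasD F G : cmeas F -> cmeas G -> cmeas (fun x => F x + G x).
Proof.
move=> [F1 F2] [G1 G2]; split.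
  by under eq_fun do rewrite ReD; exact: measurable_funD.
by under eq_fun do rewrite ImD; exact: measurable_funD.
Qed.

Lemma cmeasM F G : cmeas F -> cmeas G -> cmeas (fun x => F x * G x).
Proof.
move=> [F1 F2] [G1 G2]; split.
  by under eq_fun do rewrite ReM; apply: measurable_funB; exact: measurable_funM.
by under eq_fun do rewrite ImM; apply: measurable_funD; exact: measurable_funM.
Qed.

Lemma cmeas_cexp F : cmeas F -> cmeas (fun x => cexp (F x)).
Proof.
move=> [F1 F2]; split; apply: measurable_funM.
- by apply: measurableT_comp F1.
- by apply: measurableT_comp F2; apply: continuous_measurable_fun; exact: continuous_cos.
- by apply: measurableT_comp F1.
- by apply: measurableT_comp F2; apply: continuous_measurable_fun; exact: continuous_sin.
Qed.

Lemma cmeas_sum (I : Type) (r : seq I) (F : I -> T -> C) :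
  (forall i, cmeas (F i)) -> cmeas (fun x => \sum_(i <- r) F i x).
Proof.
move=> mF; elim: r => [|i r IH].
  by under eq_fun do rewrite big_nil; exact: cmeas_cst.
by under eq_fun do rewrite big_cons; exact: cmeasD.
Qed.

Lemma cmeas_prod (I : Type) (r : seq I) (F : I -> T -> C) :
  (forall i, cmeas (F i)) -> cmeas (fun x => \prod_(i <- r) F i x).
Proof.
move=> mF; elim: r => [|i r IH].
  by under eq_fun do rewrite big_nil; exact: cmeas_cst.
by under eq_fun do rewrite big_cons; exact: cmeasM.
Qed.

Lemma cmeas_comp d' (T' : measurableType d') (g : T' -> T) F :
  measurable_fun setT g -> cmeas F -> cmeas (fun x => F (g x)).
Proof. 
by move=> mg [F1 F2]; split; [exact: (measurableT_comp F1 mg)|exact: (measurableT_comp F2 mg)].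
Qed.

End Measurability.

Lemma measurable_sqnorm n : measurable_fun setT (@sqnorm R n).
Proof.
apply: measurable_sum => i.
exact: (measurable_funX 2 (measurable_tnth i)).
Qed.

Definition cgd n (F : n.-tuple R -> C) := cmeas F /\
  exists K c, 0 < c /\ forall x, cmod (F x) <= K * expR (- (c * sqnorm x)).

Lemma cgd_Re n (F : n.-tuple R -> C) : cgd F -> rgd (fun x => complex.Re (F x)).
Proof.
move=> [[F1 F2] [K [c [c0 Fb]]]]; split=> //; exists K, c; split=> // x.
exact: le_trans (ler_Re_cmod _) (Fb x).
Qed.

Lemma cgd_Im n (F : n.-tuple R -> C) : cgd F -> rgd (fun x => complex.Im (F x)).
Proof.
move=> [[F1 F2] [K [c [c0 Fb]]]]; split=> //; exists K, c; split=> // x.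
exact: le_trans (ler_Im_cmod _) (Fb x).
Qed.

Lemma cgdD n (F G : n.-tuple R -> C) : cgd F -> cgd G -> cgd (fun x => F x + G x).
Proof.
move=> [mF [K [c [c0 Fb]]]] [mG [L [e [e0 Gb]]]]; split; first exact: cmeasD.
exists (`|K| + `|L|), (Num.min c e); split; first by rewrite lt_min c0.
move=> x; apply: le_trans (ler_cmodD _ _) _; rewrite mulrDl; apply: lerD.
  by apply: le_trans (Fb x) (gauss_weaken _ _ _); rewrite ge_min lexx.
by apply: le_trans (Gb x) (gauss_weaken _ _ _); rewrite ge_min lexx orbT.
Qed.

Lemma cgdZ n (k : C) (F : n.-tuple R -> C) : cgd F -> cgd (fun x => k * F x).
Proof.
move=> [mF [K [c [c0 Fb]]]]; split; first by apply: cmeasM => //; exact: cmeas_cst.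
exists (cmod k * K), c; split=> // x.
by rewrite cmodM -mulrA ler_wpM2l ?cmod_ge0.
Qed.

Lemma cgd0 n : cgd (fun _ : n.-tuple R => 0 : C).
Proof.
split; first exact: cmeas_cst.
by exists 0, 1; split=> // x; rewrite cmod0 mul0r.
Qed.

Lemma eq_cint n (F G : n.-tuple R -> C) : (forall x, F x = G x) -> cint F = cint G.
Proof. by move=> /funext ->. Qed.

Lemma cintD n (F G : n.-tuple R -> C) : cgd F -> cgd G ->
  cint (fun x => F x + G x) = cint F + cint G.
Proof.
move=> gF gG; apply: complexP; rewrite ?ReD ?ImD /=.
  rewrite -iintD; [|exact: cgd_Re..].
  by apply: eq_iint => x; rewrite ReD.
rewrite -iintD; [|exact: cgd_Im..].
by apply: eq_iint => x; rewrite ImD.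
Qed.

Lemma cintZ n (k : C) (F : n.-tuple R -> C) : cgd F ->
  cint (fun x => k * F x) = k * cint F.
Proof.
move=> gF; have rR := cgd_Re gF; have rI := cgd_Im gF.
apply: complexP; rewrite ?ReM ?ImM /=.
  rewrite -iintZ// -[in RHS]mulNr -iintZ// -iintD; [|exact: rgdZ..].
  by apply: eq_iint => x; rewrite ReM mulNr.
rewrite -iintZ// -iintZ// -iintD; [|exact: rgdZ..].
by apply: eq_iint => x; rewrite ImM.
Qed.

Lemma cint0 n : cint (fun _ : n.-tuple R => 0 : C) = 0.
Proof.
have E := cintZ 0 (cgd0 n); rewrite [RHS]mul0r in E; rewrite -[RHS]E.
by apply: eq_cint => x; rewrite mul0r.
Qed.

Lemma cgd_sum n (I : Type) (r : seq I) (F : I -> n.-tuple R -> C) :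
  (forall i, cgd (F i)) -> cgd (fun x => \sum_(i <- r) F i x).
Proof.
move=> gF; elim: r => [|i r IH].
  by under eq_fun do rewrite big_nil; exact: cgd0.
by under eq_fun do rewrite big_cons; exact: cgdD.
Qed.

Lemma cint_sum n (I : Type) (r : seq I) (F : I -> n.-tuple R -> C) :
  (forall i, cgd (F i)) ->
  cint (fun x => \sum_(i <- r) F i x) = \sum_(i <- r) cint (F i).
Proof.
move=> gF; elim: r => [|i r IH].
  by under eq_fun do rewrite big_nil; rewrite big_nil cint0.
under eq_fun do rewrite big_cons.
by rewrite big_cons -IH -cintD//; exact: cgd_sum.
Qed.

Lemma ler_cmod_cint n (F : n.-tuple R -> C) (g : n.-tuple R -> R) :
  cgd F -> rgd g -> (forall x, cmod (F x) <= g x) -> cmod (cint F) <= iint g.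
Proof.
move=> gF gg Fg; have [c c1 cE] := cmod_rot (cint F).
have -> : cmod (cint F) = iint (fun x => complex.Re (c * F x)).
  by have := congr1 (@complex.Re R) cE; rewrite -cintZ//= => ->.
apply: ler_iint => // [|x]; first by apply: cgd_Re; exact: cgdZ.
apply: le_trans (ler_norm _) _; apply: le_trans (ler_Re_cmod _) _.
rewrite cmodM; apply: le_trans (Fg x).
by rewrite ler_piMl// cmod_ge0.
Qed.

Lemma cint_swap n m (F : n.-tuple R -> m.-tuple R -> C) (K c : R) : 0 < c ->
  cmeas (fun p : n.-tuple R * m.-tuple R => F p.1 p.2) ->
  (forall x y, cmod (F x y) <= K * expR (- (c * sqnorm x)) * expR (- (c * sqnorm y))) ->
  cint (fun x => cint (fun y => F x y)) = cint (fun y => cint (fun x => F x y)).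
Proof.
move=> c0 [mR mI] Fb; apply: complexP => /=.
  apply: (iint_swap (F := fun p => complex.Re (F p.1 p.2)) c0 mR) => p.
  exact: le_trans (ler_Re_cmod _) (Fb _ _).
apply: (iint_swap (F := fun p => complex.Im (F p.1 p.2)) c0 mI) => p.
exact: le_trans (ler_Im_cmod _) (Fb _ _).
Qed.

Lemma cmeas_cint n d (T : measurableType d) (F : T * n.-tuple R -> C)
    (g : T -> R) (c : R) : 0 < c -> cmeas F ->
  (forall p, cmod (F p) <= g p.1 * expR (- (c * sqnorm p.2))) ->
  cmeas (fun t => cint (fun x => F (t, x))).
Proof.
move=> c0 [mR mI] Fb; split => /=.
  have [] // := iint_param (g := g) c0 mR _.
  by move=> p; exact: le_trans (ler_Re_cmod _) (Fb _).
have [] // := iint_param (g := g) c0 mI _.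
by move=> p; exact: le_trans (ler_Im_cmod _) (Fb _).
Qed.

(** Going through 1-tuples makes [cint_cons] hold by computation and the lemmas on [cint] apply in
    one variable. *)
Definition cint1 (phi : R -> C) : C := cint (fun x : 1.-tuple R => phi (tnth x ord0)).

Lemma cint_cons n (F : n.+1.-tuple R -> C) :
  cint F = cint1 (fun t => cint (fun x => F (cons_tuple t x))).
Proof. by []. Qed.

Lemma sqnorm1 (x : 1.-tuple R) : sqnorm x = tnth x ord0 ^+ 2.
Proof. by rewrite /sqnorm big_ord_recl big_ord0 addr0. Qed.

Lemma cgd_prod n (phi : 'I_n -> R -> C) (K : 'I_n -> R) (c : R) : 0 < c ->
  (forall i, cmeas (phi i)) ->
  (forall i t, cmod (phi i t) <= K i * expR (- (c * t ^+ 2))) ->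
  cgd (fun x : n.-tuple R => \prod_(i < n) phi i (tnth x i)).
Proof.
move=> c0 mphi phib; split.
  apply: cmeas_prod => i; apply: (cmeas_comp _ (mphi i)); exact: measurable_tnth.
exists (\prod_(i < n) K i), c; split=> // x.
rewrite (big_morph _ (@cmodM R) (cmod1 R)) /sqnorm mulr_sumr -sumrN expR_sum -big_split /=.
apply: ler_prod => i _; by rewrite cmod_ge0 phib.
Qed.

Lemma cint_prod n (phi : 'I_n -> R -> C) (K : 'I_n -> R) (c : R) : 0 < c ->
  (forall i, cmeas (phi i)) ->
  (forall i t, cmod (phi i t) <= K i * expR (- (c * t ^+ 2))) ->
  cint (fun x => \prod_(i < n) phi i (tnth x i)) = \prod_(i < n) cint1 (phi i).
Proof.
move=> c0; elim: n phi K => [|n IH] phi K mphi phib.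
  by rewrite big_ord0; apply: complexP; rewrite /= big_ord0.
rewrite cint_cons big_ord_recl.
have gt : cgd (fun x : n.-tuple R => \prod_(i < n) phi (lift ord0 i) (tnth x i)).
  exact: (cgd_prod c0 (fun i => mphi (lift ord0 i)) (fun i => phib (lift ord0 i))).
transitivity (cint1 (fun t => (\prod_(i < n) cint1 (phi (lift ord0 i))) * phi ord0 t)).
  apply: eq_cint => y; rewrite mulrC -(IH _ (fun i => K (lift ord0 i)))// -cintZ//.
  apply: eq_cint => x; rewrite big_ord_recl; congr (_ * _).
  by apply: eq_bigr => i _; rewrite tnth_consS.
rewrite /cint1 cintZ 1?mulrC//; split.
  by apply: (cmeas_comp _ (mphi ord0)); exact: measurable_tnth.
by exists (K ord0), c; split=> // x; rewrite sqnorm1.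
Qed.

End ComplexTupleIntegrals.

(** * Exponential kernels and complex Gaussian integrals *)

Section ExponentialKernels.
Variable R : realType.
Local Notation C := R[i].
Local Open Scope classical_set_scope.

(** Completing the square: half of the Gaussian absorbs the linear exponential. Here q plays the
    squared norm of y and a a linear form in y. *)
Lemma exp_lin_gauss (s c A a q : R) : 0 < c -> 0 < A -> a ^+ 2 <= A * q ->
  expR (s * `|a|) * expR (- (c * q)) <=
  expR (s ^+ 2 * A / (2 * c)) * expR (- (c / 2 * q)).
Proof.
move=> c0 A0 aq; rewrite -!expRD ler_expR.
have sq : 0 <= (s * A - c * `|a|) ^+ 2 by exact: sqr_ge0.
have a2 : `|a| ^+ 2 = a ^+ 2 by rewrite real_normK ?num_real.
have d0 : 0 < 2 * A * c by rewrite !mulr_gt0.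
rewrite -(ler_pM2l d0) -subr_ge0.
have -> : 2 * A * c * (s ^+ 2 * A / (2 * c) + - (c / 2 * q)) - 2 * A * c * (s * `|a| - c * q)
   = (s * A - c * `|a|) ^+ 2 + c ^+ 2 * (A * q - `|a| ^+ 2).
  by field; rewrite gt_eqF.
by rewrite addr_ge0// mulr_ge0 ?sqr_ge0// subr_ge0 a2.
Qed.

Lemma measurable_hq d (T : measurableType d) (a : T -> R) (b : R) k :
  measurable_fun setT a -> measurable_fun setT (fun y => hq (a y) b k).
Proof.
move=> ma; elim/nat2_ind: k => [||k h1 h2]; first exact: measurable_cst.
  exact: ma.
have k2 : k.+2%:R != 0 :> R by rewrite pnatr_eq0.
have E t : hq t b k.+2 = k.+2%:R^-1 * (t * hq t b k.+1 + 2 * b * hq t b k).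
  by apply: (mulfI k2); rewrite hqSS mulVKf.
under eq_fun do rewrite E.
apply: measurable_funM => //; apply: measurable_funD; exact: measurable_funM.
Qed.

Lemma gauss_rgd n (K c : R) : 0 < c ->
  rgd (fun y : n.-tuple R => K * expR (- (c * sqnorm y))).
Proof.
move=> c0; split.
  apply: measurable_funM => //; apply: measurableT_comp => //.
  apply: measurableT_comp => //; apply: measurable_funM => //.
  exact: measurable_sqnorm.
by exists `|K|, c; split=> // x; rewrite normrM [X in _ * X]ger0_norm ?expR_ge0.
Qed.

Variables (n : nat) (W : n.-tuple R -> C) (K c : R) (a : n.-tuple R -> R) (A b : R).
Hypotheses (c_gt0 : 0 < c) (K_ge0 : 0 <= K) (A_gt0 : 0 < A).
Hypothesis mW : cmeas W.
Hypothesis W_le : forall y, cmod (W y) <= K * expR (- (c * sqnorm y)).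
Hypothesis ma : measurable_fun setT a.
Hypothesis a_le : forall y, a y ^+ 2 <= A * sqnorm y.

Lemma kernel_le (k : n.-tuple R -> C) (B s : R) : 0 <= B ->
  (forall y, cmod (k y) <= B * expR (s * `|a y|)) ->
  forall y, cmod (W y * k y) <=
    K * B * expR (s ^+ 2 * A / (2 * c)) * expR (- (c / 2 * sqnorm y)).
Proof.
move=> B0 kb y; rewrite cmodM.
apply: le_trans (_ : K * B * (expR (s * `|a y|) * expR (- (c * sqnorm y))) <= _).
  rewrite [leRHS](_ : _ = K * expR (- (c * sqnorm y)) * (B * expR (s * `|a y|))); last by ring.
  by apply: ler_pM; rewrite ?cmod_ge0.
rewrite -[leRHS]mulrA ler_wpM2l ?mulr_ge0//.
exact: exp_lin_gauss.
Qed.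

Lemma cgd_kernel (k : n.-tuple R -> C) (B s : R) : 0 <= B -> cmeas k ->
  (forall y, cmod (k y) <= B * expR (s * `|a y|)) -> cgd (fun y => W y * k y).
Proof.
move=> B0 mk kb; split; first exact: cmeasM.
exists (K * B * expR (s ^+ 2 * A / (2 * c))), (c / 2); split; first by rewrite divr_gt0.
exact: kernel_le.
Qed.

(** The Taylor coefficients of [kernel_fun], which is the generating series integrated against W. It
    serves twice: for the Bargmann transform, and with b = 0 for the Laplace transform of a
    Gaussian. *)
Definition kernel_coef k : C := cint (fun y => W y * Complex (hq (a y) b k) 0).

Definition kernel_fun (z : C) : C :=
  cint (fun y => W y * cexp (Complex (a y) 0 * z + Complex b 0 * z ^+ 2)).

Lemma cgd_hq k : cgd (fun y => W y * Complex (hq (a y) b k) 0).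
Proof.
apply: (@cgd_kernel _ (k.+1%:R * expR `|b|) 1); first by rewrite mulr_ge0// expR_ge0.
  by apply: cmeas_real; exact: measurable_hq.
move=> y; rewrite cmod_real; apply: le_trans (norm_hq_le _ _ _) _.
have := @hq_le_expR R `|a y| `|b| 1 k (normr_ge0 _) (normr_ge0 _) ler01.
by rewrite !expr1n !mulr1 mul1r expRD -mulrA (mulrC (expR `|b|)).
Qed.

Lemma cgd_cexp z : cgd (fun y => W y * cexp (Complex (a y) 0 * z + Complex b 0 * z ^+ 2)).
Proof.
apply: (@cgd_kernel _ (expR (cmod (Complex b 0 * z ^+ 2))) (cmod z)); first exact: expR_ge0.
  apply: cmeas_cexp; apply: cmeasD; last exact: cmeas_cst.
  by apply: cmeasM; [exact: cmeas_real|exact: cmeas_cst].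
move=> y; rewrite cmod_cexp -expRD ler_expR; apply: le_trans (ler_norm _) _.
apply: le_trans (ler_Re_cmod _) _; apply: le_trans (ler_cmodD _ _) _.
by rewrite addrC lerD2l cmodM cmod_real mulrC.
Qed.

(** The truncation error of [cexp_psum_hq] grows in y only like exp(6 r |a y|), which the Gaussian
    decay of W absorbs, so the rate 1/N survives integration. *)
Lemma kernel_psum_cvg : psum_cvg kernel_coef kernel_fun.
Proof.
move=> r0 eps eps0; pose r := `|r0|.
pose B := 5 * (1 + 2 * `|b| * r ^+ 2) * expR (18 * (`|b| * r ^+ 2)).
pose L := K * B * expR ((6 * r) ^+ 2 * A / (2 * c)).
have c2 : 0 < c / 2 by rewrite divr_gt0.
pose D := L * iint (fun y : n.-tuple R => 1 * expR (- (c / 2 * sqnorm y))).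
have q0 : 0 <= 2 * `|b| * r ^+ 2 by apply: mulr_ge0; rewrite ?sqr_ge0 ?mulr_ge0.
have B0 : 0 <= B by apply: mulr_ge0; rewrite ?expR_ge0// mulr_ge0// addr_ge0.
have [N0 HN0] : exists N0 : nat, `|D| / eps < N0%:R.
  by exists (Num.bound (`|D| / eps)); rewrite archi_boundP// divr_ge0// ltW.
exists N0.+1 => -[//|N] NN z zr.
have {}zr : cmod z <= r by exact: le_trans zr (ler_norm _).
have Np : 0 < N.+1%:R :> R by rewrite ltr0n.
have -> : kernel_fun z - psum kernel_coef N.+1 z = cint (fun y => W y *
    (cexp (Complex (a y) 0 * z + Complex b 0 * z ^+ 2) -
     psum (fun k => Complex (hq (a y) b k) 0) N.+1 z)).
  have -> : psum kernel_coef N.+1 z = cint (fun y => \sum_(k < N.+1)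
      z ^+ k * (W y * Complex (hq (a y) b k) 0)).
    rewrite cint_sum => [|i]; last by apply: cgdZ; exact: cgd_hq.
    by apply: eq_bigr => k _; rewrite cintZ 1?mulrC//; exact: cgd_hq.
  rewrite -[- cint _]mulN1r -cintZ; last first.
    by apply: cgd_sum => i; apply: cgdZ; exact: cgd_hq.
  rewrite -cintD; last 2 first.
  - exact: cgd_cexp.
  - by apply: cgdZ; apply: cgd_sum => i; apply: cgdZ; exact: cgd_hq.
  apply: eq_cint => y; rewrite mulrBr mulN1r /psum; congr (_ - _).
  by rewrite mulr_sumr; apply: eq_bigr => k _; ring.
have kb y : cmod (cexp (Complex (a y) 0 * z + Complex b 0 * z ^+ 2) -
     psum (fun k => Complex (hq (a y) b k) 0) N.+1 z) <=
     B / N.+1%:R * expR (6 * r * `|a y|).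
  apply: le_trans (cexp_psum_hq _ _ _ zr) _.
  rewrite expRD /B le_eqVlt; apply/orP; left; apply/eqP.
  have -> : 6 * (`|a y| * r) = 6 * r * `|a y| by ring.
  by ring.
have BN : 0 <= B / N.+1%:R by rewrite divr_ge0.
have KB := kernel_le BN kb.
apply: le_trans (ler_cmod_cint (g := fun y => L / N.+1%:R *
   (1 * expR (- (c / 2 * sqnorm y)))) _ _ _) _.
- apply: (@cgd_kernel _ (B / N.+1%:R) (6 * r)) => //.
  apply: cmeasD.
    apply: cmeas_cexp; apply: cmeasD; last exact: cmeas_cst.
    by apply: cmeasM; [exact: cmeas_real|exact: cmeas_cst].
  under eq_fun do rewrite -mulN1r.
  apply: cmeasM; first exact: cmeas_cst.
  apply: cmeas_sum => k; apply: cmeasM; last exact: cmeas_cst.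
  by apply: cmeas_real; exact: measurable_hq.
- by apply: rgdZ; exact: gauss_rgd.
- move=> y; apply: le_trans (KB y) _; rewrite mul1r /L le_eqVlt; apply/orP; left.
  by apply/eqP; ring.
rewrite iintZ; last exact: gauss_rgd.
rewrite mulrAC -/D ler_pdivrMr//; apply: le_trans (ler_norm _) _.
rewrite mulrC -ler_pdivrMr//; apply: le_trans (ltW HN0) _.
by rewrite ler_nat; exact: leq_trans (leqnSn _) NN.
Qed.

End ExponentialKernels.

(** * Identity theorem from the real axis *)

Section IdentityTheorem.
Variable R : realType.
Local Notation C := R[i].

Lemma psum_cvg_zero (P : nat -> C) (G : C -> C) :
  psum_cvg P G -> (forall x : R, G (Complex x 0) = 0) -> forall k, P k = 0.
Proof.
move=> cv G0 k; elim/ltn_ind: k => k IH.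
(* Convergence on the disc of radius 2 gives |P j| <= 2 * 2^-j eventually, hence a bound M on all
   sums of moduli. *)
have [N0 HN] := cv 2 1 ltr01.
have big j : (N0 <= j)%N -> cmod (P j) <= 2 * 2^-1 ^+ j.
  move=> Nj; have h1 := HN j Nj (Complex 2 0); have h2 := HN j.+1 (leqW Nj) (Complex 2 0).
  have c2 : cmod (Complex 2 0 : C) = 2 by rewrite cmod_real ger0_norm.
  rewrite c2 lexx in h1 h2; have {}h1 := h1 isT; have {}h2 := h2 isT.
  have E : P j * Complex 2 0 ^+ j = (G (Complex 2 0) - psum P j (Complex 2 0)) -
      (G (Complex 2 0) - psum P j.+1 (Complex 2 0)).
    by rewrite /psum big_ord_recr /=; ring.
  have : cmod (P j * Complex 2 0 ^+ j) <= 2.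
    rewrite E; apply: le_trans (ler_cmodD _ _) _; rewrite cmodN.
    by apply: le_trans (lerD h1 h2) _; rewrite -[1 + 1]mulr2n.
  by rewrite cmodM cmodX c2 exprVn ler_pdivlMr ?exprn_gt0.
pose M := \sum_(j < N0) cmod (P j) + 4.
have M0 : 0 <= M by rewrite addr_ge0// sumr_ge0// => i _; exact: cmod_ge0.
have tail N : \sum_(j < N) cmod (P j) <= M.
  rewrite /M; have [NN|NN] := leqP N N0.
    rewrite -(subnKC NN) big_split_ord /= -addrA lerDl addr_ge0// sumr_ge0// => i _.
    exact: cmod_ge0.
  rewrite -(subnKC (ltnW NN)) big_split_ord /= lerD2l.
  apply: (@le_trans _ _ (\sum_(i < N - N0) 2 * 2^-1 ^+ i)).
    apply: ler_sum => i _; apply: le_trans (big _ (leq_addr _ _)) _.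
    by rewrite ler_wpM2l// exprD ler_piMl// ?exprn_ge0// exprn_ile1// invf_le1// ler1n.
  rewrite -mulr_sumr; have := subrX1 (2^-1 : R) (N - N0).
  set S := \sum_(i < _) _ => hS.
  have : 0 <= 2^-1 ^+ (N - N0) :> R by rewrite exprn_ge0.
  by lra.
apply: cmod_eq0; apply/eqP; rewrite eq_le cmod_ge0 andbT.
apply/ler_addgt0Pr => eta eta0; rewrite add0r.
(* The lower coefficients vanish and the higher ones contribute at most x^(k+1) M, so at this small
   x the term of degree k must be at most eta x^k. *)
pose x := Num.min 1 (eta / (2 * (M + 1))).
have M1 : 0 < M + 1 by rewrite ltr_wpDl.
have x0 : 0 < x by rewrite lt_min ltr01 divr_gt0// mulr_gt0.
have x1 : x <= 1 by rewrite ge_min lexx.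
have xM : x * M <= eta / 2.
  apply: le_trans (_ : eta / (2 * (M + 1)) * M <= _).
    by rewrite ler_wpM2r// ge_min lexx orbT.
  rewrite mulrAC ler_pdivrMr ?mulr_gt0//.
  have -> : eta / 2 * (2 * (M + 1)) = eta * (M + 1) by field.
  by rewrite ler_pM2l// lerDl.
have e2 : 0 < eta / 2 * x ^+ k by rewrite mulr_gt0 ?exprn_gt0// divr_gt0.
have [N1 HN1] := cv 1 _ e2.
pose N := (N1 + k.+1)%N.
have cx : cmod (Complex x 0 : C) = x by rewrite cmod_real gtr0_norm.
have := HN1 N (leq_addr _ _) (Complex x 0); rewrite cx x1 G0 sub0r cmodN => /(_ isT).
have kN : (k < N)%N by rewrite /N addnS ltnS leq_addl.
rewrite /psum (bigD1 (Ordinal kN)) //=.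
set S := \sum_(i < N | _) _ => h.
have Sb : cmod S <= x ^+ k.+1 * M.
  apply: le_trans (ler_cmod_sum _ _ _) _.
  apply: (@le_trans _ _ (\sum_(i < N | i != Ordinal kN) x ^+ k.+1 * cmod (P i))).
    apply: ler_sum => i ik; rewrite cmodM cmodX cx mulrC.
    have [ik1|ik1] := ltnP i k; first by rewrite IH// cmod0 !mulr0.
    have ik2 : (k < i)%N by rewrite ltn_neqAle ik1 andbT eq_sym.
    by rewrite ler_wpM2r ?cmod_ge0// -(subnKC ik2) exprD ler_piMr ?exprn_ge0 ?(ltW x0)// exprn_ile1// ltW.
  rewrite -mulr_sumr ler_wpM2l ?exprn_ge0 ?(ltW x0)//.
  apply: le_trans (tail N); rewrite [leRHS](bigD1 (Ordinal kN))//= lerDr.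
  exact: cmod_ge0.
have : cmod (P k * Complex x 0 ^+ k) <= eta / 2 * x ^+ k + x ^+ k.+1 * M.
  rewrite -(addrK S (P k * _)); apply: le_trans (ler_cmodD _ _) _.
  by rewrite cmodN; exact: lerD.
rewrite cmodM cmodX cx exprS.
have -> : eta / 2 * x ^+ k + x * x ^+ k * M = (eta / 2 + x * M) * x ^+ k by ring.
rewrite ler_pM2r ?exprn_gt0// => /le_trans; apply.
by rewrite [leRHS]splitr lerD2l.
Qed.

Lemma psum_cvgB (P Q : nat -> C) (G H : C -> C) : psum_cvg P G -> psum_cvg Q H ->
  psum_cvg (fun k => P k - Q k) (fun z => G z - H z).
Proof.
move=> cP cQ r eps eps0; have e2 : 0 < eps / 2 by rewrite divr_gt0.
have [N1 H1] := cP r _ e2; have [N2 H2] := cQ r _ e2.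
exists (maxn N1 N2) => N; rewrite geq_max => /andP[n1 n2] z zr.
have -> : G z - H z - psum (fun k => P k - Q k) N z =
   (G z - psum P N z) - (H z - psum Q N z).
  rewrite /psum; under eq_bigr do rewrite mulrBl.
  by rewrite sumrB; ring.
apply: le_trans (ler_cmodD _ _) _; rewrite cmodN [leRHS]splitr.
by apply: lerD; [exact: H1|exact: H2].
Qed.

Lemma psum_cvg_identity (P Q : nat -> C) (G H : C -> C) :
  psum_cvg P G -> psum_cvg Q H ->
  (forall x : R, G (Complex x 0) = H (Complex x 0)) -> forall z, G z = H z.
Proof.
move=> cP cQ GH z; have cB := psum_cvgB cP cQ.
have PQ : forall k, P k - Q k = 0.
  by apply: psum_cvg_zero cB _ => x; rewrite GH subrr.
apply/eqP; rewrite -subr_eq0; apply/eqP/cmod_eq0/eqP.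
rewrite eq_le cmod_ge0 andbT; apply/ler_addgt0Pr => eps eps0; rewrite add0r.
have [N0 HN] := cB (cmod z) eps eps0.
have := HN N0 (leqnn _) z (lexx _).
by rewrite /psum big1 ?subr0// => k _; rewrite PQ mul0r.
Qed.

Lemma psum_cvg_cexp_sqr (k : C) (b : R) :
  psum_cvg (fun j => k * Complex (hq 0 b j) 0)
    (fun z => k * cexp (Complex b 0 * z ^+ 2)).
Proof.
move=> r0 eps eps0; pose r := `|r0|.
pose D := cmod k * (5 * (1 + 2 * `|b| * r ^+ 2) * expR (18 * (`|b| * r ^+ 2))).
have q0 : 0 <= 2 * `|b| * r ^+ 2 by apply: mulr_ge0; rewrite ?sqr_ge0 ?mulr_ge0.
have D0 : 0 <= D.
  by apply: mulr_ge0; rewrite ?cmod_ge0// mulr_ge0 ?expR_ge0// mulr_ge0// addr_ge0.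
have [N0 HN0] : exists N0 : nat, D / eps < N0%:R.
  by exists (Num.bound (D / eps)); rewrite archi_boundP// divr_ge0// ltW.
exists N0.+1 => -[//|N] NN z zr.
have {}zr : cmod z <= r by exact: le_trans zr (ler_norm _).
have Np : 0 < N.+1%:R :> R by rewrite ltr0n.
have := cexp_psum_hq 0 b N zr; rewrite normr0 !mul0r mulr0 !add0r => h.
have -> : psum (fun j => k * Complex (hq 0 b j) 0) N.+1 z =
    k * psum (fun j => Complex (hq 0 b j) 0) N.+1 z.
  by rewrite /psum mulr_sumr; apply: eq_bigr => i _; rewrite mulrA.
rewrite -mulrBr cmodM.
apply: le_trans (ler_wpM2l (cmod_ge0 _) h) _.
have -> : cmod k * (5 / N.+1%:R * (1 + 2 * `|b| * r ^+ 2) * expR (18 * (`|b| * r ^+ 2))) =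
  D / N.+1%:R by rewrite /D; ring.
rewrite ler_pdivrMr// mulrC -ler_pdivrMr//; apply: le_trans (ltW HN0) _.
by rewrite ler_nat; exact: leq_trans (leqnSn _) NN.
Qed.

End IdentityTheorem.

(** * Gaussian integrals with complex linear exponent *)

Section GaussianIntegrals.
Variable R : realType.
Local Notation C := R[i].
Local Notation leb := (@lebesgue_measure R).
Local Open Scope classical_set_scope.

Lemma iint0 n : iint (fun _ : n.-tuple R => 0 : R) = 0.
Proof. by have := congr1 (@complex.Re R) (cint0 R n). Qed.

Lemma cint_real n (g : n.-tuple R -> R) :
  cint (fun x => Complex (g x) 0 : C) = Complex (iint g) 0.
Proof. by rewrite /cint /= iint0. Qed.

Lemma iint_gauss1 (c x : R) : 0 < c ->
  iint (fun y : 1.-tuple R => expR (- (c * sqnorm y)) * expR (tnth y ord0 * x)) =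
  gauss_mass c * expR ((4 * c)^-1 * x ^+ 2).
Proof.
move=> c0; have cn : c != 0 by rewrite gt_eqF.
rewrite -(Rintegral_gauss (x / (2 * c)) c0) mulrC -RintegralZl//; last exact: integrable_gauss.
rewrite /=; apply: eq_Rintegral => t _; rewrite sqnorm1 tnth_cons0 -!expRD.
by congr expR; field.
Qed.

(** Both sides are entire in w and agree for real w, where translating the Gaussian is enough. This
    avoids a contour shift. *)
Lemma cint1_gauss (c : R) (w : C) : 0 < c ->
  cint1 (fun t => Complex (expR (- (c * t ^+ 2))) 0 * cexp (Complex t 0 * w)) =
  Complex (gauss_mass c) 0 * cexp (Complex (4 * c)^-1 0 * w ^+ 2).
Proof.
move=> c0.
pose W (y : 1.-tuple R) : C := Complex (expR (- (c * sqnorm y))) 0.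
pose a (y : 1.-tuple R) := tnth y ord0.
have mW : cmeas W.
  apply: cmeas_real; have := (gauss_rgd 1 1 c0).1.
  by under eq_fun do rewrite mul1r.
have Wb y : cmod (W y) <= 1 * expR (- (c * sqnorm y)).
  by rewrite cmod_real ger0_norm ?expR_ge0// mul1r.
have ma : measurable_fun setT a by exact: measurable_tnth.
have ab y : a y ^+ 2 <= 1 * sqnorm y by rewrite sqnorm1 mul1r.
have cv1 := @kernel_psum_cvg _ _ _ 1 c _ 1 0 c0 ler01 ltr01 mW Wb ma ab.
have cv2 := psum_cvg_cexp_sqr (Complex (gauss_mass c) 0) (4 * c)^-1.
rewrite -(psum_cvg_identity cv1 cv2).
  by apply: eq_cint => y; rewrite /W sqnorm1 mul0r addr0.
move=> x; rewrite /kernel_fun.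
rewrite (eq_cint (G := fun y => Complex (expR (- (c * sqnorm y)) * expR (tnth y ord0 * x)) 0)).
  rewrite cint_real iint_gauss1//.
  have -> : Complex (4 * c)^-1 0 * Complex x 0 ^+ 2 = Complex ((4 * c)^-1 * x ^+ 2) 0 :> C.
    by apply: complexP; rewrite !expr2 /=; ring.
  by rewrite cexp_real; apply: complexP => /=; ring.
move=> y; rewrite mul0r addr0.
have -> : Complex (a y) 0 * Complex x 0 = Complex (a y * x) 0 :> C.
  by apply: complexP => /=; ring.
by rewrite cexp_real; apply: complexP => /=; ring.
Qed.

Lemma cmeas_gauss1 (c : R) (w : C) :
  cmeas (fun t : R => Complex (expR (- (c * t ^+ 2))) 0 * cexp (Complex t 0 * w)).
Proof.
apply: cmeasM.
  apply: cmeas_real; apply: measurableT_comp => //; apply: measurableT_comp => //.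
  by apply: measurable_funM => //; exact: measurable_funX.
by apply: cmeas_cexp; apply: cmeasM; [exact: cmeas_real|exact: cmeas_cst].
Qed.

Lemma cmod_gauss1 (c : R) (w : C) t : 0 < c ->
  cmod (Complex (expR (- (c * t ^+ 2))) 0 * cexp (Complex t 0 * w)) <=
  expR (cmod w ^+ 2 * 1 / (2 * c)) * expR (- (c / 2 * t ^+ 2)).
Proof.
move=> c0; rewrite cmodM cmod_real ger0_norm ?expR_ge0// cmod_cexp mulrC.
apply: le_trans (exp_lin_gauss (a := t) (cmod w) c0 ltr01 _); last by rewrite mul1r.
rewrite ler_wpM2r ?expR_ge0// ler_expR; apply: le_trans (ler_norm _) _.
by apply: le_trans (ler_Re_cmod _) _; rewrite cmodM cmod_real mulrC.
Qed.

Lemma gauss_prodE n (c : R) (w : 'I_n -> C) (y : n.-tuple R) :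
  Complex (expR (- (c * sqnorm y))) 0 * cexp (\sum_(i < n) Complex (tnth y i) 0 * w i) =
  \prod_(i < n) (Complex (expR (- (c * tnth y i ^+ 2))) 0 *
     cexp (Complex (tnth y i) 0 * w i)).
Proof.
rewrite big_split /= -cexp_sum; congr (_ * _).
rewrite -cexp_real /sqnorm mulr_sumr -sumrN.
rewrite (big_morph (fun t : R => Complex t 0) (id1 := 0) (op1 := +%R)) ?cexp_sum//.
  by apply: eq_bigr => i _; rewrite cexp_real.
by move=> s t; apply: complexP => //=; rewrite addr0.
Qed.

Lemma cgd_gauss n (c : R) (w : 'I_n -> C) : 0 < c ->
  cgd (fun y : n.-tuple R => Complex (expR (- (c * sqnorm y))) 0 *
    cexp (\sum_(i < n) Complex (tnth y i) 0 * w i)).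
Proof.
move=> c0; have c2 : 0 < c / 2 by rewrite divr_gt0.
rewrite (_ : (fun _ => _) = fun y : n.-tuple R => \prod_(i < n)
   (Complex (expR (- (c * tnth y i ^+ 2))) 0 * cexp (Complex (tnth y i) 0 * w i))).
  exact: (cgd_prod (phi := fun i t => Complex (expR (- (c * t ^+ 2))) 0 *
    cexp (Complex t 0 * w i)) c2 (fun i => cmeas_gauss1 c (w i))
    (fun i t => cmod_gauss1 (w i) t c0)).
by apply/funext => y; exact: gauss_prodE.
Qed.

Lemma cint_gauss n (c : R) (w : 'I_n -> C) : 0 < c ->
  cint (fun y : n.-tuple R => Complex (expR (- (c * sqnorm y))) 0 *
    cexp (\sum_(i < n) Complex (tnth y i) 0 * w i)) =
  Complex (gauss_mass c) 0 ^+ n * cexp (Complex (4 * c)^-1 0 * \sum_(i < n) w i ^+ 2).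
Proof.
move=> c0; have c2 : 0 < c / 2 by rewrite divr_gt0.
rewrite (eq_cint (gauss_prodE c w)).
rewrite (cint_prod (phi := fun i t => Complex (expR (- (c * t ^+ 2))) 0 *
    cexp (Complex t 0 * w i)) c2 (fun i => cmeas_gauss1 c (w i))
    (fun i t => cmod_gauss1 (w i) t c0)).
under eq_bigr do rewrite cint1_gauss//.
by rewrite big_split /= prodr_const card_ord mulr_sumr cexp_sum.
Qed.

Lemma cmod_cint_gauss n (F : n.-tuple R -> C) (c M : R) (u : 'I_n -> R) : 0 < c ->
  cgd F ->
  (forall y, cmod (F y) <= M * (expR (- (c * sqnorm y)) * expR (\sum_(i < n) tnth y i * u i))) ->
  cmod (cint F) <= M * (gauss_mass c ^+ n * expR ((4 * c)^-1 * \sum_(i < n) u i ^+ 2)).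
Proof.
move=> c0 gF Fb.
have realsum (v : 'I_n -> R) : \sum_(i < n) Complex (v i) 0 = Complex (\sum_(i < n) v i) 0 :> C.
  rewrite (big_morph (fun t : R => Complex t 0) (id1 := 0) (op1 := +%R))//.
  by move=> s t; apply: complexP => //=; rewrite addr0.
have realE y : Complex (expR (- (c * sqnorm y))) 0 *
    cexp (\sum_(i < n) Complex (tnth y i) 0 * Complex (u i) 0) =
    Complex (expR (- (c * sqnorm y)) * expR (\sum_(i < n) tnth y i * u i)) 0 :> C.
  have -> : \sum_(i < n) Complex (tnth y i) 0 * Complex (u i) 0 =
      Complex (\sum_(i < n) tnth y i * u i) 0 :> C.
    by rewrite -realsum; apply: eq_bigr => i _; apply: complexP => /=; ring.
  by rewrite cexp_real; apply: complexP => /=; ring.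
have gG := cgd_gauss (fun i => Complex (u i) 0) c0.
have rG : rgd (fun y : n.-tuple R => expR (- (c * sqnorm y)) * expR (\sum_(i < n) tnth y i * u i)).
  by have := cgd_Re gG; under eq_fun do rewrite realE.
apply: le_trans (ler_cmod_cint gF (rgdZ M rG) Fb) _.
rewrite iintZ//; suff -> : iint (fun y : n.-tuple R => expR (- (c * sqnorm y)) *
  expR (\sum_(i < n) tnth y i * u i)) =
  gauss_mass c ^+ n * expR ((4 * c)^-1 * \sum_(i < n) u i ^+ 2) by [].
have := cint_gauss (fun i => Complex (u i) 0) c0.
rewrite (eq_cint realE) cint_real.
have -> : \sum_(i < n) Complex (u i) 0 ^+ 2 = Complex (\sum_(i < n) u i ^+ 2) 0 :> C.
  by rewrite -realsum; apply: eq_bigr => i _; rewrite !expr2; apply: complexP => /=; ring.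
have -> : Complex (4 * c)^-1 0 * Complex (\sum_(i < n) u i ^+ 2) 0 =
    Complex ((4 * c)^-1 * \sum_(i < n) u i ^+ 2) 0 :> C.
  by apply: complexP => /=; ring.
rewrite cexp_real.
have powE (t : R) k : Complex t 0 ^+ k = Complex (t ^+ k) 0 :> C.
  elim: k => [//|k IH]; rewrite !exprS IH; by apply: complexP => /=; ring.
by rewrite powE => /(congr1 (@complex.Re R)) /= ->; ring.
Qed.

End GaussianIntegrals.

(** * The Bargmann transform *)

Section BargmannBounds.
Variable R : realType.
Local Notation C := R[i].
Local Open Scope classical_set_scope.

Lemma CplxM (s t : R) : Complex (s * t) 0 = Complex s 0 * Complex t 0 :> C.
Proof. by apply: complexP => /=; ring. Qed.

Lemma Cplx_sum (I : Type) (r : seq I) (v : I -> R) :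
  Complex (\sum_(i <- r) v i) 0 = \sum_(i <- r) Complex (v i) 0 :> C.
Proof.
rewrite (big_morph (fun t : R => Complex t 0) (id1 := 0) (op1 := +%R))//.
by move=> s t; apply: complexP => //=; rewrite addr0.
Qed.

Lemma dotp_cauchy_schwarz n (x y : n.-tuple R) :
  dotp x y ^+ 2 <= sqnorm x * sqnorm y.
Proof.
set s := dotp x y; set t := sqnorm x.
have sq : 0 <= t * (t * sqnorm y - s ^+ 2).
  have -> : t * (t * sqnorm y - s ^+ 2) =
      \sum_(i < n) (t * tnth y i - s * tnth x i) ^+ 2.
    under eq_bigr do rewrite sqrrB !exprMn.
    rewrite big_split /= sumrB -!mulr_sumr -/(sqnorm y) -/(sqnorm x) -/t.
    have -> : \sum_(i < n) t * tnth y i * (s * tnth x i) *+ 2 = t * s * s *+ 2.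
      rewrite [in RHS]/s /dotp mulr_sumr -sumrMnl; apply: eq_bigr => i _.
      by congr (_ *+ 2); rewrite -/(dotp x y) -/s; ring.
    by ring.
  by apply: sumr_ge0 => i _; exact: sqr_ge0.
have := sqnorm_ge0 x; rewrite -/t le_eqVlt => /predU1P[t0|t0].
  suff -> : s = 0 by rewrite -t0 expr0n mul0r.
  rewrite /s /dotp big1 // => i _.
  move/esym/eqP: t0; rewrite /t /sqnorm psumr_eq0 => [/allP/(_ i)|j _]; last exact: sqr_ge0.
  by rewrite mem_index_enum sqrf_eq0 => /(_ isT) /eqP ->; rewrite mul0r.
by rewrite -subr_ge0; rewrite pmulr_rge0 in sq.
Qed.

Lemma measurable_dotp n (x : n.-tuple R) : measurable_fun setT (dotp x).
Proof.
apply: measurable_sum => i; apply: measurable_funM => //; exact: measurable_tnth.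
Qed.

Lemma cmod_expi (t : R) : cmod (expi t) = 1.
Proof. by rewrite -cexp_expi cmod_cexp /= expR0. Qed.

Variables (n : nat) (f : n.-tuple R -> C) (a C0 : R).
Hypotheses (a_gt0 : 0 < a) (C0_ge0 : 0 <= C0) (mf : cmeas f).
Hypothesis f_le : forall y, cmod (f y) <= C0 * expR (- (a * sqnorm y) / 2).
Hypothesis fh_le : forall xi, cmod (fourier f xi) <= C0 * expR (- (a * sqnorm xi) / 2).

Definition gweight (y : n.-tuple R) : C := f y * Complex (expR (- (2^-1 * sqnorm y))) 0.

Definition rdot (x y : n.-tuple R) : R := Num.sqrt 2 * dotp x y.

Let half_gt0 : 0 < 2^-1 :> R. Proof. by rewrite invr_gt0. Qed.

Let f_le' y : cmod (f y) <= C0 * expR (- (a / 2 * sqnorm y)).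
Proof. by apply: le_trans (f_le y) _; rewrite mulNr mulrAC. Qed.

Lemma cmeas_gauss (c : R) : cmeas (fun y : n.-tuple R => Complex (expR (- (c * sqnorm y))) 0 : C).
Proof.
apply: cmeas_real; apply: measurableT_comp => //.
apply: measurableT_comp => //; apply: measurable_funM => //.
exact: measurable_sqnorm.
Qed.

Lemma cmeas_gweight : cmeas gweight.
Proof. by apply: cmeasM => //; exact: cmeas_gauss. Qed.

Lemma gweight_le y : cmod (gweight y) <= C0 * expR (- (2^-1 * sqnorm y)).
Proof.
rewrite cmodM cmod_real ger0_norm ?expR_ge0// ler_wpM2r ?expR_ge0//.
apply: le_trans (f_le' y) _; rewrite ler_piMr// expR_le1 oppr_le0.
by rewrite mulr_ge0 ?sqnorm_ge0// divr_ge0// ltW.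
Qed.

Lemma measurable_rdot x : measurable_fun setT (rdot x).
Proof. by apply: measurable_funM => //; exact: measurable_dotp. Qed.

Lemma rdot_le x y : sqnorm x <= 1 -> rdot x y ^+ 2 <= 2 * sqnorm y.
Proof.
move=> x1; rewrite exprMn sqr_sqrtr// ler_pM2l//.
apply: le_trans (dotp_cauchy_schwarz x y) _.
by rewrite ler_piMl// sqnorm_ge0.
Qed.

Lemma cgd_gweight_hq x b k : sqnorm x <= 1 ->
  cgd (fun y => gweight y * Complex (hq (rdot x y) b k) 0).
Proof.
move=> x1; exact: (cgd_hq b half_gt0 C0_ge0 (@ltr0Sn R 1) cmeas_gweight gweight_le
  (measurable_rdot x) (fun y => rdot_le y x1)).
Qed.

Section UnitVector.
Variable x : n.-tuple R.
Hypothesis x1 : sqnorm x = 1.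

Let x_le1 : sqnorm x <= 1. Proof. by rewrite x1. Qed.

(** Up to a constant, the classical Bargmann transform at the point z x: the kernel is exp(-|y|^2/2
    + sqrt 2 z x.y - z^2/2), because x.x = 1. *)
Definition bargmann : C -> C := kernel_fun gweight (rdot x) (- 2^-1).

Lemma bargmann_psum_cvg : psum_cvg (kernel_coef gweight (rdot x) (- 2^-1)) bargmann.
Proof.
exact: (@kernel_psum_cvg _ _ _ _ _ _ _ (- 2^-1) half_gt0 C0_ge0 (@ltr0Sn R 1) cmeas_gweight
  gweight_le (measurable_rdot x) (fun y => rdot_le y x_le1)).
Qed.

Definition barg_cst : R := C0 * gauss_mass ((1 + a) / 2) ^+ n.

Lemma barg_cst_ge0 : 0 <= barg_cst.
Proof. by rewrite mulr_ge0// exprn_ge0// gauss_mass_ge0. Qed.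

Let c_gt0 : 0 < (1 + a) / 2. Proof. by rewrite divr_gt0// addr_gt0. Qed.

Let sum_sqr (u : R) : (4 * ((1 + a) / 2))^-1 *
  (\sum_(i < n) (Num.sqrt 2 * u * tnth x i) ^+ 2) = u ^+ 2 / (1 + a).
Proof.
under eq_bigr do rewrite exprMn.
rewrite -mulr_sumr -/(sqnorm x) x1 mulr1 exprMn sqr_sqrtr//.
by field; rewrite gt_eqF// addr_gt0.
Qed.

Let exponent (u v : R) : - ((u ^+ 2 - v ^+ 2) / 2) + u ^+ 2 / (1 + a) =
  ((1 - a) / (1 + a) * u ^+ 2 + v ^+ 2) / 2.
Proof. by field; rewrite gt_eqF// addr_gt0. Qed.

(** With z = u + i v, the decay of f leaves the Gaussian exp(-(1 + a)|y|^2/2 + sqrt 2 u x.y), whose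
    integral contributes exp(u^2/(1 + a)); the factor exp(-(u^2 - v^2)/2) of the kernel does the
    rest. *)
Lemma bargmann_real z : cmod (bargmann z) <=
  barg_cst * expR (((1 - a) / (1 + a) * complex.Re z ^+ 2 + complex.Im z ^+ 2) / 2).
Proof.
set u := complex.Re z; set v := complex.Im z.
apply: le_trans (@cmod_cint_gauss _ _ _ ((1 + a) / 2) (C0 * expR (- ((u ^+ 2 - v ^+ 2) / 2)))
  (fun i => Num.sqrt 2 * u * tnth x i) c_gt0 _ _) _.
- exact: (cgd_cexp _ half_gt0 C0_ge0 (@ltr0Sn R 1) cmeas_gweight
    gweight_le (measurable_rdot x) (fun y => rdot_le y x_le1)).
- move=> y; rewrite !cmodM cmod_real cmod_cexp ger0_norm ?expR_ge0//.
  have -> : complex.Re (Complex (rdot x y) 0 * z + Complex (- 2^-1) 0 * z ^+ 2) =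
      - ((u ^+ 2 - v ^+ 2) / 2) + \sum_(i < n) tnth y i * (Num.sqrt 2 * u * tnth x i).
    have -> : \sum_(i < n) tnth y i * (Num.sqrt 2 * u * tnth x i) = rdot x y * u.
      by rewrite /rdot /dotp mulrAC mulr_sumr; apply: eq_bigr => i _; ring.
    by rewrite expr2 !ReImE /= -/u -/v; field.
  rewrite expRD.
  rewrite [leRHS](_ : _ = C0 * expR (- (a * sqnorm y) / 2) * expR (- (2^-1 * sqnorm y)) *
    (expR (- ((u ^+ 2 - v ^+ 2) / 2)) * expR (\sum_(i < n) tnth y i * (Num.sqrt 2 * u * tnth x i)))).
    rewrite ler_wpM2r ?mulr_ge0 ?expR_ge0// ler_wpM2r ?expR_ge0//; exact: f_le.
  have -> : expR (- ((1 + a) / 2 * sqnorm y)) =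
     expR (- (a * sqnorm y) / 2) * expR (- (2^-1 * sqnorm y)).
    by rewrite -expRD; congr expR; field.
  by ring.
rewrite sum_sqr -exponent expRD /barg_cst le_eqVlt; apply/orP; left; apply/eqP; ring.
Qed.

Let Bk (z : C) (xi : n.-tuple R) : C := Complex (expR (- (2^-1 * sqnorm xi))) 0 *
  cexp (Complex (rdot x xi) 0 * (Complex 0 1 * z) + Complex 2^-1 0 * z ^+ 2).

Let cmeas_Bk z : cmeas (Bk z).
Proof.
apply: cmeasM; first exact: cmeas_gauss.
apply: cmeas_cexp; apply: cmeasD; last exact: cmeas_cst.
by apply: cmeasM; [apply: cmeas_real; exact: measurable_rdot|exact: cmeas_cst].
Qed.

Let cmod_Bk z xi : cmod (Bk z xi) <=
  expR (cmod (Complex 2^-1 0 * z ^+ 2)) * expR (cmod z ^+ 2 * 2 / (2 * 2^-1)) *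
  expR (- (2^-1 / 2 * sqnorm xi)).
Proof.
set t := cmod (Complex 2^-1 0 * _).
rewrite cmodM cmod_real ger0_norm ?expR_ge0// cmod_cexp mulrC -mulrA.
apply: le_trans (ler_wpM2l (expR_ge0 _) (exp_lin_gauss (cmod z) half_gt0 (@ltr0Sn R 1) (rdot_le xi x_le1))).
rewrite [leRHS]mulrA ler_wpM2r ?expR_ge0// -expRD ler_expR.
apply: le_trans (ler_norm _) _; apply: le_trans (ler_Re_cmod _) _.
apply: le_trans (ler_cmodD _ _) _; rewrite addrC lerD2l 2!cmodM cmod_real.
have -> : cmod (Complex 0 1 : C) = 1 by rewrite /cmod /= expr0n expr1n add0r sqrtr1.
by rewrite mul1r mulrC.
Qed.

Let kappa : R := (2 * pi) `^ (- (n%:R) / 2).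

Let kappaE : kappa * gauss_mass 2^-1 ^+ n = 1.
Proof.
rewrite /kappa /gauss_mass invrK.
have p0 : 0 < 2 * pi :> R by rewrite mulr_gt0// pi_gt0.
rewrite (mulrC pi) -powR12_sqrt ?(ltW p0)// -powR_mulrn ?powR_ge0// -powRrM.
rewrite (mulrC 2^-1).
rewrite -powRD; last by rewrite (gt_eqF p0) implybT.
by rewrite mulNr addNr powRr0.
Qed.

(* Gaussian Fourier inversion on the kernel side: the Bargmann transform of the
   Fourier transform of f is that of f, rotated by i. *)
Let bargmann_fourier z : bargmann z = cint (fun xi => fourier f xi * Bk z xi).
Proof.
pose E xi y : C := f y * expi (- dotp xi y) * (Complex kappa 0 * Bk z xi).
pose K1 := expR (cmod (Complex 2^-1 0 * z ^+ 2)) * expR (cmod z ^+ 2 * 2 / (2 * 2^-1)).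
(* The exchange of integrals needs one Gaussian rate in both variables: f decays at rate a/2 in y,
   and [Bk] keeps rate 1/4 in xi. *)
pose c := Num.min (a / 2) (2^-1 / 2).
have a2 : 0 < a / 2 by rewrite divr_gt0.
have h2 : 0 < 2^-1 / 2 :> R by rewrite divr_gt0.
have c0 : 0 < c by rewrite lt_min a2 h2.
have K10 : 0 <= K1 by rewrite mulr_ge0 ?expR_ge0.
have kap0 : 0 <= kappa by exact: powR_ge0.
have Eb xi y : cmod (E xi y) <=
    `|C0| * kappa * `|K1| * expR (- (c * sqnorm xi)) * expR (- (c * sqnorm y)).
  rewrite /E cmodM [cmod (f y * _)]cmodM [cmod (Complex kappa 0 * _)]cmodM.
  rewrite cmod_expi mulr1 cmod_real (ger0_norm kap0).
  rewrite [leRHS](_ : _ = `|C0| * expR (- (c * sqnorm y)) * (kappa * (`|K1| * expR (- (c * sqnorm xi))))); last by ring.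
  apply: ler_pM; rewrite ?cmod_ge0 ?mulr_ge0 ?cmod_ge0//.
    by apply: le_trans (f_le' y) (gauss_weaken _ _ _); rewrite ge_min lexx.
  rewrite ler_wpM2l//.
  by apply: le_trans (cmod_Bk z xi) (gauss_weaken _ _ _); rewrite ge_min lexx orbT.
have mdot : measurable_fun setT (fun p : n.-tuple R * n.-tuple R => - dotp p.1 p.2).
  apply: measurableT_comp => //; apply: measurable_sum => i; apply: measurable_funM.
    by apply: (measurableT_comp (measurable_tnth i)).
  by apply: (measurableT_comp (measurable_tnth i)).
have mexpi : cmeas (fun p : n.-tuple R * n.-tuple R => expi (- dotp p.1 p.2)).
  under eq_fun do rewrite -cexp_expi.
  apply: cmeas_cexp; split => //=.
have mE : cmeas (fun p : n.-tuple R * n.-tuple R => E p.1 p.2).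
  apply: cmeasM; first by apply: cmeasM => //; exact: (cmeas_comp (g := snd)).
  by apply: cmeasM; [exact: cmeas_cst|exact: (cmeas_comp (g := fst))].
have sw := cint_swap c0 mE Eb.
have gf xi : cgd (fun y => f y * expi (- dotp xi y)).
  split.
    apply: cmeasM => //.
    by apply: (cmeas_comp (g := pair xi) _ mexpi); exact: pair1_measurable.
  exists C0, (a / 2); split=> // y; by rewrite cmodM cmod_expi mulr1.
have L : cint (fun xi => cint (fun y => E xi y)) = cint (fun xi => fourier f xi * Bk z xi).
  apply: eq_cint => xi; rewrite /E /fourier.
  rewrite (eq_cint (G := fun y => (Complex kappa 0 * Bk z xi) * (f y * expi (- dotp xi y)))).
    by rewrite cintZ// -/kappa; ring.
  by move=> y; rewrite mulrC.
rewrite -L sw; apply: eq_cint => y.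
(* All terms linear in xi, from the Fourier phase and from [Bk], so that the inner integral is the
   one of [cint_gauss] at rate 1/2. *)
pose w i : C := Complex 0 1 * (Complex (Num.sqrt 2) 0 * z * Complex (tnth x i) 0 - Complex (tnth y i) 0).
have s2 : Complex (Num.sqrt 2) 0 ^+ 2 = 2 :> C.
  by rewrite expr2 -CplxM -expr2 sqr_sqrtr// ComplexMn mul0rn.
have i2 : Complex 0 1 ^+ 2 = -1 :> C by exact: sqr_i.
have sumw xi : \sum_(i < n) Complex (tnth xi i) 0 * w i =
   Complex (rdot x xi) 0 * (Complex 0 1 * z) + Complex 0 (- dotp xi y).
  have -> : Complex 0 (- dotp xi y) = - Complex 0 1 * Complex (dotp xi y) 0 :> C.
    by apply: complexP => /=; ring.
  rewrite /rdot CplxM /dotp !Cplx_sum !mulr_sumr mulr_suml -big_split /=.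
  by apply: eq_bigr => i _; rewrite /w !CplxM; ring.
have sumw2 : \sum_(i < n) w i ^+ 2 =
   - (2 * z ^+ 2) + 2 * (Complex (rdot x y) 0 * z) - Complex (sqnorm y) 0.
  have -> : 2 * z ^+ 2 = 2 * z ^+ 2 * Complex (sqnorm x) 0 by rewrite x1 mulr1.
  rewrite /rdot CplxM /dotp /sqnorm !Cplx_sum !mulr_sumr mulr_suml mulr_sumr.
  rewrite -!sumrN -!big_split /=; apply: eq_bigr => i _.
  by rewrite /w exprMn i2 sqrrB !exprMn s2 ![Complex (_ ^+ 2) 0]CplxM CplxM; ring.
rewrite (eq_cint (G := fun xi => (f y * Complex kappa 0 * cexp (Complex 2^-1 0 * z ^+ 2)) *
   (Complex (expR (- (2^-1 * sqnorm xi))) 0 * cexp (\sum_(i < n) Complex (tnth xi i) 0 * w i)))); last first.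
  move=> xi; rewrite /E /Bk sumw !cexpD -cexp_expi; ring.
rewrite cintZ; last exact: cgd_gauss.
rewrite cint_gauss// sumw2 /gweight.
have -> : (4 * 2^-1)^-1 = 2^-1 :> R by field.
have powE (t : R) k : Complex t 0 ^+ k = Complex (t ^+ k) 0 :> C.
  by elim: k => [//|k IH]; rewrite !exprS IH CplxM.
rewrite powE -cexp_real.
transitivity (f y * (Complex kappa 0 * Complex (gauss_mass 2^-1 ^+ n) 0) *
  (cexp (Complex 2^-1 0 * z ^+ 2) * cexp (Complex 2^-1 0 *
   (- (2 * z ^+ 2) + 2 * (Complex (rdot x y) 0 * z) - Complex (sqnorm y) 0)))); last by ring.
rewrite -CplxM kappaE mulr1 -mulrA -!cexpD; congr (_ * cexp _).
have h : (2 : C) * Complex 2^-1 0 = 1.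
  have -> : (2 : C) = Complex 2 0 by rewrite ComplexMn mul0rn.
  by rewrite -CplxM divff.
have -> : Complex (- (2^-1 * sqnorm y)) 0 = - (Complex 2^-1 0 * Complex (sqnorm y) 0) :> C.
  by rewrite -CplxM; apply: complexP => //=; rewrite oppr0.
have -> : Complex (- 2^-1) 0 = - Complex 2^-1 0 :> C.
  by apply: complexP => //=; rewrite oppr0.
move: (Complex 2^-1 0 : C) h => H h.
have -> : H * (- (2 * z ^+ 2) + 2 * (Complex (rdot x y) 0 * z) - Complex (sqnorm y) 0) =
  (2 * H) * (- z ^+ 2 + Complex (rdot x y) 0 * z) - H * Complex (sqnorm y) 0 by ring.
rewrite h.
have -> : - z ^+ 2 = - (2 * H) * z ^+ 2 by rewrite h mulN1r.
by ring.
Qed.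

(** The estimate of [bargmann_real] repeated on [bargmann_fourier]: there the kernel is evaluated at
    i z, whose real part is -v, so u and v exchange roles. *)
Lemma bargmann_imag z : cmod (bargmann z) <=
  barg_cst * expR ((complex.Re z ^+ 2 + (1 - a) / (1 + a) * complex.Im z ^+ 2) / 2).
Proof.
set u := complex.Re z; set v := complex.Im z.
rewrite bargmann_fourier.
have mfh : cmeas (fourier f).
  apply: cmeasM; first exact: cmeas_cst.
  have mexpi : cmeas (fun p : n.-tuple R * n.-tuple R => f p.2 * expi (- dotp p.1 p.2)).
    apply: cmeasM; first exact: (cmeas_comp (g := snd)).
    under eq_fun do rewrite -cexp_expi.
    apply: cmeas_cexp; split => //=.
    apply: measurableT_comp => //; apply: measurable_sum => i; apply: measurable_funM.
      by apply: (measurableT_comp (measurable_tnth i)).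
    by apply: (measurableT_comp (measurable_tnth i)).
  apply: (@cmeas_cint _ _ _ _ (fun p => f p.2 * expi (- dotp p.1 p.2)) (fun=> C0) (a / 2)) => //.
    by rewrite divr_gt0.
  by move=> p; rewrite cmodM cmod_expi mulr1.
have fhb xi : cmod (fourier f xi) <= C0.
  apply: le_trans (fh_le xi) _; rewrite ler_piMr// expR_le1 mulNr oppr_le0.
  by rewrite divr_ge0// mulr_ge0 ?sqnorm_ge0// ltW.
apply: le_trans (@cmod_cint_gauss _ _ _ ((1 + a) / 2) (C0 * expR (- ((v ^+ 2 - u ^+ 2) / 2)))
  (fun i => Num.sqrt 2 * (- v) * tnth x i) c_gt0 _ _) _.
- split; first exact: cmeasM.
  exists (C0 * (expR (cmod (Complex 2^-1 0 * z ^+ 2)) * expR (cmod z ^+ 2 * 2 / (2 * 2^-1)))), (2^-1 / 2).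
  split; first by rewrite divr_gt0.
  by move=> y; rewrite cmodM -mulrA; apply: ler_pM; rewrite ?cmod_ge0// cmod_Bk.
- move=> y; rewrite cmodM [cmod (Bk z y)]cmodM cmod_real cmod_cexp ger0_norm ?expR_ge0//.
  have -> : complex.Re (Complex (rdot x y) 0 * (Complex 0 1 * z) + Complex 2^-1 0 * z ^+ 2) =
      - ((v ^+ 2 - u ^+ 2) / 2) + \sum_(i < n) tnth y i * (Num.sqrt 2 * (- v) * tnth x i).
    have -> : \sum_(i < n) tnth y i * (Num.sqrt 2 * (- v) * tnth x i) = rdot x y * (- v).
      by rewrite /rdot /dotp mulrAC mulr_sumr; apply: eq_bigr => i _; ring.
    by rewrite expr2 !ReImE /= -/u -/v; field.
  rewrite expRD.
  rewrite [leRHS](_ : _ = C0 * expR (- (a * sqnorm y) / 2) * (expR (- (2^-1 * sqnorm y)) *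
    (expR (- ((v ^+ 2 - u ^+ 2) / 2)) * expR (\sum_(i < n) tnth y i * (Num.sqrt 2 * (- v) * tnth x i))))).
    by rewrite ler_wpM2r ?mulr_ge0 ?expR_ge0// fh_le.
  have -> : expR (- ((1 + a) / 2 * sqnorm y)) =
     expR (- (a * sqnorm y) / 2) * expR (- (2^-1 * sqnorm y)).
    by rewrite -expRD; congr expR; field.
  by ring.
rewrite sum_sqr sqrrN [X in expR (X / 2)]addrC -exponent expRD /barg_cst le_eqVlt.
by apply/orP; left; apply/eqP; ring.
Qed.

End UnitVector.
End BargmannBounds.

(** * Hermite coefficients *)

Section HermiteCoefficients.
Variable R : realType.
Local Notation C := R[i].

Lemma tanh_gt0 (t : R) : 0 < t -> 0 < tanh t.
Proof.
move=> t0; apply: divr_gt0; last by rewrite addr_gt0 ?expR_gt0.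
by rewrite subr_gt0 ltr_expR (lt_trans _ t0)// oppr_lt0.
Qed.

(** At t = 2 gamma this identifies the coefficient (1 - a)/(1 + a) of the Bargmann bounds with
    beta^2. *)
Lemma tanh_ratio (t : R) : (1 - tanh t) / (1 + tanh t) = expR (- t) ^+ 2.
Proof.
rewrite /tanh expRN; have := expR_gt0 t; move: (expR t) => E E0.
have h1 : E + E^-1 != 0 by rewrite gt_eqF// addr_gt0// invr_gt0.
have h2 : E != 0 by rewrite gt_eqF.
have h3 : E * E + 1 != 0 by rewrite gt_eqF// addr_gt0// mulr_gt0.
have -> : 1 - (E - E^-1) / (E + E^-1) = 2 * E^-1 / (E + E^-1).
  by field; rewrite h3 h2.
have -> : 1 + (E - E^-1) / (E + E^-1) = 2 * E / (E + E^-1).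
  by field; rewrite h3 h2.
by field; rewrite h3 h2.
Qed.

Variables (n : nat) (f : n.-tuple R -> C) (gamma C0 : R).
Let a := tanh (2 * gamma).
Hypotheses (gamma_gt0 : 0 < gamma) (C0_ge0 : 0 <= C0) (mf : cmeas f).
Hypothesis f_le : forall y, cmod (f y) <= C0 * expR (- (a * sqnorm y) / 2).
Hypothesis fh_le : forall xi, cmod (fourier f xi) <= C0 * expR (- (a * sqnorm xi) / 2).

Let a_gt0 : 0 < a. Proof. by apply: tanh_gt0; rewrite mulr_gt0. Qed.
Let beta := expR (- (2 * gamma)).
Let beta_gt0 : 0 < beta. Proof. exact: expR_gt0. Qed.
Let beta_lt1 : beta < 1. Proof. by rewrite expR_lt1 oppr_lt0 mulr_gt0. Qed.

Definition hermite_cst : R := barg_cst n a C0 * coef_cst beta.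

Lemma hermite_cst_ge0 : 0 <= hermite_cst.
Proof.
by apply: mulr_ge0; [exact: barg_cst_ge0|apply: ltW; exact: coef_cst_gt0].
Qed.

(** The bound of [coefficient_bound] at r = sqrt k exp(gamma), the radius with beta r^2 = k. *)
Definition hermite_bound (k : nat) : R :=
  hermite_cst * expR (k%:R / 2) / Num.sqrt k%:R / (Num.sqrt k%:R * expR gamma) ^+ k.

Lemma hermite_bound_ge0 k : 0 <= hermite_bound k.
Proof.
apply: divr_ge0; last by apply: exprn_ge0; rewrite mulr_ge0 ?expR_ge0 ?sqrtr_ge0.
apply: divr_ge0; last exact: sqrtr_ge0.
by apply: mulr_ge0; [exact: hermite_cst_ge0|exact: expR_ge0].
Qed.

Lemma kernel_coef_unit x k : sqnorm x = 1 -> (0 < k)%N ->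
  cmod (kernel_coef (gweight f) (rdot x) (- 2^-1) k) <= hermite_bound k.
Proof.
move=> x1 k0; have kR : 0 < k%:R :> R by rewrite ltr0n.
have sk : 0 < Num.sqrt (k%:R : R) by rewrite sqrtr_gt0.
pose r := Num.sqrt k%:R * expR gamma.
have r0 : 0 < r by rewrite mulr_gt0 ?expR_gt0.
have br : beta * r ^+ 2 = k%:R.
  rewrite /r exprMn sqr_sqrtr ?ltW// mulrCA /beta -expRM_natl -expRD.
  by rewrite addNr expR0 mulr1.
have HR z := bargmann_real a_gt0 C0_ge0 mf f_le x1 z.
have HI z := bargmann_imag a_gt0 C0_ge0 mf f_le fh_le x1 z.
rewrite tanh_ratio -/beta in HR; rewrite tanh_ratio -/beta in HI.
rewrite /hermite_bound ler_pdivlMr ?exprn_gt0//.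
apply: (coefficient_bound beta_gt0 beta_lt1 (barg_cst_ge0 n a C0_ge0)
  (bargmann_psum_cvg a_gt0 C0_ge0 mf f_le x1)) => //.
Qed.

(** The factor |x|^2 in the second argument of [hq] makes the integral homogeneous of degree k in x,
    so the bound passes from the sphere to the ball, where the quadrature nodes lie. *)
Lemma kernel_coef_ball x k : sqnorm x <= 1 -> (0 < k)%N ->
  cmod (cint (fun y => gweight f y *
    Complex (hq (rdot x y) (sqnorm x * - 2^-1) k) 0)) <= hermite_bound k.
Proof.
move=> x1 k0; have := sqnorm_ge0 x; rewrite le_eqVlt => /predU1P[x0|x0].
  have z y : rdot x y = 0.
    have := dotp_cauchy_schwarz x y; rewrite -x0 mul0r => h.
    have : dotp x y ^+ 2 = 0 by apply/eqP; rewrite eq_le h sqr_ge0.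
    by move/eqP; rewrite sqrf_eq0 /rdot => /eqP ->; rewrite mulr0.
  rewrite (eq_cint (G := fun=> 0)) ?cint0 ?cmod0 ?hermite_bound_ge0// => y.
  by rewrite z -x0 mul0r hq00 (gtn_eqF k0) mulr0.
pose s := Num.sqrt (sqnorm x).
have s0 : 0 < s by rewrite sqrtr_gt0.
have s2 : s ^+ 2 = sqnorm x by rewrite sqr_sqrtr// ltW.
have s1 : s <= 1 by rewrite -sqrtr1 ler_wsqrtr.
pose x' := [tuple tnth x i / s | i < n].
have x'1 : sqnorm x' = 1.
  rewrite /sqnorm; under eq_bigr do rewrite tnth_mktuple exprMn.
  by rewrite -mulr_suml -/(sqnorm x) -s2 exprVn divff// expf_neq0// gt_eqF.
have dx y : rdot x y = s * rdot x' y.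
  rewrite /rdot mulrCA; congr (_ * _); rewrite /dotp mulr_sumr.
  apply: eq_bigr => i _; rewrite tnth_mktuple; field; by rewrite gt_eqF.
rewrite (eq_cint (G := fun y => Complex (s ^+ k) 0 *
   (gweight f y * Complex (hq (rdot x' y) (- 2^-1) k) 0))); last first.
  by move=> y; rewrite dx -s2 hq_scale CplxM; ring.
rewrite cintZ; last by apply: (cgd_gweight_hq a_gt0 C0_ge0 mf f_le); rewrite x'1.
rewrite cmodM cmod_real ger0_norm ?exprn_ge0 ?(ltW s0)//.
apply: le_trans (kernel_coef_unit x'1 k0); rewrite /kernel_coef ler_piMl ?cmod_ge0//.
by rewrite exprn_ile1// ltW.
Qed.

Section MultiIndex.
Variable al : n.-tuple nat.
Let k := msize al.
Hypotheses (k_gt0 : (0 < k)%N) (n_gt0 : (0 < n)%N).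

Let kR : 0 < k%:R :> R. Proof. by rewrite ltr0n. Qed.
Let sk : 0 < Num.sqrt (k%:R : R). Proof. by rewrite sqrtr_gt0. Qed.

Let al_le i : (tnth al i <= k)%N.
Proof. by rewrite /k /msize (bigD1 i)//= leq_addr. Qed.

Definition hprod (y : n.-tuple R) : R :=
  \prod_(i < n) hq (Num.sqrt 2 * tnth y i) (- 2^-1) (tnth al i).

(** These radii maximize the monomial rho^al on the unit sphere, and rho^al supplies the powers
    al_i^(al_i/2) that Stirling's formula asks for. *)
Let rho (i : 'I_n) : R := Num.sqrt (tnth al i)%:R / Num.sqrt k%:R.

Let rho_sqr_sum : \sum_(i < n) rho i ^+ 2 = 1.
Proof.
under eq_bigr do rewrite exprMn exprVn !sqr_sqrtr ?ler0n//.
by rewrite -mulr_suml -natr_sum divff// gt_eqF.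
Qed.

Let hermite_multiE y : hermite_multi al y =
  (\prod_(i < n) (Num.sqrt (tnth al i)`!%:R / Num.sqrt (Num.sqrt pi))) *
  (hprod y * expR (- (2^-1 * sqnorm y))).
Proof.
have -> : expR (- (2^-1 * sqnorm y)) = \prod_(i < n) expR (- tnth y i ^+ 2 / 2).
  rewrite /sqnorm mulr_sumr -sumrN expR_sum; apply: eq_bigr => i _.
  by rewrite mulrC mulNr.
rewrite /hprod -!big_split /=; apply: eq_bigr => i _.
by rewrite hermite_hq; ring.
Qed.

Let J := k.*2.+1.
Let node (phi : {ffun 'I_n -> 'I_J}) : n.-tuple R :=
  [tuple rho i * cos (qnode R J (phi i)) | i < n].

Let node_le1 phi : sqnorm (node phi) <= 1.
Proof.
rewrite -rho_sqr_sum /sqnorm; apply: ler_sum => i _; rewrite tnth_mktuple exprMn.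
by rewrite ler_piMr ?sqr_ge0// -real_normK ?num_real// exprn_ile1 ?cos_max.
Qed.

Let hprod_extract y : hprod y * \prod_(i < n) rho i ^+ tnth al i =
  \sum_(phi : {ffun 'I_n -> 'I_J}) (\prod_(i < n) qweight R J (tnth al i) (phi i)) *
    hq (rdot (node phi) y) (sqnorm (node phi) * - 2^-1) k.
Proof.
rewrite /hprod -big_split /= (hq_extract _ _ rho (tnth al)); apply: eq_bigr => phi _.
congr (_ * hq _ _ _).
  rewrite /rdot /dotp mulr_sumr; apply: eq_bigr => i _; rewrite tnth_mktuple; ring.
by rewrite /sqnorm mulr_suml; apply: eq_bigr => i _; rewrite tnth_mktuple.
Qed.

Let wt (phi : {ffun 'I_n -> 'I_J}) : R := \prod_(i < n) qweight R J (tnth al i) (phi i).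
Let rp : R := \prod_(i < n) rho i ^+ tnth al i.

Let rp_ge0 : 0 <= rp.
Proof. by apply: prodr_ge0 => i _; rewrite exprn_ge0// divr_ge0 ?sqrtr_ge0. Qed.

Let rp_neq0 : rp != 0.
Proof.
(* A zero index makes the radius 0, but then the factor is its power 0, which is 1. *)
apply/prodf_neq0 => i _; case: (posnP (tnth al i)) => [->|m0].
  by rewrite expr0 oner_eq0.
by rewrite expf_neq0// mulf_neq0 ?invr_eq0 ?(gt_eqF sk)// gt_eqF// sqrtr_gt0 ltr0n.
Qed.

Let gweight_hprodE y : gweight f y * Complex (hprod y) 0 = Complex rp^-1 0 *
  \sum_(phi : {ffun 'I_n -> 'I_J}) Complex (wt phi) 0 *
    (gweight f y * Complex (hq (rdot (node phi) y) (sqnorm (node phi) * - 2^-1) k) 0).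
Proof.
have -> : hprod y = rp^-1 * (hprod y * rp) by field.
rewrite hprod_extract CplxM Cplx_sum !mulr_sumr; apply: eq_bigr => phi _.
by rewrite CplxM; ring.
Qed.

Let cgd_node phi : cgd (fun y => Complex (wt phi) 0 * (gweight f y *
  Complex (hq (rdot (node phi) y) (sqnorm (node phi) * - 2^-1) k) 0)).
Proof. by apply: cgdZ; exact: (cgd_gweight_hq a_gt0 C0_ge0 mf f_le). Qed.

Let cgd_hprod : cgd (fun y => gweight f y * Complex (hprod y) 0).
Proof.
under eq_fun do rewrite gweight_hprodE.
by apply: cgdZ; exact: cgd_sum.
Qed.

(** There are J^n node choices, each of weight at most 2^k / J^n. *)
Let hprod_bound_ge2 : cmod (cint (fun y => gweight f y * Complex (hprod y) 0)) * rp
  <= 2 ^+ k * hermite_bound k.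
Proof.
rewrite (eq_cint gweight_hprodE) cintZ; last exact: cgd_sum.
rewrite cint_sum//.
rewrite cmodM cmod_real ger0_norm ?invr_ge0// mulrAC mulVf// mul1r.
apply: le_trans (ler_cmod_sum _ _ _) _.
apply: (@le_trans _ _ (\sum_(phi : {ffun 'I_n -> 'I_J}) 2 ^+ k / J%:R ^+ n * hermite_bound k)).
  apply: ler_sum => phi _.
  rewrite cintZ; last exact: (cgd_gweight_hq a_gt0 C0_ge0 mf f_le).
  rewrite cmodM cmod_real; apply: ler_pM; rewrite ?cmod_ge0 ?kernel_coef_ball//.
  rewrite /wt normr_prod.
  have -> : 2 ^+ k / J%:R ^+ n = \prod_(i < n) (2 ^+ tnth al i / J%:R) :> R.
    by rewrite big_split /= prodr_const card_ord prodrXr exprVn.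
  by apply: ler_prod => i _; rewrite normr_ge0 norm_qweight.
rewrite sumr_const card_ffun !card_ord -[leLHS]mulr_natl natrX.
have JR : J%:R ^+ n != 0 :> R by rewrite expf_neq0// pnatr_eq0.
by move: (J%:R ^+ n) JR => X X0; rewrite mulrA (mulrC X) mulfVK.
Qed.

(** For n = 1 the factor is 1 and the loss 2^k is not affordable; there the integral is itself a
    Taylor coefficient, at the unit vector 1, and no extraction is made. *)
Let hprod_bound : cmod (cint (fun y => gweight f y * Complex (hprod y) 0)) * rp
  <= n%:R ^+ k * hermite_bound k.
Proof.
have [n2|n1] := leqP 2 n.
  apply: le_trans hprod_bound_ge2 _; rewrite ler_wpM2r ?hermite_bound_ge0//.
  by rewrite lerXn2r ?nnegrE// ler_nat.
have {n1}n1 : n = 1%N by apply/eqP; rewrite eqn_leq n_gt0 -ltnS n1.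
have i0 (i : 'I_n) : tnth al i = k.
  rewrite /k /msize (bigD1 i)//= big1 ?addn0// => j /eqP ji; exfalso; apply: ji.
  by apply: val_inj => /=; have := ltn_ord i; have := ltn_ord j; lia.
have r1 i : rho i = 1 by rewrite /rho i0 divff// gt_eqF.
rewrite /rp big1 => [|i _]; last by rewrite r1 expr1n.
have -> : n%:R = 1 :> R by rewrite n1.
rewrite mulr1 expr1n mul1r.
pose x := [tuple (1 : R) | i < n].
have x1 : sqnorm x = 1.
  rewrite /sqnorm; under eq_bigr do rewrite tnth_mktuple expr1n.
  by rewrite sumr_const card_ord n1.
apply: le_trans (kernel_coef_unit x1 k_gt0); rewrite le_eqVlt; apply/orP; left; apply/eqP.
congr cmod; apply: eq_cint => y; congr (_ * Complex _ 0).
rewrite /hprod.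
have -> : rdot x y = Num.sqrt 2 * \sum_(i < n) tnth y i.
  by rewrite /rdot /dotp; congr (_ * _); apply: eq_bigr => i _; rewrite tnth_mktuple mul1r.
have o : (0 < n)%N by rewrite n1.
have only (i : 'I_n) : i = Ordinal o.
  by apply: val_inj => /=; have := ltn_ord i; lia.
rewrite (bigD1 (Ordinal o))//= big1 ?mulr1 => [|i]; last by rewrite [X in X != _]only eqxx.
rewrite (bigD1 (Ordinal o))//= big1 ?addr0 => [|i]; last by rewrite [X in X != _]only eqxx.
by rewrite i0.
Qed.

Let q := Num.sqrt (Num.sqrt (k%:R : R)).

Let q_ge1 : 1 <= q.
Proof. by rewrite -sqrtr1 ler_wsqrtr// -[leLHS]sqrtr1 ler_wsqrtr// ler1n. Qed.

(** The square root of Stirling's bound, with al_i^(1/4) enlarged to q = k^(1/4). One such q per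
    coordinate gives k^(n/4). *)
Let fact_bound i : Num.sqrt (tnth al i)`!%:R <= rho i ^+ tnth al i *
  (expR (1 / 2) * q * Num.sqrt k%:R ^+ tnth al i * expR (- ((tnth al i)%:R / 2))).
Proof.
rewrite /rho; have := al_le i; move: (tnth al i) => m mk.
(* Stirling's bound fails at 0, where its right side vanishes; q >= 1 covers this case. *)
case: (posnP m) => [->|m0].
  rewrite fact0 sqrtr1 !expr0 mul1r mul0r oppr0 expR0 !mulr1.
  by rewrite -[leLHS]mul1r ler_pM// -expR0 ler_expR.
have mR : 0 < m%:R :> R by rewrite ltr0n.
have sm : 0 < Num.sqrt (m%:R : R) by rewrite sqrtr_gt0.
rewrite [leRHS](_ : _ = expR (1 / 2) * q * Num.sqrt m%:R ^+ m * expR (- (m%:R / 2))); last first.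
  rewrite exprMn exprVn; field; by rewrite expf_neq0// gt_eqF.
rewrite expRN ler_pdivlMr ?expR_gt0//.
rewrite -(@ler_pXn2r _ 2)// ?nnegrE ?mulr_ge0 ?exprn_ge0 ?expR_ge0 ?sqrtr_ge0//.
rewrite !exprMn -[(Num.sqrt m%:R ^+ m) ^+ 2]exprM mulnC exprM.
rewrite !sqr_sqrtr ?sqrtr_ge0 ?ler0n// -!expRM_natl.
have -> : 2 * (m%:R / 2) = m%:R :> R by field.
have -> : 2 * (1 / 2) = 1 :> R by field.
apply: le_trans (stirling_upper R m0) _.
rewrite ler_wpM2r ?exprn_ge0 ?(ltW mR)// ler_wpM2l ?expR_ge0//.
by rewrite ler_wsqrtr// ler_nat.
Qed.

(** The factors exp(-al_i/2) of [fact_bound] cancel exp(k/2) in [hermite_bound], and sqrt k^k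
    cancels as well, which leaves exp(-gamma k) and q^n / sqrt k. The powers of pi in the
    normalization are at most 1 and are dropped. *)
Lemma hermite_coef_bound : cmod (hermite_coef f al) <=
  hermite_cst * expR (1 / 2) ^+ n * n%:R ^+ k * (q ^+ n / Num.sqrt k%:R) *
  expR (- (gamma * k%:R)).
Proof.
pose I := cint (fun y => gweight f y * Complex (hprod y) 0).
pose ca := \prod_(i < n) (Num.sqrt (tnth al i)`!%:R / Num.sqrt (Num.sqrt pi)) : R.
have ca0 : 0 <= ca by apply: prodr_ge0 => i _; rewrite divr_ge0 ?sqrtr_ge0.
have -> : hermite_coef f al = Complex ca 0 * I.
  rewrite /hermite_coef /I -cintZ//; apply: eq_cint => y.
  by rewrite hermite_multiE /gweight !CplxM; ring.
rewrite cmodM cmod_real ger0_norm//.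
pose B := \prod_(i < n) (expR (1 / 2) * q * Num.sqrt k%:R ^+ tnth al i * expR (- ((tnth al i)%:R / 2))).
have BE : B = expR (1 / 2) ^+ n * q ^+ n * Num.sqrt k%:R ^+ k * expR (- (k%:R / 2)).
  rewrite /B !big_split /= !prodr_const card_ord prodrXr; congr (_ * _).
  by rewrite -expR_sum sumrN -mulr_suml -natr_sum.
have B0 : 0 <= B.
  by apply: prodr_ge0 => i _; rewrite !mulr_ge0 ?expR_ge0 ?exprn_ge0 ?sqrtr_ge0.
have caB : ca <= rp * B.
  rewrite /rp /B -big_split /=; apply: ler_prod => i _.
  rewrite divr_ge0 ?sqrtr_ge0//=; apply: le_trans (fact_bound i).
  rewrite ler_piMr ?sqrtr_ge0// invf_le1 ?sqrtr_gt0 ?pi_gt0//.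
  have pi1 : 1 <= pi :> R by apply: le_trans (@pi_ge2 R); rewrite ler1n.
  by rewrite -sqrtr1 ler_wsqrtr// -[leLHS]sqrtr1 ler_wsqrtr.
apply: le_trans (ler_wpM2r (cmod_ge0 _) caB) _.
have -> : rp * B * cmod I = cmod I * rp * B by ring.
apply: le_trans (ler_wpM2r B0 hprod_bound) _.
rewrite BE /hermite_bound le_eqVlt; apply/orP; left; apply/eqP.
have -> : expR (- (gamma * k%:R)) = (expR gamma ^+ k)^-1.
  by rewrite expRN (mulrC gamma) expRM_natl.
rewrite expRN exprMn.
have e0 : expR (k%:R / 2) != 0 :> R by rewrite gt_eqF// expR_gt0.
have g0 : expR gamma ^+ k != 0 :> R by rewrite expf_neq0// gt_eqF// expR_gt0.
have s0 : Num.sqrt k%:R ^+ k != 0 :> R by rewrite expf_neq0// gt_eqF.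
have s1 : Num.sqrt k%:R != 0 :> R by rewrite gt_eqF.
move: (Num.sqrt k%:R) (expR (k%:R / 2)) (expR gamma ^+ k) (Num.sqrt k%:R ^+ k) e0 g0 s0 s1.
by move=> t e g s e0 g0 s0 t0; field; rewrite e0 g0 s0 t0.
Qed.

End MultiIndex.
End HermiteCoefficients.

Theorem theorem3p4 (R : realType) (d : nat) (gamma : R)
    (f : d.-tuple R -> R[i]) :
  (1 <= d)%N -> 0 < gamma -> hardy_class (tanh (2 * gamma)) f ->
  exists C : R, 0 < C /\
    forall al : d.-tuple nat, (0 < msize al)%N ->
      cmod (hermite_coef f al) <=
        C * d%:R ^+ msize al * (msize al)%:R `^ ((d%:R - 2) / 4)
          * expR (- (gamma * (msize al)%:R)).
Proof.
move=> d1 g0 [[mR mI _ _] [C0 [C0_gt0 [f_le fh_le]]]].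
pose K := hermite_cst d gamma C0 * expR (1 / 2) ^+ d.
have K0 : 0 <= K.
  by rewrite mulr_ge0 ?exprn_ge0 ?expR_ge0// hermite_cst_ge0// ltW.
(* K is only shown nonnegative; adding 1 makes the constant positive. *)
exists (K + 1); split; first by rewrite ltr_wpDl.
move=> al k0; set k := msize al.
have kR : 0 < k%:R :> R by rewrite ltr0n.
have pw : Num.sqrt (Num.sqrt k%:R) ^+ d / Num.sqrt k%:R = k%:R `^ ((d%:R - 2) / 4) :> R.
  rewrite -!powR12_sqrt ?powR_ge0 ?ler0n// -powRrM -powR_mulrn ?powR_ge0// -powRrM.
  rewrite -powRN -powRD; last by rewrite (gt_eqF kR) implybT.
  by congr (_ `^ _); field.
apply: le_trans (hermite_coef_bound g0 (ltW C0_gt0) (conj mR mI) f_le fh_le k0 d1) _.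
rewrite -/k pw -/K.
rewrite ler_wpM2r ?expR_ge0// ler_wpM2r ?powR_ge0// ler_wpM2r ?exprn_ge0//.
by rewrite lerDl.
Qed.
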